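(* Let $M$ be either $B_n^+$ or $B_n^{+*}$ ($n\ge2$). For a real $p\ge0$, there exists a uniform measure of parameter $p$ on $\overline M$ if and only if $p\in[0,q_n]\cup\{1\}$, and for each such $p$ it is unique; denote it $\nu_p$. Moreover: (1) $\nu_0$ is the Dirac measure at $\mathbf e$. (2) $\nu_1$ is the Dirac measure at the element $\Delta^\infty\in\overline M$, the constant sequence $(\Delta,\Delta,\dots)$. (3) For $p\in(0,q_n)$, $\nu_p$ is supported by $M$, and it is characterized equivalently by $\nu_p(\{x\})=H_n(p)\,p^{|x|}$ for all $x\in M$, or by $\nu_p(\Uparrow x)=p^{|x|}$ for all $x\in M$. (4) For $p=q_n$, $\nu_{q_n}$ is supported by $\partial M$, and it is the unique probability measure on $\overline M$ satisfying $\nu_{q_n}(\uparrow x)=q_n^{|x|}$ for all $x\in M$.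
   Context: $M$ is either (a) the positive braid monoid $B_n^+$, generated by $\Sigma=\{\sigma_1,\dots,\sigma_{n-1}\}$ with relations $\sigma_i\sigma_j=\sigma_j\sigma_i$ for $|i-j|\ge2$, $\sigma_i\sigma_j\sigma_i=\sigma_j\sigma_i\sigma_j$ for $|i-j|=1$; or (b) the dual braid monoid $B_n^{+*}$, generated by $\Sigma=\{\sigma_{i,j}:1\le i<j\le n\}$ ($\sigma_{j,i}=\sigma_{i,j}$) with relations $\sigma_{i,j}\sigma_{j,k}=\sigma_{j,k}\sigma_{k,i}=\sigma_{k,i}\sigma_{i,j}$ for $i<j<k$ and $\sigma_{i,j}\sigma_{k,\ell}=\sigma_{k,\ell}\sigma_{i,j}$ whenever $i<j<k<\ell$ or $i<k<\ell<j$. Unit $\mathbf e$; $|x|$ word length; $x\le_l y$ iff $y=xz$. $M$ is a Garside monoid; $\Delta_X$ is the least upper bound of $X\subseteq\Sigma$ for $\le_l$, $\Delta=\Delta_\Sigma$, $\mathcal S_n$ the set of left divisors of $\Delta$. For $x\in\mathcal S_n$, $\mathsf R(x)=\{\sigma\in\Sigma:x\sigma\notin\mathcal S_n\}$, $\mathsf L(x)=\{\sigma\in\Sigma:\sigma\le_l x\}$, $x\to y$ iff $\mathsf L(y)\subseteq\mathsf R(x)$. Every $x\neq\mathbf e$ has a unique Garside normal form $(x_1,\dots,x_k)$ (non-unit simple braids, $x=x_1\cdots x_k$, $x_i\to x_{i+1}$); the normal form of $\mathbf e$ is $(\mathbf e)$. $G_n(t)=\sum_{x\in M}t^{|x|}$,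 $H_n(t)=\sum_{X\subseteq\Sigma}(-1)^{|X|}t^{|\Delta_X|}$ (so that $G_n=1/H_n$), and $q_n$ is the radius of convergence of $G_n$. $\overline M$ is the set of sequences $(\xi_k)_{k\ge1}$ in $\mathcal S_n$ with $\xi_k\to\xi_{k+1}$ for all $k$, with product topology ($\mathcal S_n$ discrete) and Borel $\sigma$-algebra; $M$ is identified with sequences eventually equal to $\mathbf e$ via $x\mapsto$ its normal form followed by infinitely many $\mathbf e$; $\partial M=\overline M\setminus M$. $\Uparrow x$ is the closure in $\overline M$ of $\{xz:z\in M\}$ and $\uparrow x=\Uparrow x\cap\partial M$. A uniform measure of parameter $p\ge0$ is a probability measure $\nu$ on $\overline M$ with $\nu(\Uparrow x)=p^{|x|}$ for all $x\in M$. *)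

(* Defs.v *)
From HB Require Import structures.
From mathcomp Require Import all_boot all_order all_algebra.
From mathcomp Require Import all_classical all_reals all_analysis.

Set Implicit Arguments.
Unset Strict Implicit.
Unset Printing Implicit Defensive.

Import Order.TTheory GRing.Theory Num.Theory.
Local Open Scope classical_set_scope.

(** Which monoid: Artin = positive braid monoid B_n^+,
    Dual = dual (Birman-Ko-Lee) braid monoid B_n^{+*}. *)
Inductive kind := Artin | Dual.

(** Generators, encoded by pairs (i,j) of integers in {0..n} (only 1..n used):
    Artin : sigma_i  <-> (i, i+1) with 1 <= i <= n-1
    Dual  : sigma_{i,j} <-> (i, j) with 1 <= i < j <= n  (sigma_{j,i} = sigma_{i,j}) *)
Definition valid_gen (k : kind) (n : nat) (p : 'I_n.+1 * 'I_n.+1) : bool :=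
  let i := nat_of_ord p.1 in let j := nat_of_ord p.2 in
  match k with
  | Artin => (1 <= i)%N && (j == i.+1)
  | Dual => (1 <= i)%N && (i < j)%N
  end.

Definition gen (k : kind) (n : nat) := {p : 'I_n.+1 * 'I_n.+1 | valid_gen k p}.

Definition gv (k : kind) (n : nat) (s : gen k n) : nat * nat :=
  (nat_of_ord (proj1_sig s).1, nat_of_ord (proj1_sig s).2).

Definition word (k : kind) (n : nat) := seq (gen k n).

Definition rel_pair (k : kind) (l r : seq (nat * nat)) : Prop :=
  match k with
  | Artin => exists i j : nat,
      (((i.+2 <= j)%N || (j.+2 <= i)%N) /\
        l = [:: (i, i.+1); (j, j.+1)] /\ r = [:: (j, j.+1); (i, i.+1)])
   \/ (((j == i.+1) || (i == j.+1)) /\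
        l = [:: (i, i.+1); (j, j.+1); (i, i.+1)] /\
        r = [:: (j, j.+1); (i, i.+1); (j, j.+1)])
  | Dual =>
      (exists i j m : nat, (i < j < m)%N /\
        let tri := [:: [:: (i, j); (j, m)]; [:: (j, m); (i, m)]; [:: (i, m); (i, j)]] in
        l \in tri /\ r \in tri)
   \/ (exists i j m o : nat, ((i < j < m)%N && (m < o)%N || (i < m < o)%N && (o < j)%N) /\
        l = [:: (i, j); (m, o)] /\ r = [:: (m, o); (i, j)])
  end.

Inductive beq (k : kind) (n : nat) : word k n -> word k n -> Prop :=
| beq_refl u : beq u u
| beq_sym u v : beq u v -> beq v u
| beq_trans u v w : beq u v -> beq v w -> beq u w
| beq_step u v a b l r : rel_pair k l r ->
    map (@gv k n) u = a ++ l ++ b -> map (@gv k n) v = a ++ r ++ b -> beq u v.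

Definition M (k : kind) (n : nat) := {A : set (word k n) | exists w, A = beq w}.

HB.instance Definition _ k n := gen_eqMixin (M k n).
HB.instance Definition _ k n := gen_choiceMixin (M k n).

Definition cls (k : kind) (n : nat) (w : word k n) : M k n :=
  exist _ (beq w) (ex_intro _ w erefl).

Definition rep (k : kind) (n : nat) (x : M k n) : word k n :=
  proj1_sig (cid (proj2_sig x)).

Definition unitM (k : kind) (n : nat) : M k n := cls [::].
Definition mulM (k : kind) (n : nat) (x y : M k n) : M k n := cls (rep x ++ rep y).
Definition len (k : kind) (n : nat) (x : M k n) : nat := size (rep x).
Definition genM (k : kind) (n : nat) (s : gen k n) : M k n := cls [:: s].

Definition le_l (k : kind) (n : nat) (x y : M k n) : Prop := exists z, y = mulM x z.

Definition is_lub (k : kind) (n : nat) (X : {set gen k n}) (d : M k n) : Prop :=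
  (forall s, s \in X -> le_l (genM s) d) /\
  (forall u, (forall s, s \in X -> le_l (genM s) u) -> le_l d u).

Definition DeltaX (k : kind) (n : nat) (X : {set gen k n}) : M k n :=
  xget (unitM k n) (is_lub X).

Definition Delta (k : kind) (n : nat) : M k n := DeltaX [set: gen k n].

Definition simple (k : kind) (n : nat) (x : M k n) : Prop := le_l x (Delta k n).
Definition S (k : kind) (n : nat) := {x : M k n | simple x}.

Definition arrow (k : kind) (n : nat) (x y : M k n) : Prop :=
  forall s : gen k n, le_l (genM s) y -> ~ simple (mulM x (genM s)).

Definition Mbar (k : kind) (n : nat) :=
  {xi : nat -> S k n | forall i, arrow (proj1_sig (xi i)) (proj1_sig (xi i.+1))}.

Lemma sig_eqP (T : Type) (P : T -> Prop) (a b : {x | P x}) :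
  proj1_sig a = proj1_sig b -> a = b.
Proof.
case: a b => [a ha] [b hb] /= eab; subst b; congr exist; exact: Prop_irrelevance.
Qed.

Lemma rel_pair_size k (l r : seq (nat * nat)) : rel_pair k l r -> size l = size r.
Proof.
case: k => /=.
- by move=> [i [j [[_ [-> ->]]|[_ [-> ->]]]]].
- move=> [[i [j [m [_ /= [hl hr]]]]]|[i [j [m [q [_ [-> ->]]]]]]] //.
  have H2 : forall s, s \in [:: [:: (i, j); (j, m)]; [:: (j, m); (i, m)];
                                 [:: (i, m); (i, j)]] -> size s = 2%N.
    by move=> s; rewrite !inE => /or3P [] /eqP ->.
  by rewrite (H2 _ hl) (H2 _ hr).
Qed.

Lemma beq_size k n (u v : word k n) : beq u v -> size u = size v.
Proof.
elim=> {u v} [u //|u v _ IH|u v w _ IH1 _ IH2|u v a b l r hr hu hv].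
- by [].
- by rewrite IH1 IH2.
-
  rewrite -(size_map (@gv k n) u) -(size_map (@gv k n) v) hu hv !size_cat.
  by rewrite (rel_pair_size hr).
Qed.

Lemma rep_spec k n (x : M k n) : proj1_sig x = beq (rep x).
Proof. by rewrite /rep; case: cid. Qed.

Lemma beq_of_cls k n (u v : word k n) : proj1_sig (cls u) = beq v -> beq u v.
Proof. by move=> /= ->; exact: beq_refl. Qed.

Lemma cls_rep k n (x : M k n) : cls (rep x) = x.
Proof. by apply: sig_eqP => /=; rewrite -rep_spec. Qed.

Lemma rep_unit k n : rep (unitM k n) = [::].
Proof.
have := beq_size (beq_of_cls (rep_spec (unitM k n))).
by case: (rep _).
Qed.

Lemma simple_unit k n : simple (unitM k n).
Proof.
exists (Delta k n); rewrite /mulM rep_unit /=; by rewrite cls_rep.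
Qed.

Lemma arrow_unit k n : arrow (unitM k n) (unitM k n).
Proof.
move=> s [z hz] _.
have h1 := beq_size (beq_of_cls (rep_spec (genM s))).
have := beq_size (beq_of_cls (congr1 (@proj1_sig _ _) hz)).
by rewrite size_cat -h1.
Qed.

Definition unitS (k : kind) (n : nat) : S k n := exist _ (unitM k n) (@simple_unit k n).

Definition Mbar_point (k : kind) (n : nat) : Mbar k n :=
  @exist (nat -> S k n)
    (fun xi => forall i, arrow (proj1_sig (xi i)) (proj1_sig (xi i.+1)))
    (fun _ => unitS k n) (fun _ => @arrow_unit k n).

HB.instance Definition _ k n := gen_eqMixin (Mbar k n).
HB.instance Definition _ k n := gen_choiceMixin (Mbar k n).
HB.instance Definition _ k n := isPointed.Build (Mbar k n) (Mbar_point k n).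

(** the i-th term xi_{i+1} of a point of Mbar, as an element of M *)
Definition term (k : kind) (n : nat) (xi : Mbar k n) (i : nat) : M k n :=
  proj1_sig (proj1_sig xi i).

(** Product topology (S_n discrete), restricted to Mbar: open sets *)
Definition open_Mbar (k : kind) (n : nat) : set (set (Mbar k n)) :=
  [set U | forall xi, U xi -> exists m : nat,
     forall zeta, (forall i, (i < m)%N -> term zeta i = term xi i) -> U zeta].

Arguments open_Mbar : clear implicits.

Definition closure_Mbar (k : kind) (n : nat) (A : set (Mbar k n)) : set (Mbar k n) :=
  [set xi | forall U, open_Mbar k n U -> U xi -> exists2 zeta, U zeta & A zeta].

Definition MbarT (k : kind) (n : nat) := g_sigma_algebraType (open_Mbar k n).

(** Embedding of M into Mbar: x |-> its normal form followed by e, e, ...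
    (the unique point of Mbar which is eventually e and whose finite product is x) *)
Definition prodN (k : kind) (n : nat) (xi : Mbar k n) (N : nat) : M k n :=
  foldr (fun i acc => mulM (term xi i) acc) (unitM k n) (iota 0 N).

Definition nf_of (k : kind) (n : nat) (x : M k n) (xi : Mbar k n) : Prop :=
  exists N, (forall i, (N <= i)%N -> term xi i = unitM k n) /\ prodN xi N = x.

Definition embed (k : kind) (n : nat) (x : M k n) : MbarT k n :=
  xget (Mbar_point k n) (nf_of x).

Definition Delta_inf (k : kind) (n : nat) : MbarT k n :=
  xget (Mbar_point k n) (fun xi => forall i, term xi i = Delta k n).

Definition Mset (k : kind) (n : nat) : set (MbarT k n) := range (@embed k n).
Arguments Mset : clear implicits.
Definition boundary (k : kind) (n : nat) : set (MbarT k n) := ~` Mset k n.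
Arguments boundary : clear implicits.

Definition Uparrow (k : kind) (n : nat) (x : M k n) : set (MbarT k n) :=
  closure_Mbar [set embed (mulM x z) | z in [set: M k n]].
Definition uparrow (k : kind) (n : nat) (x : M k n) : set (MbarT k n) :=
  Uparrow x `&` boundary k n.

Definition uniform (k : kind) (n : nat) (R : realType)
  (nu : set (MbarT k n) -> \bar R) (p : R) : Prop :=
  forall x : M k n, nu (Uparrow x) = ((p ^+ len x)%:E)%E.

Definition Hn (k : kind) (n : nat) (R : realType) (t : R) : R :=
  (\sum_(X : {set gen k n}) (-1) ^+ #|X| * t ^+ len (DeltaX X))%R.

(** q_n = radius of convergence of G_n(t) = sum_{x in M} t^|x| *)
Definition qn (k : kind) (n : nat) (R : realType) : \bar R :=
  ereal_sup [set r%:E | r in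
    [set r : R | (0 <= r)%R /\ ((\esum_(x in [set: M k n]) (r ^+ len x)%:E)%R < +oo)%E]].

(* Main.v *)
(* A uniform measure is determined by its values on the sets [Uparrow x], which
   form a pi-system; inclusion-exclusion over the generators extending the last
   letter gives each cylinder (x_1, .., x_m) the mass p^|x_1 .. x_m| h_Y(p), with
   h_Y(p) the sum over the subsets X of Y of (-1)^|X| p^|Delta_X| and Y the set
   of generators s with x_m s simple. Conversely, these weights always satisfy
   the consistency equations, so a uniform measure exists as soon as they are
   nonnegative. This holds for p < q_n, because G_n(p) h_Y(p) is a sum of
   nonnegative terms, and at q_n by continuity.

   If a uniform measure exists with 0 < p < 1, then h_Y(p) > 0 for every proper
   subset Y of the generators. Hence the sums of p^|x| over the elements x whose
   normal form has a given length are bounded, G_n converges on [0, p[, and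
   p <= q_n. Positivity propagates along two rules: h_Y(p) >= p^|w| h_Y'(p) when
   every common multiple of w and of a generator of Y is a multiple of w s for
   some s in Y', and h is multiplicative on commuting sets of generators. For
   B_n^+ one moves a missing generator until the first one is isolated; for
   B_n^{+*} one cuts a polygon along a chord.

   If H_n(q_n) > 0, all h_Y would remain positive slightly beyond q_n, against
   the previous paragraph; so H_n(q_n) = 0 and nu_{q_n} does not charge M.

   The Garside structure is obtained from Garside's induction on word length: it
   only requires a cube condition on triples of generators, which reduces to
   finitely many configurations and is checked by computation. *)

Require Import Defs.
From HB Require Import structures.
From mathcomp Require Import all_boot all_order all_algebra.
From mathcomp Require Import finmap zify lra.
From mathcomp Require Import all_classical all_reals all_analysis.
Set Implicit Arguments.
Unset Strict Implicit.
Unset Printing Implicit Defensive.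
Import Order.TTheory GRing.Theory Num.Theory.
Local Open Scope classical_set_scope.

(** * Word reversing and the cube condition *)

(** The parameter 1 is isolated: for nonempty [Y] the polynomial h_Y vanishes at 1, being an
    alternating sum over the subsets of [Y], so strict positivity and the bound p <= q_n it yields
    hold only below 1. Beyond q_n the series G_n diverges and says nothing about signs, so the two
    positivity rules are read off the hypothetical measure itself, as an inclusion and an
    independence of events. Only proper [Y] can be treated, since for the full set h_Y is H_n, which
    vanishes at q_n. They suffice, because every non-unit simple element x has a generator s with x
    s not simple; the full set occurs only after the unit, that is, at points of M.

    Units are kept as letters of streams, so that points of M and of the boundary obey one and the
    same cylinder formula, and a point of M is itself a cylinder. The measure is obtained as the
    image of Lebesgue measure on [0, 1[ under an explicit coding of streams, in place of an
    extension theorem. Lcms and cancellation are not given with the presentation: both come from the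
    factorization property of complements. *)

Section Complement.
Context {T : eqType} (f : T -> T -> seq T).

(* The congruence on words presented by the relations [s (s\t) = t (t\s)],
   where [s\t] is the word [f s t]. *)
Inductive ceq : seq T -> seq T -> Prop :=
| ceq_refl u : ceq u u
| ceq_sym u v : ceq u v -> ceq v u
| ceq_trans u v w : ceq u v -> ceq v w -> ceq u w
| ceq_step a b s t : ceq (a ++ s :: f s t ++ b) (a ++ t :: f t s ++ b).

Hypothesis fss : forall s, f s s = [::].
Hypothesis fsize : forall s t, size (f s t) = size (f t s).

Lemma ceq_catl a u v : ceq u v -> ceq (a ++ u) (a ++ v).
Proof.
elim=> [w|u' v' _ h|u' v' w' _ h1 _ h2|c b s t].
- exact: ceq_refl.
- exact: ceq_sym.
- exact: ceq_trans h1 h2.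
- by rewrite !catA; exact: ceq_step.
Qed.

Lemma ceq_catr a u v : ceq u v -> ceq (u ++ a) (v ++ a).
Proof.
elim=> [w|u' v' _ h|u' v' w' _ h1 _ h2|c b s t].
- exact: ceq_refl.
- exact: ceq_sym.
- exact: ceq_trans h1 h2.
- by rewrite -!catA !cat_cons -!catA; exact: ceq_step.
Qed.

Lemma ceq_cons s u v : ceq u v -> ceq (s :: u) (s :: v).
Proof. exact: (@ceq_catl [:: s]). Qed.

Lemma ceq_size u v : ceq u v -> size u = size v.
Proof.
elim=> [//|u' v' _ -> //|u' v' w' _ -> _ -> //|a b s t].
by rewrite !size_cat /= !size_cat fsize.
Qed.

(* Word reversing: a result [(a, b)] means that [u ++ a] and [v ++ b] both
   represent the right lcm of [u] and [v]. *)
Fixpoint rev (N : nat) (u v : seq T) : option (seq T * seq T) :=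
  if N is N'.+1 then
    match u, v with
    | [::], _ => Some (v, [::])
    | _, [::] => Some ([::], u)
    | s :: u', t :: v' =>
      if rev N' u' (f s t) is Some (a, b) then
        if rev N' (f t s) v' is Some (c, d) then
          if rev N' b c is Some (e, g) then Some (a ++ e, d ++ g) else None
        else None
      else None
    end
  else None.

Lemma rev_sound N u v a b : rev N u v = Some (a, b) -> ceq (u ++ a) (v ++ b).
Proof.
elim: N u v a b => [//|N IH] [|s u] [|t v] a b /=.
- by move=> [<- <-]; exact: ceq_refl.
- by move=> [<- <-]; rewrite cats0; exact: ceq_refl.
- by move=> [<- <-]; rewrite cats0; exact: ceq_refl.
case E1: (rev N u (f s t)) => [[a1 b1]|//].
case E2: (rev N (f t s) v) => [[c d]|//].
case E3: (rev N b1 c) => [[e g]|//] [<- <-].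
have h1 : ceq (s :: u ++ a1 ++ e) (s :: f s t ++ b1 ++ e).
  by apply: ceq_cons; rewrite !catA; apply: ceq_catr; exact: IH E1.
have h2 : ceq (t :: f t s ++ c ++ g) (t :: v ++ d ++ g).
  by apply: ceq_cons; rewrite !catA; apply: ceq_catr; exact: IH E2.
have h3 : ceq (s :: f s t ++ b1 ++ e) (s :: f s t ++ c ++ g).
  by apply: ceq_cons; apply: ceq_catl; exact: IH E3.
apply: ceq_trans h1 (ceq_trans h3 (ceq_trans _ h2)).
exact: (@ceq_step [::]).
Qed.

(** Truncation of [ceq_factor] that drives Garside's induction: the appeals to it made at level
    [m.+1] concern words one letter shorter. *)
Definition factors_below m := forall s t u v, size u < m ->
  ceq (s :: u) (t :: v) -> exists w, ceq u (f s t ++ w) /\ ceq v (f t s ++ w).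

(** Minimality of what reversing returns: with [rev_sound], it makes [u ++ a] a right lcm as far as
    common multiples of length at most [m] are concerned. *)
Lemma rev_complete m N u v a b w1 w2 : factors_below m -> size (u ++ w1) <= m ->
  rev N u v = Some (a, b) -> ceq (u ++ w1) (v ++ w2) ->
  exists w, ceq w1 (a ++ w) /\ ceq w2 (b ++ w).
Proof.
move=> hm; elim: N u v a b w1 w2 => [//|N IH] [|s u] [|t v] a b w1 w2 /= hs.
- by move=> [<- <-] h; exists w1; split; [exact: ceq_refl|exact: ceq_sym].
- by move=> [<- <-] h; exists w2; split => //; exact: ceq_refl.
- by move=> [<- <-] h; exists w1; split; [exact: ceq_refl|exact: ceq_sym].
case E1: (rev N u (f s t)) => [[a1 b1]|//].
case E2: (rev N (f t s) v) => [[c d]|//].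
case E3: (rev N b1 c) => [[e g]|//] [<- <-] h.
have [w [hu hv]] := hm _ _ _ _ hs h.
have su := ceq_size hu; have sv := ceq_size hv.
have suv : size (u ++ w1) = size (v ++ w2).
  by move: (ceq_size h) => /= [].
have [w' [h1 h2]] := IH _ _ _ _ _ _ (ltnW hs) E1 hu.
have hs2 : size (f t s ++ w) <= m by rewrite -sv -suv ltnW.
have [w'' [h3 h4]] := IH _ _ _ _ _ _ hs2 E2 (ceq_sym hv).
have hs3 : size (b1 ++ w') <= m.
  rewrite -(ceq_size h2); apply: leq_trans (ltnW hs).
  by rewrite su size_cat leq_addl.
have [z [h5 h6]] := IH _ _ _ _ _ _ hs3 E3 (ceq_trans (ceq_sym h2) h3).
exists z; split.
- by apply: ceq_trans h1 _; rewrite -catA; exact: ceq_catl.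
- by apply: ceq_trans h4 _; rewrite -catA; exact: ceq_catl.
Qed.

(** Here [r (r\s) a] plays the role of the lcm of [r], [s] and [t]. By [rev_sound], the empty
    components express [(s\r) a = (s\t) c] and [(t\r) b = (t\s) c]: the faces of the cube close
    up. *)
Definition cubeb N r s t : bool :=
  if rev N (f r s) (f r t) is Some (a, b) then
    if rev N (f s r ++ a) (f s t) is Some ([::], c) then
      if rev N (f t r ++ b) (f t s ++ c) is Some ([::], [::]) then true else false
    else false
  else false.

Hypothesis cube : forall r s t, exists N, cubeb N r s t.

(** Induction on the derivation of the equivalence. The substantial case is transitivity: if the
    middle word begins with [r], the factorizations for [r, s] and for [r, t] must be merged, which
    is the cube at [r, s, t]. *)
Lemma factors_step m : factors_below m -> factors_below m.+1.
Proof.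
move=> hm.
suff H x y : ceq x y -> size x <= m.+1 ->
    forall s t u v, x = s :: u -> y = t :: v ->
    exists w, ceq u (f s t ++ w) /\ ceq v (f t s ++ w).
  by move=> s t u v hu h; exact: H h _ _ _ _ _ erefl erefl.
elim=> {x y} [x|x y h IH|x z y h1 IH1 h2 IH2|a b s0 t0] hs s t u v.
- by move=> -> [<- <-]; exists u; rewrite fss; split; exact: ceq_refl.
- move=> hy hx; rewrite -(ceq_size h) in hs.
  by have [w [hw1 hw2]] := IH hs _ _ _ _ hx hy; exists w.
- case: z h1 h2 IH1 IH2 => [|r z] h1 h2 IH1 IH2 hx hy.
    by move: (ceq_size h1); rewrite hx.
  have [w1 [hu hz1]] := IH1 hs _ _ _ _ hx erefl.
  rewrite (ceq_size h1) in hs.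
  have [w2 [hz2 hv]] := IH2 hs _ _ _ _ erefl hy.
  have [N] := cube r s t; rewrite /cubeb.
  case E1: (rev N _ _) => [[a b]|//].
  case E2: (rev N _ _) => [[[|//] c]|//].
  case E3: (rev N _ _) => [[[|//] [|//]]|//] _.
  have hsz : size (f r s ++ w1) <= m by rewrite -(ceq_size hz1).
  have [w [g1 g2]] := rev_complete hm hsz E1 (ceq_trans (ceq_sym hz1) hz2).
  have := rev_sound E2; rewrite cats0 => k1.
  have := rev_sound E3; rewrite !cats0 => k2.
  exists (c ++ w); split.
  + apply: ceq_trans hu (ceq_trans (ceq_catl _ g1) _).
    by rewrite !catA; exact: ceq_catr.
  + apply: ceq_trans hv (ceq_trans (ceq_catl _ g2) _).
    by rewrite !catA; exact: ceq_catr.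
- case: a hs => [|c a] /= hs.
    move=> [<- <-] [<- <-]; exists b; split; exact: ceq_refl.
  move=> [<- <-] [<- <-]; rewrite fss; eexists; split; last exact: ceq_refl.
  exact: ceq_step.
Qed.

Lemma ceq_factor s t u v : ceq (s :: u) (t :: v) ->
  exists w, ceq u (f s t ++ w) /\ ceq v (f t s ++ w).
Proof.
suff : factors_below (size u).+1 by apply.
by elim: (size u).+1 => [//|m]; exact: factors_step.
Qed.

Lemma ceq_cancel a u v : ceq (a ++ u) (a ++ v) -> ceq u v.
Proof.
elim: a => [//|s a IH] /= /ceq_factor [w]; rewrite fss => -[h1 h2].
exact: IH (ceq_trans h1 (ceq_sym h2)).
Qed.

(** The given common multiple bounds the recursion, in place of fuel. The predicate [D] records that
    an lcm of words over a set of letters stable under complements is again written in these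
    letters. *)
Lemma ceq_lcm (D : pred T) u v w1 w2 :
  (forall s t, D s -> D t -> all D (f s t)) -> all D u -> all D v ->
  ceq (u ++ w1) (v ++ w2) ->
  exists a b, [/\ ceq (u ++ a) (v ++ b), all D a, all D b &
    forall z1 z2, ceq (u ++ z1) (v ++ z2) ->
      exists z, ceq z1 (a ++ z) /\ ceq z2 (b ++ z)].
Proof.
move=> hD; move En : (size (u ++ w1)) => n.
elim/ltn_ind: n u v w1 w2 En => n IH [|s u] v w1 w2 En hu hv h.
  exists v, [::]; split=> //=; first by rewrite cats0; exact: ceq_refl.
  by move=> z1 z2 hz; exists z2; split => //; exact: ceq_refl.
case: v hv h => [|t v] /= hv h.
  exists [::], (s :: u); split=> //=; first by rewrite cats0; exact: ceq_refl.
  by move=> z1 z2 hz; exists z1; split; [exact: ceq_refl|exact: ceq_sym].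
move: hu hv => /= /andP[hs hu] /andP[ht hv].
have [w [g1 g2]] := ceq_factor h.
have su := ceq_size g1; have sv := ceq_size g2.
have suv : size (u ++ w1) = size (v ++ w2) by move: (ceq_size h) => /= [].
move: En => /= En.
have l1 : size (u ++ w1) < n by rewrite -En.
have [a1 [b1 [k1 Da1 Db1 m1]]] := IH _ l1 _ _ _ _ erefl hu (hD _ _ hs ht) g1.
have l2 : size (f t s ++ w) < n by rewrite -sv -suv.
have [c [d [k2 Dc Dd m2]]] := IH _ l2 _ _ _ _ erefl (hD _ _ ht hs) hv (ceq_sym g2).
have [w' [g3 g4]] := m1 _ _ g1.
have [w'' [g5 g6]] := m2 _ _ (ceq_sym g2).
have l3 : size (b1 ++ w') < n.
  rewrite -(ceq_size g4); apply: leq_ltn_trans l1.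
  by rewrite su size_cat leq_addl.
have [e [g [k3 De Dg m3]]] := IH _ l3 _ _ _ _ erefl Db1 Dc (ceq_trans (ceq_sym g4) g5).
exists (a1 ++ e), (d ++ g); split; rewrite ?all_cat ?Da1 ?De ?Dd ?Dg //.
  have h1 : ceq (s :: u ++ a1 ++ e) (s :: f s t ++ b1 ++ e).
    by apply: ceq_cons; rewrite !catA; exact: ceq_catr.
  have h2 : ceq (t :: f t s ++ c ++ g) (t :: v ++ d ++ g).
    by apply: ceq_cons; rewrite !catA; exact: ceq_catr.
  have h3 : ceq (s :: f s t ++ b1 ++ e) (s :: f s t ++ c ++ g).
    by apply: ceq_cons; exact: ceq_catl.
  apply: ceq_trans h1 (ceq_trans h3 (ceq_trans _ h2)).
  exact: (@ceq_step [::]).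
move=> z1 z2 /= /ceq_factor [y [p1 p2]].
have [y1 [q1 q2]] := m1 _ _ p1.
have [y2 [q3 q4]] := m2 _ _ (ceq_sym p2).
have [y3 [q5 q6]] := m3 _ _ (ceq_trans (ceq_sym q2) q3).
exists y3; split; rewrite -catA.
- exact: ceq_trans q1 (ceq_catl _ q5).
- exact: ceq_trans q4 (ceq_catl _ q6).
Qed.

End Complement.

(** * Transport of reversing along a relabelling of letters *)

Section ComplementMorphism.
Context {A B : eqType} (fA : A -> A -> seq A) (fB : B -> B -> seq B).
Variables (phi : A -> B) (D : pred A).
Hypothesis hD : forall s t, D s -> D t -> all D (fA s t).
Hypothesis hphi : forall s t, D s -> D t ->
  fB (phi s) (phi t) = map phi (fA s t).

Lemma rev_closed N u v a b : all D u -> all D v ->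
  rev fA N u v = Some (a, b) -> all D a /\ all D b.
Proof.
elim: N u v a b => [//|N IH] [|s u] [|t v] a b /=.
- by move=> _ _ [<- <-].
- by move=> _ h [<- <-].
- by move=> h _ [<- <-].
move=> /andP[hs hu] /andP[ht hv].
case E1: (rev fA N u _) => [[a1 b1]|//].
case E2: (rev fA N _ v) => [[c d]|//].
case E3: (rev fA N b1 c) => [[e g]|//] [<- <-].
have [h1 h2] := IH _ _ _ _ hu (hD hs ht) E1.
have [h3 h4] := IH _ _ _ _ (hD ht hs) hv E2.
have [h5 h6] := IH _ _ _ _ h2 h3 E3.
by rewrite !all_cat h1 h4 h5 h6.
Qed.

Lemma rev_map N u v : all D u -> all D v ->
  rev fB N (map phi u) (map phi v) =
  omap (fun p => (map phi p.1, map phi p.2)) (rev fA N u v).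
Proof.
elim: N u v => [//|N IH] [|s u] [|t v] //= /andP[hs hu] /andP[ht hv].
rewrite !hphi // !IH ?hD //.
case E1: (rev fA N u _) => [[a1 b1]|//] /=.
case E2: (rev fA N _ v) => [[c d]|//] /=.
have [h1 h2] := rev_closed hu (hD hs ht) E1.
have [h3 h4] := rev_closed (hD ht hs) hv E2.
rewrite IH //.
by case: (rev fA N b1 c) => [[e g]|//] /=; rewrite !map_cat.
Qed.

Lemma cubeb_map N r s t : D r -> D s -> D t ->
  cubeb fB N (phi r) (phi s) (phi t) = cubeb fA N r s t.
Proof.
move=> hr hs ht; rewrite /cubeb !hphi // rev_map ?hD //.
case E1: (rev fA N _ _) => [[a b]|//] /=.
have [ha hb] := rev_closed (hD hr hs) (hD hr ht) E1.
rewrite -map_cat rev_map ?all_cat ?hD ?ha //.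
case E2: (rev fA N (fA s r ++ a) _) => [[[|x a'] c]|//] //=.
have := @rev_closed N _ _ _ _ _ (hD hs ht) E2.
rewrite all_cat hD // ha => /(_ isT)[_ hc].
rewrite -!map_cat rev_map ?all_cat ?hD ?hb ?hc //.
by case: (rev fA N _ _) => [[[|x a'] [|y b']]|//].
Qed.

End ComplementMorphism.

(** * Complements of generators *)

(* The part, in the triangle [a, b, x], of the Garside element of the triangle
   remaining after [sigma_(a,b)]. *)
Definition tri_compl (a b x : nat) : nat * nat :=
  if a < x < b then (a, x) else if x < a then (x, b) else (b, x).

(** Crossing chords have no defining relation. Their lcm is the Garside element of the quadrilateral
    on the four endpoints, of length three, whence the two-letter complements in the last two
    branches. *)
Definition dual_compl (p q : nat * nat) : seq (nat * nat) :=
  let: (a, b) := p in let: (c, d) := q in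
  if (a == c) && (b == d) then [::]
  else if (c == a) || (c == b) then [:: tri_compl a b d]
  else if (d == a) || (d == b) then [:: tri_compl a b c]
  else if (a < c < b) == (a < d < b) then [:: q]
  else if a < c < b then [:: tri_compl a b c; tri_compl a b d]
  else [:: tri_compl a b d; tri_compl a b c].

Definition artin_compl (p q : nat * nat) : seq (nat * nat) :=
  if p.1 == q.1 then [::]
  else if (q.1 == p.1.+1) || (p.1 == q.1.+1) then [:: q; p] else [:: q].

Definition raw_compl (k : kind) := if k is Artin then artin_compl else dual_compl.

Definition raw_valid (k : kind) (n : nat) (p : nat * nat) : bool :=
  [&& 1 <= p.1, p.2 <= n & if k is Artin then p.2 == p.1.+1 else p.1 < p.2].

Lemma gv_inj k n : injective (@gv k n).
Proof.
move=> [[i j] hs] [[i' j'] hs'] [] /= /val_inj e1 /val_inj e2.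
by apply: val_inj; rewrite /= e1 e2.
Qed.

Lemma gv_valid k n (s : gen k n) : raw_valid k n (gv s).
Proof.
case: s => [[i j]]; rewrite /raw_valid /gv /valid_gen /=.
by case: k => /andP[-> h] /=; rewrite -ltnS ltn_ord.
Qed.

Lemma gv_onto k n p : raw_valid k n p -> exists s : gen k n, gv s = p.
Proof.
case: p => i j /and3P[/= h1 h2 h3].
have hi : i < n.+1 by case: k h3 => [/eqP|]; lia.
have hv : valid_gen k (Ordinal hi, Ordinal (h2 : j < n.+1)).
  by rewrite /valid_gen /= h1; case: k h3.
by exists (exist (fun p => valid_gen k p) _ hv).
Qed.

(* Order-preserving relabelling reduces statements on dual generators to
   finitely many configurations of at most six points. *)
Section DualReduction.
Variable L : seq nat.
Hypothesis hL : sorted ltn L.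

Definition relabel (p : nat * nat) := (nth 0 L p.1, nth 0 L p.2).
Definition in_range (p : nat * nat) := p.1 < p.2 < size L.

Lemma relabel_lt i j : i < size L -> j < size L ->
  (nth 0 L i < nth 0 L j) = (i < j).
Proof.
move=> hi hj; case: (ssrnat.ltngtP i j) => h.
- exact: (sorted_ltn_nth ltn_trans).
- have := sorted_ltn_nth ltn_trans 0 hL _ _ hj hi h; lia.
- by rewrite h ltnn.
Qed.

Lemma relabel_eq i j : i < size L -> j < size L ->
  (nth 0 L i == nth 0 L j) = (i == j).
Proof.
move=> hi hj; apply/nth_uniq => //.
exact: (sorted_uniq ltn_trans ltnn).
Qed.

Lemma relabel_compl s t : in_range s -> in_range t ->
  dual_compl (relabel s) (relabel t) = map relabel (dual_compl s t).
Proof.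
case: s t => a b [c d] /andP[/= ab hb] /andP[/= cd hd].
have ha : a < size L by exact: ltn_trans hb.
have hc : c < size L by exact: ltn_trans hd.
rewrite /dual_compl /tri_compl /relabel /= !relabel_lt // !relabel_eq //.
repeat (case: ifP => //= ?); exfalso; lia.
Qed.

End DualReduction.

Lemma dual_compl_valid (P : pred nat) s t : s.1 < s.2 -> t.1 < t.2 ->
  P s.1 -> P s.2 -> P t.1 -> P t.2 ->
  all (fun p => [&& p.1 < p.2, P p.1 & P p.2]) (dual_compl s t).
Proof.
case: s t => a b [c d] /= ab cd pa pb pc pd.
rewrite /dual_compl /tri_compl.
by do ![case: ifPn => //= ?]; rewrite ?andbT ?pa ?pb ?pc ?pd ?andbT; lia.
Qed.

Definition six_pairs := 
  [seq p <- [seq (i, j) | i <- iota 0 6, j <- iota 0 6] | p.1 < p.2].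

Lemma six_pairsP p : p.1 < p.2 < 6 -> p \in six_pairs.
Proof.
case: p => i j /= /andP[h1 h2]; rewrite mem_filter; apply/andP; split => //.
by apply/allpairsP; exists (i, j); rewrite !mem_iota; split => //=; lia.
Qed.

Lemma dual_reduce r s t : r.1 < r.2 -> s.1 < s.2 -> t.1 < t.2 ->
  exists L, sorted ltn L /\ exists r' s' t',
   [/\ in_range L r', in_range L s' & in_range L t'] /\
   [/\ r' \in six_pairs, s' \in six_pairs & t' \in six_pairs] /\
   [/\ r = relabel L r', s = relabel L s' & t = relabel L t'].
Proof.
move=> hr hs ht.
pose l := [:: r.1; r.2; s.1; s.2; t.1; t.2].
pose L := sort leq (undup l).
have sL : sorted ltn L.
  by rewrite ltn_sorted_uniq_leq sort_uniq undup_uniq sort_sorted //; exact: leq_total.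
have mL x : (x \in L) = (x \in l) by rewrite mem_sort mem_undup.
have zL : size L <= 6 by rewrite size_sort (leq_trans (size_undup _)).
exists L; split=> //.
pose g (p : nat * nat) := (index p.1 L, index p.2 L).
have Hg p : p.1 < p.2 -> p.1 \in l -> p.2 \in l ->
    [/\ in_range L (g p), g p \in six_pairs & p = relabel L (g p)].
  move=> hp; rewrite -!mL => p1 p2.
  have e : p = relabel L (g p) by rewrite /relabel /g !nth_index //; case: p {hp p1 p2}.
  have hi : in_range L (g p).
    rewrite /in_range /g /= index_mem p2 andbT.
    by rewrite -(relabel_lt sL) ?index_mem // !nth_index.
  split=> //; apply: six_pairsP.
  by case/andP: hi => -> h; exact: leq_trans h zL.
have [r1 r2 r3] : [/\ in_range L (g r), g r \in six_pairs & r = relabel L (g r)].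
  by apply: Hg => //; rewrite !inE eqxx ?orbT.
have [s1 s2 s3] : [/\ in_range L (g s), g s \in six_pairs & s = relabel L (g s)].
  by apply: Hg => //; rewrite !inE eqxx ?orbT.
have [t1 t2 t3] : [/\ in_range L (g t), g t \in six_pairs & t = relabel L (g t)].
  by apply: Hg => //; rewrite !inE eqxx ?orbT.
by exists (g r), (g s), (g t); split.
Qed.

(** The fuel 20 is harmless: [cubeb] is false whenever reversing runs out of fuel, so the
    computation also certifies that 20 is enough. *)
Lemma dual_cube_six : all (fun r => all (fun s => all (fun t =>
  (size (dual_compl s t) == size (dual_compl t s)) &&
  cubeb dual_compl 20 r s t) six_pairs) six_pairs) six_pairs.
Proof. by vm_compute. Qed.

Lemma dual_cube r s t : r.1 < r.2 -> s.1 < s.2 -> t.1 < t.2 ->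
  (size (dual_compl s t) == size (dual_compl t s)) && cubeb dual_compl 20 r s t.
Proof.
move=> hr hs ht.
have [L [sL [r' [s' [t' [[r1 s1 t1] [[r2 s2 t2] [-> -> ->]]]]]]]] := dual_reduce hr hs ht.
have /allP/(_ _ r2)/allP/(_ _ s2)/allP/(_ _ t2)/andP[h1 h2] := dual_cube_six.
rewrite !(relabel_compl sL) // !size_map h1 /=.
rewrite (@cubeb_map _ _ dual_compl dual_compl (relabel L) (in_range L)) // => x y hx hy.
  have [/andP[x1 x2] /andP[y1 y2]] := (hx, hy).
  apply/allP => p /(allP (@dual_compl_valid (fun i => i < size L) _ _ x1 y1
    (ltn_trans x1 x2) x2 (ltn_trans y1 y2) y2)).
  by rewrite /in_range => /and3P[-> _ ->].
exact: relabel_compl.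
Qed.

(* Artin generators are reduced to three labels together with their adjacency
   relation, which cannot be a triangle. *)
Definition label_compl (e : nat -> nat -> bool) (x y : nat) : seq nat :=
  if x == y then [::] else if e x y then [:: y; x] else [:: y].

Definition label_rel (b01 b02 b12 : bool) (x y : nat) : bool :=
  match x, y with
  | 0, 1 | 1, 0 => b01
  | 0, 2 | 2, 0 => b02
  | 1, 2 | 2, 1 => b12
  | _, _ => false
  end.

Lemma label_cube b01 b02 b12 : ~~ [&& b01, b02 & b12] ->
  all (fun r => all (fun s => all (fun t =>
  cubeb (label_compl (label_rel b01 b02 b12)) 20 r s t) (iota 0 3)) (iota 0 3)) (iota 0 3).
Proof. by case: b01; case: b02; case: b12 => //= _; vm_compute. Qed.

Lemma artin_cube i j m :
  cubeb artin_compl 20 (i, i.+1) (j, j.+1) (m, m.+1).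
Proof.
pose L : seq nat := undup [:: i; j; m].
pose adj (x y : nat) := (y == x.+1) || (x == y.+1).
(* When labels coincide, [L] has fewer than three entries; the size guards prevent the default value
   of [nth] from creating a spurious triangle of adjacencies. *)
pose a x y := [&& x < size L, y < size L & adj (nth 0 L x) (nth 0 L y)].
pose e := label_rel (a 0 1) (a 0 2) (a 1 2).
pose phi x := (nth 0 L x, (nth 0 L x).+1).
have sL : size L <= 3 by apply: leq_trans (size_undup _) _.
have hL x : x \in [:: i; j; m] -> index x L < size L /\ (x, x.+1) = phi (index x L).
  by rewrite -mem_undup => h; rewrite index_mem /phi nth_index.
have [i1 ->] : index i L < size L /\ (i, i.+1) = phi (index i L).
  by apply: hL; rewrite !inE eqxx.
have [j1 ->] : index j L < size L /\ (j, j.+1) = phi (index j L).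
  by apply: hL; rewrite !inE eqxx ?orbT.
have [m1 ->] : index m L < size L /\ (m, m.+1) = phi (index m L).
  by apply: hL; rewrite !inE eqxx ?orbT.
have he x y : x < size L -> y < size L -> x != y -> e x y = adj (nth 0 L x) (nth 0 L y).
  move=> hx hy hxy.
  have ac u v : adj u v = adj v u by rewrite /adj orbC.
  have := leq_trans hy sL; have := leq_trans hx sL.
  by case: x y hx hy hxy => [|[|[|x]]] [|[|[|y]]] //= hx hy _ _ _;
    rewrite /e /= /a ?hx ?hy //= ac.
rewrite (@cubeb_map _ _ (label_compl e) artin_compl phi (fun x => x < size L)) //.
- have nt : ~~ [&& a 0 1, a 0 2 & a 1 2].
    apply/negP => /and3P[/and3P[h0 h1 e1] /and3P[_ h2 e2] /and3P[_ _ e3]].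
    move: e1 e2 e3; rewrite /adj.
    move: (nth 0 L 0) (nth 0 L 1) (nth 0 L 2) => x y z.
    move=> /orP[]/eqP e1 /orP[]/eqP e2 /orP[]/eqP e3; lia.
  have /allP h := label_cube nt.
  have hi x : x < size L -> x \in iota 0 3 by rewrite mem_iota /=; lia.
  by have /allP/(_ _ (hi _ j1))/allP/(_ _ (hi _ m1)) := h _ (hi _ i1).
- move=> x y hx hy; rewrite /label_compl.
  by do 2![case: ifP => _ //=]; rewrite ?hx ?hy.
- move=> x y hx hy; rewrite /artin_compl /label_compl /=.
  rewrite nth_uniq ?undup_uniq //; case: ifPn => // hxy.
  by rewrite he // /adj; case: ifP.
Qed.

Lemma raw_compl_valid k n p q : raw_valid k n p -> raw_valid k n q ->
  all (raw_valid k n) (raw_compl k p q).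
Proof.
case: k => /= hp hq.
  by rewrite /artin_compl; do 2![case: ifP => _ //=]; rewrite ?hp ?hq.
move: hp hq => /and3P[p1 p2 p3] /and3P[q1 q2 q3].
have := @dual_compl_valid (fun i => 1 <= i <= n) p q p3 q3.
rewrite p1 q1 p2 q2 (leq_trans q1 (ltnW q3)) (leq_trans p1 (ltnW p3)).
rewrite (leq_trans (ltnW p3) p2) (leq_trans (ltnW q3) q2).
move=> /(_ isT isT isT isT) /allP h; apply/allP => x /h.
by rewrite /raw_valid => /and3P[-> /andP[-> _] /andP[_ ->]].
Qed.

Section Generators.
Context {k : kind} {n : nat}.
Implicit Types (s t : gen k n) (u v w : word k n).

(** Complements are computed on pairs of integers, where relabelling is possible, and read back as
    generators; by [raw_compl_valid], [pmap] loses no letter. *)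
Definition compl s t : word k n :=
  pmap (fun p => [pick x : gen k n | gv x == p]) (raw_compl k (gv s) (gv t)).

Lemma map_compl s t : map (@gv k n) (compl s t) = raw_compl k (gv s) (gv t).
Proof.
rewrite /compl; have := raw_compl_valid (gv_valid s) (gv_valid t).
elim: (raw_compl _ _ _) => //= p l IH /andP[hp hl].
case: pickP => [x /eqP hx|h] /=; first by rewrite hx IH.
by have [x hx] := gv_onto hp; have := h x; rewrite hx eqxx.
Qed.

Lemma compl_ss s : compl s s = [::].
Proof.
apply: (inj_map (@gv_inj k n)); rewrite map_compl /raw_compl.
by case: k s => s; rewrite /artin_compl /dual_compl /= ?eqxx.
Qed.

Lemma compl_size s t : size (compl s t) = size (compl t s).
Proof.
rewrite -(size_map (@gv k n)) -[RHS](size_map (@gv k n)) !map_compl.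
have := gv_valid s; have := gv_valid t; rewrite /raw_valid /raw_compl.
case: k s t => s t /and3P[_ _ h1] /and3P[_ _ h2].
  rewrite /artin_compl eq_sym orbC.
  by case: ifP => // _; case: ifP.
by have /andP[/eqP] := dual_cube h1 h2 h1.
Qed.

Lemma compl_cube r s t : exists N, cubeb compl N r s t.
Proof.
exists 20; rewrite -(@cubeb_map _ _ compl (raw_compl k) (@gv k n) xpredT) //.
- have := gv_valid s; have := gv_valid t; have := gv_valid r.
  rewrite /raw_valid /raw_compl; case: k r s t => r s t /and3P[_ _ h1] /and3P[_ _ h2] /and3P[_ _ h3].
    move: h1 h2 h3; case: (gv r) (gv s) (gv t) => [a a'] [b b'] [c c'] /=.
    by move=> /eqP-> /eqP-> /eqP->; exact: artin_cube.
  by have /andP[] := dual_cube h1 h3 h2.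
- by move=> *; apply/allP.
- by move=> s' t' _ _; rewrite map_compl.
Qed.

End Generators.

(** * The two presentations *)

Arguments dual_compl : simpl never.
#[local] Opaque gv.

Ltac dual_compl_cases :=
  rewrite /dual_compl /tri_compl;
  repeat (case: ifPn => //= ?); try (exfalso; lia).

Lemma dual_compl_tri i j m : i < j -> j < m ->
  [/\ dual_compl (i, j) (j, m) = [:: (j, m)],
      dual_compl (i, j) (i, m) = [:: (j, m)] &
      dual_compl (j, m) (i, j) = [:: (i, m)]] /\
  [/\ dual_compl (j, m) (i, m) = [:: (i, m)],
      dual_compl (i, m) (i, j) = [:: (i, j)] &
      dual_compl (i, m) (j, m) = [:: (i, j)]].
Proof. by move=> ij jm; do 2!split; dual_compl_cases. Qed.

Definition noncrossing (p q : nat * nat) : bool :=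
  [|| p.2 < q.1, q.2 < p.1, (p.1 < q.1) && (q.2 < p.2) | (q.1 < p.1) && (p.2 < q.2)].

Lemma dual_compl_noncrossing p q : p.1 < p.2 -> q.1 < q.2 -> noncrossing p q ->
  dual_compl p q = [:: q].
Proof.
case: p q => a b [c d]; rewrite /noncrossing /= => ab cd h.
by dual_compl_cases.
Qed.

Lemma dual_compl_crossing a b c d : a < c -> c < b -> b < d ->
  dual_compl (a, b) (c, d) = [:: (a, c); (b, d)] /\
  dual_compl (c, d) (a, b) = [:: (c, b); (a, d)].
Proof. by move=> ac cb bd; split; dual_compl_cases. Qed.

Lemma dual_config p q : p.1 < p.2 -> q.1 < q.2 ->
  [\/ p = q,
      exists i j m, [/\ i < j, j < m & p \in [:: (i, j); (j, m); (i, m)] /\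
                                       q \in [:: (i, j); (j, m); (i, m)]],
      noncrossing p q | (p.1 < q.1 < p.2) && (p.2 < q.2) \/ (q.1 < p.1 < q.2) && (q.2 < p.2)].
Proof.
case: p q => a b [c d] /= ab cd.
have tri i j m p q : i < j -> j < m -> p \in [:: (i, j); (j, m); (i, m)] ->
   q \in [:: (i, j); (j, m); (i, m)] -> exists i j m, [/\ i < j, j < m & p \in [:: (i, j); (j, m); (i, m)] /\
                                       q \in [:: (i, j); (j, m); (i, m)]].
  by move=> *; exists i, j, m; split.
have [ac|ca|eac] := ssrnat.ltngtP a c; have [bd|db|ebd] := ssrnat.ltngtP b d.
- have [bc|cb|ebc] := ssrnat.ltngtP b c.
  + apply: Or43; rewrite /noncrossing /=; lia.
  + by apply: Or44; left.
  + by apply: Or42; apply: (tri a b d) => //; rewrite ebc !inE eqxx ?orbT.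
- apply: Or43; rewrite /noncrossing /=; lia.
- by apply: Or42; apply: (tri a c d) => //; rewrite ?ebd !inE eqxx ?orbT.
- apply: Or43; rewrite /noncrossing /=; lia.
- have [da|ad|eda] := ssrnat.ltngtP d a.
  + apply: Or43; rewrite /noncrossing /=; lia.
  + by apply: Or44; right.
  + by apply: Or42; apply: (tri c d b) => //; rewrite ?eda !inE eqxx ?orbT.
- by apply: Or42; apply: (tri c a b) => //; rewrite ?ebd !inE eqxx ?orbT.
- by subst c; apply: Or42; apply: (tri a b d) => //; rewrite !inE eqxx ?orbT.
- by subst c; apply: Or42; apply: (tri a d b) => //; rewrite !inE eqxx ?orbT.
- by apply: Or41; rewrite eac ebd.
Qed.

Lemma rel_pair_compl k l r : rel_pair k l r ->
  l = r \/ exists p q, l = p :: raw_compl k p q /\ r = q :: raw_compl k q p.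
Proof.
case: k => /=.
  move=> [i [j [[h [-> ->]]|[h [-> ->]]]]]; right; exists (i, i.+1), (j, j.+1);
    rewrite /artin_compl /=.
  - by rewrite !ifN //; lia.
  - by rewrite [i == j]eq_sym h orbC h; case: eqVneq => // e; lia.
case; last first.
  move=> [i [j [m [l0 [h [-> ->]]]]]].
  right; exists (i, j), (m, l0).
  have h1 : i < j by lia.
  have h2 : m < l0 by lia.
  by rewrite !dual_compl_noncrossing // /noncrossing /=; lia.
move=> [i [j [m [/andP[ij jm] [hl hr]]]]].
have [[e1 e2 e3] [e4 e5 e6]] := dual_compl_tri ij jm.
move: hl hr; rewrite !inE => /or3P[] /eqP-> /or3P[] /eqP->; try by left.
- by right; exists (i, j), (j, m); rewrite e1 e3.
- by right; exists (i, j), (i, m); rewrite e2 e5.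
- by right; exists (j, m), (i, j); rewrite e1 e3.
- by right; exists (j, m), (i, m); rewrite e4 e6.
- by right; exists (i, m), (i, j); rewrite e2 e5.
- by right; exists (i, m), (j, m); rewrite e4 e6.
Qed.

Lemma map_eq_cat (A B : Type) (g : A -> B) (u : seq A) (a b : seq B) :
  map g u = a ++ b ->
  exists u1 u2, [/\ u = u1 ++ u2, map g u1 = a & map g u2 = b].
Proof.
move=> h; exists (take (size a) u), (drop (size a) u).
by rewrite cat_take_drop map_take map_drop h take_size_cat // drop_size_cat.
Qed.

Section Presentation.
Context {k : kind} {n : nat}.
Implicit Types (u v w : word k n).
Notation ceq := (ceq (@compl k n)).

Definition raw_eq (l r : seq (nat * nat)) := forall a b u v,
  map (@gv k n) u = a ++ l ++ b -> map (@gv k n) v = a ++ r ++ b -> beq u v.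

Lemma raw_eq_refl l : raw_eq l l.
Proof.
move=> a b u v hu hv; rewrite (inj_map (@gv_inj k n) (etrans hu (esym hv))).
exact: beq_refl.
Qed.

Lemma raw_eq_sym l r : raw_eq l r -> raw_eq r l.
Proof. by move=> h a b u v hu hv; apply: beq_sym; exact: h hv hu. Qed.

Lemma raw_eq_rel l r : rel_pair k l r -> raw_eq l r.
Proof. by move=> h a b u v hu hv; exact: beq_step h hu hv. Qed.

Lemma raw_eq_cat x y l r : raw_eq l r -> raw_eq (x ++ l ++ y) (x ++ r ++ y).
Proof.
move=> h a b u v hu hv; apply: (h (a ++ x) (y ++ b)).
- by rewrite hu -!catA.
- by rewrite hv -!catA.
Qed.

Lemma word_of_raw l : all (raw_valid k n) l -> exists u : word k n, map (@gv k n) u = l.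
Proof.
elim: l => [|p l IH] /=; first by exists [::].
by move=> /andP[/gv_onto[s hs] /IH[u hu]]; exists (s :: u); rewrite /= hs hu.
Qed.

(** Validity lets the middle word lift to generators; [raw_eq] is vacuous for a word containing an
    invalid pair, so such a word could link anything. *)
Lemma raw_eq_trans m l r : all (raw_valid k n) m -> raw_eq l m -> raw_eq m r -> raw_eq l r.
Proof.
move=> hm h1 h2 a b u v hu hv.
have : all (raw_valid k n) (a ++ l ++ b).
  by rewrite -hu all_map; apply/allP => s _; exact: gv_valid.
rewrite !all_cat => /andP[ha /andP[_ hb]].
have [w hw] : exists w : word k n, map (@gv k n) w = a ++ m ++ b.
  by apply: word_of_raw; rewrite !all_cat ha hm hb.
exact: beq_trans (h1 _ _ _ _ hu hw) (h2 _ _ _ _ hw hv).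
Qed.

End Presentation.

Lemma raw_eq_tri n i j m : i < j -> j < m ->
  forall l r, l \in [:: [:: (i, j); (j, m)]; [:: (j, m); (i, m)]; [:: (i, m); (i, j)]] ->
  r \in [:: [:: (i, j); (j, m)]; [:: (j, m); (i, m)]; [:: (i, m); (i, j)]] ->
  @raw_eq Dual n l r.
Proof.
move=> ij jm l r hl hr; apply: raw_eq_rel; left.
by exists i, j, m; rewrite ij jm.
Qed.

(** Three triangle relations are chained, in the triangles [a < c < b], [a < b < d] and
    [c < b < d]. *)
Lemma raw_eq_crossing n a b c d : 1 <= a -> a < c -> c < b -> b < d -> d <= n ->
  @raw_eq Dual n [:: (a, b); (a, c); (b, d)] [:: (c, d); (c, b); (a, d)].
Proof.
move=> a1 ac cb bd dn.
apply: (@raw_eq_trans _ _ [:: (c, b); (a, b); (b, d)]).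
- by rewrite /= /raw_valid /=; lia.
- apply: (@raw_eq_cat _ _ [::] [:: (b, d)] [:: (a, b); (a, c)] [:: (c, b); (a, b)]).
  by apply: (raw_eq_tri ac cb); rewrite !inE eqxx ?orbT.
apply: (@raw_eq_trans _ _ [:: (c, b); (b, d); (a, d)]).
- by rewrite /= /raw_valid /=; lia.
- apply: (@raw_eq_cat _ _ [:: (c, b)] [::] [:: (a, b); (b, d)] [:: (b, d); (a, d)]).
  by apply: (raw_eq_tri (ltn_trans ac cb) bd); rewrite !inE eqxx ?orbT.
apply: (@raw_eq_cat _ _ [::] [:: (a, d)] [:: (c, b); (b, d)] [:: (c, d); (c, b)]).
by apply: (raw_eq_tri cb bd); rewrite !inE eqxx ?orbT.
Qed.

Lemma raw_eq_compl k n p q : raw_valid k n p -> raw_valid k n q ->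
  @raw_eq k n (p :: raw_compl k p q) (q :: raw_compl k q p).
Proof.
case: k => /and3P[p1 p2 p3] /and3P[q1 q2 q3] /=.
  case: p q p1 p2 p3 q1 q2 q3 => i i' [j j'] /= _ _ /eqP-> _ _ /eqP->.
  rewrite /artin_compl /= [j == i]eq_sym [(i == _) || _]orbC.
  case: eqVneq => [->|ij]; first exact: raw_eq_refl.
  case: ifP => h; apply: raw_eq_rel; exists i, j.
  - by right; rewrite h.
  - by left; split => //; lia.
have [->|[i [j [m [ij jm [hp hq]]]]]|h|h] := dual_config p3 q3.
- exact: raw_eq_refl.
- have [[e1 e2 e3] [e4 e5 e6]] := dual_compl_tri ij jm.
  have e0 s : dual_compl s s = [::] by case: s => *; rewrite /dual_compl !eqxx.
  move: hp hq; rewrite !inE => /or3P[] /eqP-> /or3P[] /eqP->;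
    rewrite ?e0 ?e1 ?e2 ?e3 ?e4 ?e5 ?e6;
    first [exact: raw_eq_refl | by apply: (raw_eq_tri ij jm); rewrite !inE eqxx ?orbT].
- rewrite !dual_compl_noncrossing //; last by move: h; rewrite /noncrossing; lia.
  case: p q p1 p2 p3 q1 q2 q3 h => i j [m o] /= _ _ h1 _ _ h2; rewrite /noncrossing /=.
  move=> h; have [h'|h'] : ((i < j < m)%N && (m < o)%N || (i < m < o)%N && (o < j)%N) \/
     ((m < o < i)%N && (i < j)%N || (m < i < j)%N && (j < o)%N) by lia.
  + by apply: raw_eq_rel; right; exists i, j, m, o.
  + by apply: raw_eq_sym; apply: raw_eq_rel; right; exists m, o, i, j.
- case: p q p1 p2 p3 q1 q2 q3 h => a b [c d] /= a1 bn ab c1 dn cd.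
  move=> [/andP[/andP[h1 h2] h3]|/andP[/andP[h1 h2] h3]].
  + have [e1 e2] := dual_compl_crossing h1 h2 h3; rewrite /= e1 e2; exact: raw_eq_crossing.
  + have [e1 e2] := dual_compl_crossing h1 h2 h3; rewrite /= e1 e2.
    by apply: raw_eq_sym; exact: raw_eq_crossing.
Qed.

Section Presentation2.
Context {k : kind} {n : nat}.
Implicit Types (u v w : word k n).
Notation ceq := (ceq (@compl k n)).

Lemma beqP u v : beq u v <-> ceq u v.
Proof.
split.
  elim=> {u v} [u|u v _ h|u v w _ h1 _ h2|u v a b l r hr hu hv].
  - exact: ceq_refl.
  - exact: ceq_sym.
  - exact: ceq_trans h1 h2.
  have [e|[p [q [hl hr']]]] := rel_pair_compl hr.
    rewrite e -hv in hu; rewrite (inj_map (@gv_inj k n) hu); exact: ceq_refl.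
  have [u1 [u' [-> ea hu']]] := map_eq_cat hu.
  have [u2 [u3 [-> el eb]]] := map_eq_cat hu'.
  have [v1 [v' [-> ea' hv']]] := map_eq_cat hv.
  have [v2 [v3 [-> er eb']]] := map_eq_cat hv'.
  have -> : v1 = u1 by apply: (inj_map (@gv_inj k n)); rewrite ea ea'.
  have -> : v3 = u3 by apply: (inj_map (@gv_inj k n)); rewrite eb eb'.
  move: el er; rewrite hl hr'.
  case: u2 {hu hu'} => //= s u2 [hs hu2]; case: v2 {hv hv'} => //= t v2 [ht hv2].
  have -> : u2 = compl s t by apply: (inj_map (@gv_inj k n)); rewrite map_compl hu2 hs ht.
  have -> : v2 = compl t s by apply: (inj_map (@gv_inj k n)); rewrite map_compl hv2 hs ht.
  exact: ceq_step.
elim=> {u v} [u|u v _ h|u v w _ h1 _ h2|a b s t].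
- exact: beq_refl.
- exact: beq_sym.
- exact: beq_trans h1 h2.
apply: (raw_eq_compl (gv_valid s) (gv_valid t)).
- by rewrite map_cat /= map_cat map_compl.
- by rewrite map_cat /= map_cat map_compl.
Qed.

End Presentation2.

(** * The braid monoids *)

Section Monoid.
Context {k : kind} {n : nat}.
Implicit Types (s t : gen k n) (u v w : word k n) (x y z : M k n).
Notation ceq := (ceq (@compl k n)).
Local Notation "x ** y" := (mulM x y) (at level 40, left associativity).
Local Notation "1" := (unitM k n).

Lemma cls_eq u v : cls u = cls v <-> ceq u v.
Proof.
rewrite -beqP; split=> [[] h|h].
  by apply: beq_of_cls => /=; rewrite h.
apply: sig_eqP => /=; apply/funext => w; apply/propext; split=> h'.
- exact: beq_trans (beq_sym h) h'.
- exact: beq_trans h h'.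
Qed.

Lemma clsP x : exists u, x = cls u.
Proof. by exists (rep x); rewrite cls_rep. Qed.

Lemma rep_cls u : ceq (rep (cls u)) u.
Proof. by apply/cls_eq; rewrite cls_rep. Qed.

Lemma mulM_cls u v : cls u ** cls v = cls (u ++ v).
Proof.
apply/cls_eq; apply: (@ceq_trans _ _ _ (u ++ rep (cls v))).
- by apply: ceq_catr; exact: rep_cls.
- by apply: ceq_catl; exact: rep_cls.
Qed.

Lemma mulMA x y z : x ** (y ** z) = x ** y ** z.
Proof.
have [[[u ->] [v ->]] [w ->]] := (clsP x, clsP y, clsP z).
by rewrite !mulM_cls catA.
Qed.

Lemma mul1M x : 1 ** x = x.
Proof. by have [u ->] := clsP x; rewrite /unitM mulM_cls. Qed.

Lemma mulM1 x : x ** 1 = x.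
Proof. by have [u ->] := clsP x; rewrite /unitM mulM_cls cats0. Qed.

Lemma len_cls u : len (cls u) = size u.
Proof. by apply: (ceq_size compl_size); exact: rep_cls. Qed.

Lemma len_mul x y : len (x ** y) = len x + len y.
Proof.
have [[u ->] [v ->]] := (clsP x, clsP y).
by rewrite mulM_cls !len_cls size_cat.
Qed.

Lemma len1 : len 1 = 0. Proof. by rewrite len_cls. Qed.

Lemma len_gen s : len (genM s) = 1%N. Proof. by rewrite len_cls. Qed.

Lemma len_eq0 x : len x = 0 -> x = 1.
Proof. by have [u ->] := clsP x; rewrite len_cls => /size0nil ->. Qed.

Lemma cls_cons s u : cls (s :: u) = genM s ** cls u.
Proof. by rewrite mulM_cls. Qed.

Lemma mulM_inj x : injective (mulM x).
Proof.
move=> y z; have [[[u ->] [v ->]] [w ->]] := (clsP x, clsP y, clsP z).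
rewrite !mulM_cls => /cls_eq h; apply/cls_eq.
exact: (ceq_cancel compl_ss compl_size compl_cube h).
Qed.

Lemma M_head x : x = 1 \/ exists s y, x = genM s ** y.
Proof.
have [[|s u] ->] := clsP x; first by left.
by right; exists s, (cls u); rewrite cls_cons.
Qed.

Lemma M_ind (P : M k n -> Prop) :
  P 1 -> (forall s x, P x -> P (genM s ** x)) -> forall x, P x.
Proof.
move=> h1 hs x; have [u ->] := clsP x.
by elim: u => // s u IH; rewrite cls_cons; exact: hs.
Qed.

Lemma le1M x : le_l 1 x. Proof. by exists x; rewrite mul1M. Qed.

Lemma leMM x : le_l x x. Proof. by exists 1; rewrite mulM1. Qed.

Lemma leM_mulr x y : le_l x (x ** y). Proof. by exists y. Qed.

Lemma leM_trans y x z : le_l x y -> le_l y z -> le_l x z.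
Proof. by move=> [a ->] [b ->]; exists (a ** b); rewrite mulMA. Qed.

Lemma leM_len x y : le_l x y -> len x <= len y.
Proof. by move=> [a ->]; rewrite len_mul leq_addr. Qed.

Lemma leM_eq x y : le_l x y -> len y <= len x -> x = y.
Proof.
move=> [a ->]; rewrite len_mul -{2}[len x]addn0 leq_add2l leqn0 => /eqP/len_eq0 ->.
by rewrite mulM1.
Qed.

Lemma leM_anti x y : le_l x y -> le_l y x -> x = y.
Proof. by move=> h1 h2; apply: leM_eq => //; exact: leM_len. Qed.

Lemma leM_mul2l a x y : le_l (a ** x) (a ** y) <-> le_l x y.
Proof.
split=> [[z]|[z ->]]; last by exists z; rewrite mulMA.
by rewrite -mulMA => /mulM_inj ->; exists z.
Qed.

Lemma leM1 x : le_l x 1 -> x = 1.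
Proof. by move=> /leM_len; rewrite len1 leqn0 => /eqP/len_eq0. Qed.

Lemma compl_lcm s t : genM s ** cls (compl s t) = genM t ** cls (compl t s).
Proof.
rewrite -!cls_cons; apply/cls_eq.
have := @ceq_step _ (@compl k n) [::] [::] s t.
by rewrite /= !cats0.
Qed.

(** The lcm property in the form used from here on: divisibility by a generator is decided by
    peeling off first letters. *)
Lemma gen_le_mul s t y : le_l (genM t) (genM s ** y) <-> le_l (cls (compl s t)) y.
Proof.
split=> [[z]|[z ->]]; last first.
  by rewrite mulMA compl_lcm -mulMA; exact: leM_mulr.
have [[u ->] [v ->]] := (clsP y, clsP z).
rewrite -!cls_cons => /cls_eq /(ceq_factor compl_ss compl_size compl_cube) [w [h _]].
by exists (cls w); rewrite mulM_cls; apply/cls_eq.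
Qed.

Lemma gen_le_cons s u y : le_l (cls (s :: u)) (genM s ** y) <-> le_l (cls u) y.
Proof. by rewrite cls_cons; exact: leM_mul2l. Qed.

Definition is_join x y z :=
  [/\ le_l x z, le_l y z & forall b, le_l x b -> le_l y b -> le_l z b].

(** The submonoid generated by [D]; if [D] is stable under complements, it is closed under lcms. *)
Definition spelled (D : pred (gen k n)) x := exists2 u, all D u & x = cls u.

Definition compl_closed (D : pred (gen k n)) :=
  forall s t, D s -> D t -> all D (compl s t).

Lemma join_spelled D x y b : compl_closed D -> spelled D x -> spelled D y ->
  le_l x b -> le_l y b -> exists2 z, is_join x y z & spelled D z.
Proof.
move=> hD [u hu ->] [v hv ->] [w1 e1] [w2 e2].
have [[w1' E1] [w2' E2]] := (clsP w1, clsP w2); subst w1 w2.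
move: e2; rewrite {}e1 !mulM_cls => /cls_eq h.
have [a [b' [h1 ha hb h2]]] := ceq_lcm compl_ss compl_size compl_cube hD hu hv h.
exists (cls (u ++ a)); last by exists (u ++ a) => //; rewrite all_cat hu.
split.
- by rewrite -mulM_cls; exact: leM_mulr.
- by have /cls_eq -> := h1; rewrite -mulM_cls; exact: leM_mulr.
move=> c [z1 ->] [z2].
have [[z1' ->] [z2' ->]] := (clsP z1, clsP z2).
rewrite !mulM_cls => /cls_eq /h2 [z [g1 _]].
exists (cls z); rewrite mulM_cls; apply/cls_eq.
by rewrite -catA; apply: ceq_catl.
Qed.

Lemma join_ex x y b : le_l x b -> le_l y b -> exists z, is_join x y z.
Proof.
have sp z : spelled xpredT z.
  by have [u ->] := clsP z; exists u => //; apply/allP.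
move=> xb yb.
have [//|z hz _] := @join_spelled xpredT _ _ _ _ (sp x) (sp y) xb yb.
  by move=> s t _ _; apply/allP.
by exists z.
Qed.

Lemma is_lub_uniq (X : {set gen k n}) d d' : is_lub X d -> is_lub X d' -> d = d'.
Proof. by move=> [h1 h2] [h3 h4]; apply: leM_anti; [exact: h2|exact: h4]. Qed.

Lemma DeltaX_eq (X : {set gen k n}) d : is_lub X d -> DeltaX X = d.
Proof.
move=> h; apply: (@is_lub_uniq X) => //.
by rewrite /DeltaX; apply: (xgetPex 1); exists d.
Qed.

Lemma lub_spelled (D : pred (gen k n)) (X : {set gen k n}) b : compl_closed D ->
  (forall s, s \in X -> D s) -> (forall s, s \in X -> le_l (genM s) b) ->
  exists2 d, is_lub X d & spelled D d.
Proof.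
move=> hD hX hb.
suff [d [h1 h2 h3]] : exists d, [/\ forall s, s \in enum X -> le_l (genM s) d,
    (forall y, (forall s, s \in enum X -> le_l (genM s) y) -> le_l d y) & spelled D d].
  exists d => //; split=> [s hs|u hu]; first by apply: h1; rewrite mem_enum.
  by apply: h2 => s; rewrite mem_enum; exact: hu.
have : forall s, s \in enum X -> D s /\ le_l (genM s) b.
  by move=> s; rewrite mem_enum => hs; split; [exact: hX|exact: hb].
elim: (enum X) => [|t l IH] hl.
  by exists 1; split=> //; [move=> u _; exact: le1M|exists [::]].
have [|d [h1 h2 h3]] := IH.
  by move=> s hs; apply: hl; rewrite inE hs orbT.
have [Dt tb] : D t /\ le_l (genM t) b by apply: hl; rewrite inE eqxx.
have db : le_l d b.
  by apply: h2 => s hs; have [] : D s /\ le_l (genM s) b by apply: hl; rewrite inE hs orbT.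
have st : spelled D (genM t) by exists [:: t] => //=; rewrite Dt.
have [z [z1 z2 z3] sz] := join_spelled hD st h3 tb db.
exists z; split=> //.
  move=> s; rewrite inE => /orP[/eqP -> //|hs].
  exact: leM_trans (h1 _ hs) z2.
move=> u hu; apply: z3; first by apply: hu; rewrite inE eqxx.
by apply: h2 => s hs; apply: hu; rewrite inE hs orbT.
Qed.

Lemma compl_of s t u :
  raw_compl k (gv s) (gv t) = map (@gv k n) u -> compl s t = u.
Proof. by move=> h; apply: (inj_map (@gv_inj k n)); rewrite map_compl. Qed.

End Monoid.

(** In the second alternative [a b] divides the lcm of [a] and [b], hence [Delta]; this is how
    [compl_simple] handles complements of two letters. *)
Lemma compl_shape k n (s t : gen k n) : s <> t ->
  (exists a, compl s t = [:: a]) \/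
  exists a b u, compl s t = [:: a; b] /\ compl a b = b :: u.
Proof.
move=> hst; have := gv_valid s; have := gv_valid t; rewrite /raw_valid.
have {hst} : gv s <> gv t by move=> /gv_inj.
case: k s t => s t hst /and3P[_ _ h1] /and3P[_ _ h2].
  have e : ((gv s).1 == (gv t).1) = false.
    apply/negP => /eqP e; apply: hst; move: h1 h2 e.
    by case: (gv s) (gv t) => a a' [b b'] /= /eqP-> /eqP-> ->.
  case E : (((gv t).1 == (gv s).1.+1) || ((gv s).1 == (gv t).1.+1)).
    right; exists t, s, [:: t]; split; apply: compl_of; rewrite /= /artin_compl.
      by rewrite e E.
    by rewrite eq_sym e orbC E.
  by left; exists t; apply: compl_of; rewrite /= /artin_compl e E.
have cross p q : raw_compl Dual (gv s) (gv t) = [:: p; q] -> 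
    dual_compl p q = [:: q] -> 
    exists a b u, compl s t = [:: a; b] /\ compl a b = b :: u.
  rewrite -map_compl; case: (compl s t) => [|a [|b [|]]] //= [ea eb] h.
  exists a, b, [::]; split=> //; apply: compl_of.
  by rewrite /= ea eb h.
have sing p : raw_compl Dual (gv s) (gv t) = [:: p] -> exists a, compl s t = [:: a].
  by rewrite -map_compl; case: (compl s t) => [|a [|]] //= _; exists a.
have [//|[i [j [m [ij jm [hp hq]]]]]|h|h] := dual_config h2 h1.
- left; have [[e1 e2 e3] [e4 e5 e6]] := dual_compl_tri ij jm.
  move: hst sing; rewrite /raw_compl.
  by move: hp hq; rewrite !inE => /or3P[] /eqP-> /or3P[] /eqP-> // _ sing;
    eapply sing; rewrite ?e1 ?e2 ?e3 ?e4 ?e5 ?e6.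
- by left; apply: (sing (gv t)); rewrite /= dual_compl_noncrossing.
right; move: cross {sing}; rewrite /raw_compl.
move: h h1 h2 {hst}; case: (gv s) (gv t) => a b [c d] /= h cd ab cross.
case: h => /andP[/andP[h1 h2] h3].
- have [e1 e2] := dual_compl_crossing h1 h2 h3.
  apply: (cross _ _ e1); apply: dual_compl_noncrossing => //=.
  by rewrite /noncrossing /= h2.
- have [e1 e2] := dual_compl_crossing h1 h2 h3.
  apply: (cross _ _ e2); apply: dual_compl_noncrossing => //=; try lia.
  by rewrite /noncrossing /=; lia.
Qed.

(** * Common multiples of all generators *)

Section CommonMultiple.

(** The multiple is the product of [(1,m)], .., [(1,2)]. The complement in a chord after
    [c = (1,m+1)] is a chord [(1,b)] with [b <= m] if that chord meets [1] or [m+1], and the chord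
    itself otherwise, so the induction hypothesis applies. *)
Lemma dual_common_multiple n m : m <= n ->
  exists x : M Dual n, forall s, (gv s).2 <= m -> le_l (genM s) x.
Proof.
elim: m => [|m IH] hm.
  exists (unitM _ _) => s; have := gv_valid s; rewrite /raw_valid; lia.
have [x hx] := IH (ltnW hm).
have [m0|m0] := posnP m.
  exists x => s h; exfalso; have := gv_valid s; rewrite /raw_valid; lia.
have [c hc] : exists c : gen Dual n, gv c = (1, m.+1).
  by apply: gv_onto; rewrite /raw_valid /=; lia.
have small b : 1 < b <= m -> exists2 t : gen Dual n, gv t = (1, b) & le_l (genM t) x.
  move=> hb; have [t ht] : exists t : gen Dual n, gv t = (1, b).
    by apply: gv_onto; rewrite /raw_valid /=; lia.
  by exists t => //; apply: hx; rewrite ht /=; lia.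
exists (mulM (genM c) x) => s hs.
have [->|sc] := eqVneq s c; first exact: leM_mulr.
apply/gen_le_mul.
have : gv s != gv c by rewrite (inj_eq (@gv_inj _ _)).
have := gv_valid s; rewrite /raw_valid => /and3P[].
move es : (gv s) hs => [a b] /= hs a1 bn ab; rewrite hc => hne.
have [ea|ea] := eqVneq a 1.
  have hb : 1 < b <= m.
    rewrite -{1}ea ab /= -ltnS ltn_neqAle hs andbT.
    by apply: contraNneq hne => ->; rewrite ea.
  have [t ht tx] := small _ hb.
  rewrite (@compl_of _ _ _ _ [:: t]) // es hc /= ht /dual_compl /tri_compl ea.
  by repeat (case: ifPn => //= ?); exfalso; lia.
have [eb|eb] := eqVneq b m.+1.
  have ha : 1 < a <= m by lia.
  have [t ht tx] := small _ ha.
  rewrite (@compl_of _ _ _ _ [:: t]) // es hc /= ht /dual_compl /tri_compl eb.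
  by repeat (case: ifPn => //= ?); exfalso; lia.
rewrite (@compl_of _ _ _ _ [:: s]); first by apply: hx; rewrite es /= -ltnS ltn_neqAle eb.
move/eqP: ea => ea; move/eqP: eb => eb.
by rewrite es hc /= es dual_compl_noncrossing // /noncrossing /=; lia.
Qed.

Lemma artin_compl_far n (s t : gen Artin n) :
  ((gv s).1.+1 < (gv t).1) || ((gv t).1.+1 < (gv s).1) -> compl s t = [:: t].
Proof.
move=> h; apply: compl_of; move: h; rewrite /raw_compl /artin_compl.
move=> h.
by case: eqP => [?|_]; [lia|case: ifP => h' //; lia].
Qed.

Lemma artin_compl_near n (s t : gen Artin n) :
  ((gv s).1.+1 == (gv t).1) || ((gv t).1.+1 == (gv s).1) -> compl s t = [:: t; s].
Proof.
move=> h; apply: compl_of; move: h; rewrite /raw_compl /artin_compl.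
move=> /orP[] /eqP <-.
- by rewrite eqxx ltn_eqF.
- by rewrite eqxx orbT gtn_eqF.
Qed.

Lemma artin_gen_eq n (s t : gen Artin n) : (gv s).1 = (gv t).1 -> s = t.
Proof.
move=> e; apply: gv_inj; have := gv_valid s; have := gv_valid t; move: e.
rewrite /raw_valid; case: (gv s) (gv t) => a a' [b b'] /= -> /and3P[_ _ /eqP->].
by move=> /and3P[_ _ /eqP->].
Qed.

Lemma artin_common_multiple n m : m <= n ->
  exists x : M Artin n, forall s, (gv s).1 < m -> le_l (genM s) x.
Proof.
elim: m => [|m IH] hm; first by exists (unitM _ _).
have [x hx] := IH (ltnW hm).
have [m0|m0] := posnP m.
  exists x => s h; exfalso; have := gv_valid s; rewrite /raw_valid; lia.
have [mn|mn] := ltnP m n; last by exfalso; lia.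
(* Here [y = s_j .. s_m x], built downwards from [j = m]. Only the generator [j-1] is not yet known
   to divide [y]; the clause on [z] provides the second letter of the complement in the braid
   relation between [s_j] and [s_(j+1)]. *)
suff H j : 0 < j <= m -> exists y z sj, [/\ (gv sj).1 = j, y = mulM (genM sj) z,
    (forall s : gen Artin n, j <= (gv s).1 < m.+1 -> le_l (genM s) y),
    (forall s : gen Artin n, (gv s).1.+1 < j -> le_l (genM s) y) &
    (forall s : gen Artin n, (gv s).1 < j -> le_l (genM s) z)].
  have [|y [_ [_ [_ _ hy _ _]]]] := H 1; first by lia.
  exists y => s hs; apply: hy; have := gv_valid s; rewrite /raw_valid; lia.
move: {2}(m - j) (erefl (m - j)) => d; elim: d j => [|d IHd] j ed hj.
  have -> : j = m by lia.
  have [sm hsm] : exists s : gen Artin n, gv s = (m, m.+1).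
    by apply: gv_onto; rewrite /raw_valid /=; lia.
  exists (mulM (genM sm) x), x, sm; split=> //; first by rewrite hsm.
  - move=> s hs; have -> : s = sm by apply: artin_gen_eq; rewrite hsm /=; lia.
    exact: leM_mulr.
  - move=> s hs; apply/gen_le_mul; rewrite artin_compl_far ?hsm //=.
      by apply: hx; lia.
    by rewrite hs orbT.
have [||y [z [s' [hs' ey ya yb za]]]] := IHd j.+1; try lia.
have [sj hsj] : exists s : gen Artin n, gv s = (j, j.+1).
  by apply: gv_onto; rewrite /raw_valid /=; lia.
exists (mulM (genM sj) y), y, sj; split=> //; first by rewrite hsj.
- move=> s hs; have [e|e] := eqVneq (gv s).1 j.
    have -> : s = sj by apply: artin_gen_eq; rewrite hsj e.
    exact: leM_mulr.
  have [e1|e1] := eqVneq (gv s).1 j.+1.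
    have -> : s = s' by apply: artin_gen_eq; rewrite hs' e1.
    apply/gen_le_mul; rewrite artin_compl_near ?hsj ?hs' ?eqxx //.
    by rewrite ey gen_le_cons; apply: (za sj); rewrite hsj /=.
  by apply/gen_le_mul; rewrite artin_compl_far; [apply: ya|rewrite hsj /=]; lia.
- by move=> s hs; apply/gen_le_mul; rewrite artin_compl_far; [apply: yb|rewrite hsj /=]; lia.
Qed.

Lemma common_multiple k n : exists x : M k n, forall s, le_l (genM s) x.
Proof.
case: k.
  have [x hx] := @artin_common_multiple n n (leqnn n); exists x => s; apply: hx.
  by have := gv_valid s; rewrite /raw_valid; lia.
have [x hx] := @dual_common_multiple n n (leqnn n); exists x => s; apply: hx.
by have := gv_valid s; rewrite /raw_valid; lia.
Qed.

End CommonMultiple.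

(** * Garside structure and normal forms *)

Section Garside.
Context {k : kind} {n : nat}.
Implicit Types (s t : gen k n) (x y z : M k n) (xi zeta : Mbar k n).
Local Notation "x ** y" := (mulM x y) (at level 40, left associativity).
Local Notation "1" := (unitM k n).

Lemma lub_bounded (X : {set gen k n}) y :
  (forall s, s \in X -> le_l (genM s) y) -> is_lub X (DeltaX X).
Proof.
move=> hy; have cl : @compl_closed k n xpredT by move=> s t _ _; apply/allP.
have [d hd _] := lub_spelled cl (fun _ _ => isT) hy.
by rewrite (DeltaX_eq hd).
Qed.

Lemma DeltaX_lub (X : {set gen k n}) : is_lub X (DeltaX X).
Proof. by have [y hy] := common_multiple k n; apply: (lub_bounded (y := y)). Qed.

Lemma DeltaX_ge (X : {set gen k n}) s : s \in X -> le_l (genM s) (DeltaX X).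
Proof. by have [h _] := DeltaX_lub X; exact: h. Qed.

Lemma DeltaX_le (X : {set gen k n}) y :
  (forall s, s \in X -> le_l (genM s) y) -> le_l (DeltaX X) y.
Proof. by have [_ h] := DeltaX_lub X; exact: h. Qed.

Lemma gen_simple s : simple (genM s).
Proof. by apply: DeltaX_ge; rewrite finset.in_setT. Qed.

Lemma le_simple x y : le_l x y -> simple y -> simple x.
Proof. exact: leM_trans. Qed.

Lemma join_simple x y z : is_join x y z -> simple x -> simple y -> simple z.
Proof. by move=> [_ _ h]; exact: h. Qed.

Lemma compl_simple s t : simple (cls (compl s t)).
Proof.
have [->|/eqP /compl_shape [[a ->]|[a [b [u [-> e]]]]]] := eqVneq s t.
- by rewrite compl_ss; exact: simple_unit.
- exact: gen_simple.
have [z ez] := gen_simple a.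
have := gen_simple b; rewrite /simple ez gen_le_mul e => h.
rewrite cls_cons leM_mul2l; apply: leM_trans h.
by rewrite !cls_cons leM_mul2l; exact: le1M.
Qed.

(* [v] is the lcm of the complements [compl s t], which are all simple. *)
Lemma Delta_tail s v : Delta k n = genM s ** v -> simple v.
Proof.
move=> e.
suff [m [h1 h2 h3]] : exists m, [/\ le_l m v, simple m &
    forall t, le_l (cls (compl s t)) m].
  have : le_l (Delta k n) (genM s ** m).
    by apply: DeltaX_le => t _; rewrite gen_le_mul.
  by rewrite e leM_mul2l => /(leM_anti h1) <-.
suff [m [h1 h2 h3]] : exists m, [/\ le_l m v, simple m &
    forall t, t \in enum [set: gen k n]%SET -> le_l (cls (compl s t)) m].
  by exists m; split => // t; apply: h3; rewrite mem_enum finset.in_setT.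
elim: (enum _) => [|t l [m [h1 h2 h3]]].
  by exists 1; split=> //; [exact: le1M|exact: simple_unit].
have ht : le_l (cls (compl s t)) v.
  by rewrite -gen_le_mul -e; exact: gen_simple.
have [m' hm'] := join_ex ht h1; case: (hm') => g1 g2 g3.
exists m'; split; first exact: g3.
  exact: join_simple hm' (compl_simple s t) h2.
move=> t'; rewrite inE => /orP[/eqP -> //|/h3 h].
exact: leM_trans h g2.
Qed.

(** Peeling off the letters of [x] one by one reduces this to [Delta_tail]. It is half of the
    balancedness of [Delta]: right divisors are left divisors. *)
Lemma simple_right x y : simple (x ** y) -> simple y.
Proof.
suff H : forall y, Delta k n = x ** y -> simple y.
  by move=> [z]; rewrite -mulMA => /H; apply: le_simple; exact: leM_mulr.
elim/(@M_ind k n): x {y} => [|s x IH] y.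
  by rewrite mul1M => <-; exact: leMM.
rewrite -mulMA => /Delta_tail [z]; rewrite -mulMA => /IH.
by apply: le_simple; exact: leM_mulr.
Qed.

(** If [x a = a b = Delta], then [x Delta = x a b = Delta b]. *)
Lemma simple_Delta x : simple x -> exists2 y, simple y & x ** Delta k n = Delta k n ** y.
Proof.
move=> [a ea]; have [b eb] : simple a by apply: (simple_right (x := x)); rewrite -ea; exact: leMM.
exists b; first by apply: (simple_right (x := a)); rewrite -eb; exact: leMM.
by rewrite {1}eb mulMA -ea.
Qed.

Definition Dpow m := iter m (mulM (Delta k n)) 1.

Lemma DpowSr m : Dpow m.+1 = Dpow m ** Delta k n.
Proof. by elim: m => [|m IH]; rewrite /= ?mulM1 ?mul1M // -mulMA -IH. Qed.

Lemma simple_Dpow m x : simple x -> exists2 y, simple y & x ** Dpow m = Dpow m ** y.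
Proof.
elim: m x => [|m IH] x hx; first by exists x => //=; rewrite mulM1 mul1M.
have [y hy e] := simple_Delta hx; have [z hz e'] := IH y hy.
by exists z => //=; rewrite mulMA e -mulMA e' mulMA.
Qed.

(** Powers of [Delta] move past simple elements, so each letter of [x] costs one factor [Delta].
    Consequently [Delta_inf] lies in every [Uparrow x]. *)
Lemma le_Dpow x : le_l x (Dpow (len x)).
Proof.
elim/(@M_ind k n): x => [|s x IH]; first exact: le1M.
rewrite len_mul len_gen add1n.
have [y hy e] := simple_Dpow (len x) (gen_simple s).
apply: (@leM_trans _ _ (genM s ** Dpow (len x))); first by rewrite leM_mul2l.
by rewrite e DpowSr leM_mul2l.
Qed.

Lemma head_ex y : exists h, [/\ simple h, le_l h y &
  forall x, simple x -> le_l x y -> le_l x h].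
Proof.
pose P m := `[< exists h, [/\ simple h, le_l h y & len h = m] >].
have P0 : exists m, P m.
  exists 0; apply/asboolP; exists 1; split; [exact: simple_unit|exact: le1M|exact: len1].
have Pm m : P m -> m <= len y by move=> /asboolP [h [_ /leM_len hl <-]].
have [m] := ex_maxnP P0 Pm; move=> /asboolP [h [h1 h2 h3]] hm; exists h; split=> // x hx xy.
have [z hz] := join_ex xy h2; case: (hz) => z1 z2 z3.
have : len z <= len h.
  rewrite h3; apply: hm; apply/asboolP; exists z; split=> //; last exact: z3.
  exact: join_simple hz hx h1.
by move=> /(leM_eq z2) ->.
Qed.

Definition head y := projT1 (cid (head_ex y)).

Lemma headP y : [/\ simple (head y), le_l (head y) y &
  forall x, simple x -> le_l x y -> le_l x (head y)].
Proof. by rewrite /head; case: cid. Qed.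

Lemma tail_ex y : exists z, y = head y ** z.
Proof. by have [_ [z e] _] := headP y; exists z. Qed.

Definition tail y := projT1 (cid (tail_ex y)).

Lemma head_tail y : y = head y ** tail y.
Proof. by rewrite /tail; case: cid. Qed.

Fixpoint prod_simple m x : Prop :=
  if m is m'.+1 then exists r y, [/\ simple r, prod_simple m' y & x = r ** y]
  else x = 1.

Lemma prod_simple_len x : prod_simple (len x) x.
Proof.
elim/(@M_ind k n): x => [|s x IH]; first by rewrite len1.
rewrite len_mul len_gen add1n; exists (genM s), x; split=> //.
exact: gen_simple.
Qed.

(** Removing [a] on the left does not increase the number of simple factors: the lcm [s t] of a
    generator [s] and a simple element is simple, hence so is [t]. *)
Lemma prod_simple_split m x a b : prod_simple m x -> le_l x (a ** b) ->
  exists y, [/\ prod_simple m y, le_l y b & le_l x (a ** y)].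
Proof.
elim: m x a b => [|m IH] x a b.
  by move=> -> _; exists 1; split=> //; exact: le1M.
elim/(@M_ind k n): a x b => [|s a IHa] x b hx hb.
  by exists x; rewrite -{1}(mul1M b); split=> //; rewrite mul1M //; exact: leMM.
suff [y [y1 y2 y3]] : exists y, [/\ prod_simple m.+1 y, le_l y (a ** b) & le_l x (genM s ** y)].
  have [y' [z1 z2 z3]] := IHa _ _ y1 y2.
  exists y'; split=> //; apply: leM_trans y3 _.
  by rewrite -mulMA leM_mul2l.
move: hx hb => [r [x' [hr hx' ->]]]; rewrite -mulMA; set c := a ** b => hb.
have [z hz] := join_ex (leM_mulr (genM s) c) (leM_trans (leM_mulr r x') hb).
have zs := join_simple hz (gen_simple s) hr.
case: hz => [[t et] [t' et'] z3].
have ts : simple t by apply: (simple_right (x := genM s)); rewrite -et.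
have : le_l z (genM s ** c).
  by apply: z3; [exact: leM_mulr|exact: leM_trans (leM_mulr r x') hb].
rewrite et leM_mul2l => -[c' ec].
move: hb; rewrite ec mulMA -et et' -mulMA leM_mul2l => hb.
have [y [y1 y2 y3]] := IH _ _ _ hx' hb.
exists (t ** y); split.
- by exists t, y.
- by rewrite leM_mul2l.
- by rewrite mulMA -et et' -mulMA leM_mul2l.
Qed.

Lemma Mbar_ext xi zeta : (forall i, term xi i = term zeta i) -> xi = zeta.
Proof. by move=> h; apply: sig_eqP; apply/funext => i; apply: sig_eqP; exact: h. Qed.

Lemma term_simple xi i : simple (term xi i).
Proof. exact: (proj2_sig (proj1_sig xi i)). Qed.

Lemma term_arrow xi i : arrow (term xi i) (term xi i.+1).
Proof. exact: (proj2_sig xi i). Qed.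

Definition mk_Mbar (f : nat -> M k n) (hf : forall i, simple (f i))
    (ha : forall i, arrow (f i) (f i.+1)) : Mbar k n :=
  exist (fun xi : nat -> S k n => forall i, arrow (proj1_sig (xi i)) (proj1_sig (xi i.+1)))
    (fun i => exist _ (f i) (hf i)) ha.

Definition shift xi : Mbar k n :=
  mk_Mbar (fun i => term_simple xi i.+1) (fun i => @term_arrow xi i.+1).

Lemma prodNS xi N : prodN xi N.+1 = term xi 0 ** prodN (shift xi) N.
Proof.
rewrite /prodN /= -[1%N]addn0 iotaDl foldr_map.
by congr mulM; elim: (iota 0 N) => //= i l ->.
Qed.

Lemma prodNSr xi N : prodN xi N.+1 = prodN xi N ** term xi N.
Proof.
elim: N xi => [|N IH] xi; first by rewrite /prodN /= mulM1 mul1M.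
by rewrite prodNS IH mulMA -prodNS.
Qed.

Lemma prodN0 xi : prodN xi 0 = 1. Proof. by []. Qed.

Lemma prodN_le xi N N' : N <= N' -> le_l (prodN xi N) (prodN xi N').
Proof.
move=> /subnK <-; elim: (N' - N) => [|d IH]; first exact: leMM.
by rewrite addSn prodNSr; apply: leM_trans IH (leM_mulr _ _).
Qed.

Lemma prodN_shift xi N m : prodN xi (N + m) = prodN xi N ** prodN (iter N shift xi) m.
Proof.
elim: N xi => [|N IH] xi; first by rewrite mul1M.
by rewrite addSn !prodNS IH mulMA -iterSr.
Qed.

Lemma term_shift xi N i : term (iter N shift xi) i = term xi (N + i).
Proof. by elim: N i => //= N IH i; rewrite addSnnS -IH. Qed.

Lemma prodN_eq xi zeta N : (forall i, i < N -> term xi i = term zeta i) ->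
  prodN xi N = prodN zeta N.
Proof.
elim: N => // N IH h; rewrite !prodNSr h // IH // => i hi.
by apply: h; exact: leqW.
Qed.

(** Local greediness implies global greediness: a generator extending the first term to a larger
    simple divisor would, by induction, divide the second term, against [arrow]. *)
Lemma le_prodN_term0 xi N x : simple x -> le_l x (prodN xi N) -> le_l x (term xi 0).
Proof.
elim: N xi x => [|N IH] xi x hx.
  by rewrite prodN0 => /leM1 ->; exact: le1M.
rewrite prodNS => hb; have [z hz] := join_ex hb (leM_mulr _ _).
have zs := join_simple hz hx (term_simple xi 0).
case: hz => z1 [u eu] z3.
have hu : le_l u (prodN (shift xi) N).
  by rewrite -(leM_mul2l (term xi 0)) -eu; apply: z3 => //; exact: leM_mulr.
have [u1|[s [u' eu']]] := M_head u; first by rewrite u1 mulM1 in eu; rewrite -eu.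
have su : le_l (genM s) u by rewrite eu'; exact: leM_mulr.
have := IH _ _ (gen_simple s) (leM_trans su hu).
move=> /(@term_arrow xi 0 s) [].
by apply: le_simple zs; rewrite eu leM_mul2l.
Qed.

Lemma prodN_term_inj xi zeta N : prodN xi N = prodN zeta N ->
  forall i, i < N -> term xi i = term zeta i.
Proof.
elim: N xi zeta => // N IH xi zeta e.
have e0 : term xi 0 = term zeta 0.
  apply: leM_anti.
  - apply: (@le_prodN_term0 _ N.+1); first exact: term_simple.
    by rewrite -e prodNS; exact: leM_mulr.
  - apply: (@le_prodN_term0 _ N.+1); first exact: term_simple.
    by rewrite e prodNS; exact: leM_mulr.
move=> [//|i] hi; move: e; rewrite !prodNS e0 => /mulM_inj /IH.
exact.
Qed.

Lemma prod_simple_prodN xi N : prod_simple N (prodN xi N).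
Proof.
elim: N xi => [|N IH] xi //; exists (term xi 0), (prodN (shift xi) N).
by split=> //; [exact: term_simple|rewrite prodNS].
Qed.

(** The reason why [Uparrow x] depends on finitely many terms: a divisor with [m] simple factors is
    already detected by the first [m] terms. *)
Lemma prod_simple_le m x xi N :
  prod_simple m x -> le_l x (prodN xi N) -> le_l x (prodN xi m).
Proof.
elim: m x xi N => [|m IH] x xi N; first by move=> -> _; exact: le1M.
case: N => [_ /leM1 -> |N]; first exact: le1M.
move=> [r [y [hr hy ->]]] h.
have [r' er] : le_l r (term xi 0).
  by apply: (@le_prodN_term0 _ N.+1) => //; apply: leM_trans h; exact: leM_mulr.
move: h; rewrite !prodNS er -!mulMA !leM_mul2l => h.
have [z [z1 z2 z3]] := prod_simple_split hy h.
by apply: leM_trans z3 _; rewrite leM_mul2l; exact: IH z2.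
Qed.

Lemma le_prodN_len x xi N : le_l x (prodN xi N) -> le_l x (prodN xi (len x)).
Proof. exact: prod_simple_le (prod_simple_len x). Qed.

Lemma nf_simple x i : simple (head (iter i tail x)).
Proof. by have [] := headP (iter i tail x). Qed.

Lemma nf_arrow x i : arrow (head (iter i tail x)) (head (iter i.+1 tail x)).
Proof.
move=> s hs hsim; set y := iter i tail x in hs hsim.
have [_ _ h] := headP y.
have : le_l (head y ** genM s) (head y).
  apply: h => //; rewrite {2}(head_tail y) leM_mul2l.
  by have [_ h' _] := headP (tail y); exact: leM_trans hs h'.
by move=> /leM_len; rewrite len_mul len_gen addn1 ltnn.
Qed.

Definition nf x : Mbar k n := mk_Mbar (nf_simple x) (@nf_arrow x).

Lemma prodN_nf x N : prodN (nf x) N ** iter N tail x = x.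
Proof.
elim: N => [|N IH]; first by rewrite mul1M.
by rewrite prodNSr -mulMA /= -head_tail.
Qed.

Lemma head_eq1 x : head x = 1 -> x = 1.
Proof.
move=> h; have [//|[s [y e]]] := M_head x; have [_ _ hx] := headP x.
have : le_l (genM s) (head x) by apply: hx; [exact: gen_simple|rewrite e; exact: leM_mulr].
by rewrite h => /leM_len; rewrite len1 len_gen.
Qed.

Lemma tail_nf x : iter (len x) tail x = 1.
Proof.
suff H N : len (iter N tail x) <= len x - N.
  by apply: len_eq0; apply/eqP; rewrite -leqn0 -(subnn (len x)); exact: H.
elim: N => [|N IH]; first by rewrite subn0.
rewrite iterS subnS; set y := iter N tail x in IH *.
have e := congr1 (@len k n) (head_tail y); rewrite len_mul in e.
have [h0|h0] := posnP (len (head y)); last by lia.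
have y1 := head_eq1 (len_eq0 h0).
by move: e IH; rewrite y1 len1; lia.
Qed.

Lemma prodN_eventually xi N m : (forall i, N <= i -> term xi i = 1) ->
  prodN xi (N + m) = prodN xi N.
Proof.
move=> h; elim: m => [|m IH]; first by rewrite addn0.
by rewrite addnS prodNSr IH h ?leq_addr // mulM1.
Qed.

Lemma nf_of_nf x : nf_of x (nf x).
Proof.
exists (len x); split; last by have := prodN_nf x (len x); rewrite tail_nf mulM1.
move=> i hi; have : len (iter i tail x) = 0.
  rewrite -(subnK hi) iterD tail_nf.
  elim: (i - len x) => [|d IH]; first exact: len1.
  rewrite iterS (len_eq0 IH).
  have := congr1 (@len k n) (head_tail 1); rewrite len_mul len1; lia.
move=> /len_eq0 e; rewrite /term /= e.
by have [_ h _] := headP 1; exact: leM1.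
Qed.

Lemma nf_of_uniq x xi zeta : nf_of x xi -> nf_of x zeta -> xi = zeta.
Proof.
move=> [N [hN eN]] [N' [hN' eN']]; apply: Mbar_ext => i.
apply: (@prodN_term_inj _ _ (N + N' + i.+1)); last by lia.
rewrite -addnA prodN_eventually // eN.
by rewrite addnA (addnC N) -addnA prodN_eventually.
Qed.

Lemma nf_of_embed x : nf_of x (embed x).
Proof. by rewrite /embed; apply: (xgetPex (Mbar_point k n)); exists (nf x); exact: nf_of_nf. Qed.

Lemma embed_eq x xi : nf_of x xi -> embed x = xi.
Proof. exact: nf_of_uniq (nf_of_embed x). Qed.

Lemma prodN_embed x N : len x <= N -> prodN (embed x) N = x.
Proof.
move=> h; rewrite (embed_eq (nf_of_nf x)).
have := prodN_nf x N; rewrite -(subnK h) iterD tail_nf.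
suff -> : iter (N - len x) tail 1 = 1 by rewrite mulM1.
apply: len_eq0; elim: (N - len x) => [|d IH]; first exact: len1.
rewrite iterS (len_eq0 IH).
have := congr1 (@len k n) (head_tail 1); rewrite len_mul len1; lia.
Qed.

Lemma le_prodN_embed x N : le_l (prodN (embed x) N) x.
Proof.
rewrite -{2}(@prodN_embed x (N + len x)) ?leq_addl //.
exact: prodN_le (leq_addr _ _).
Qed.

Lemma term_embed x i : len x <= i -> term (embed x) i = 1.
Proof.
move=> h; apply: (mulM_inj (x := x)).
by rewrite -{1}(prodN_embed h) -prodNSr prodN_embed ?mulM1 // leqW.
Qed.

Lemma embed_inj : injective (@embed k n).
Proof.
move=> x y e; rewrite -(@prodN_embed x (len x + len y)) ?leq_addr // e.
by rewrite prodN_embed // leq_addl.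
Qed.

Lemma prodN_embed_prodN xi N : prodN (embed (prodN xi N)) N = prodN xi N.
Proof.
apply: leM_anti; first exact: le_prodN_embed.
apply: (prod_simple_le (N := len (prodN xi N)) (prod_simple_prodN xi N)).
by rewrite prodN_embed //; exact: leMM.
Qed.

Lemma UparrowP x xi : Uparrow x xi <-> le_l x (prodN xi (len x)).
Proof.
split=> [h|h].
  have [||zeta hz [z _ e]] := h [set zeta | forall i, i < len x -> term zeta i = term xi i].
  - by move=> zeta /= hz; exists (len x) => z' hz' i hi; rewrite hz' // hz.
  - by [].
  rewrite -(prodN_eq hz) -e.
  apply: (@le_prodN_len _ _ (len (x ** z))).
  by rewrite prodN_embed //; exact: leM_mulr.
move=> U oU Uxi; have [m hm] := oU _ Uxi.
pose N := maxn m (len x).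
have [z ez] : le_l x (prodN xi N) by apply: leM_trans h (prodN_le _ (leq_maxr _ _)).
exists (embed (prodN xi N)); last by exists z => //; rewrite -ez.
apply: hm => i hi; apply: (prodN_term_inj (prodN_embed_prodN xi N)).
exact: leq_trans hi (leq_maxl _ _).
Qed.

Lemma UparrowPex x xi : Uparrow x xi <-> exists N, le_l x (prodN xi N).
Proof.
split=> [/UparrowP h|[N h]]; first by exists (len x).
by apply/UparrowP; exact: le_prodN_len h.
Qed.

Lemma Uparrow_embed x y : Uparrow x (embed y) <-> le_l x y.
Proof.
rewrite UparrowPex; split=> [[N h]|h].
  exact: leM_trans h (le_prodN_embed _ _).
by exists (len y); rewrite prodN_embed.
Qed.

Lemma Uparrow1 : Uparrow 1 = setT.
Proof. by apply/seteqP; split=> // xi _; apply/UparrowPex; exists 0; exact: le1M. Qed.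

Lemma Uparrow_join x y z : is_join x y z -> Uparrow x `&` Uparrow y = Uparrow z.
Proof.
move=> [h1 h2 h3]; apply/seteqP; split=> xi.
  move=> [/UparrowPex [N hx] /UparrowPex [N' hy]]; apply/UparrowPex.
  exists (N + N'); apply: h3.
  - exact: leM_trans hx (prodN_le _ (leq_addr _ _)).
  - exact: leM_trans hy (prodN_le _ (leq_addl _ _)).
by move=> /UparrowPex [N h]; split; apply/UparrowPex; exists N; apply: leM_trans h.
Qed.

(** The complement of R(x): a simple element may follow [x] when no generator of [ext x] divides it
    ([arrowP]). *)
Definition ext x : {set gen k n} := [set s | `[< simple (x ** genM s) >]]%SET.

Lemma in_ext x s : s \in ext x <-> simple (x ** genM s).
Proof. by rewrite inE; split=> /asboolP. Qed.

Definition cyl N y : set (MbarT k n) := [set xi | prodN xi N = y].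

Definition avoid y (Y : {set gen k n}) : set (MbarT k n) :=
  Uparrow y `\` \bigcup_(s in [set` Y]) Uparrow (y ** genM s).

Lemma cyl_avoid zeta N :
  cyl N.+1 (prodN zeta N.+1) = avoid (prodN zeta N.+1) (ext (term zeta N)).
Proof.
apply/seteqP; split=> xi.
  move=> e; split; first by apply/UparrowPex; exists N.+1; rewrite e; exact: leMM.
  move=> [s /= /in_ext hs /UparrowPex [N' h]].
  have : le_l (prodN zeta N.+1 ** genM s) (prodN xi (N.+1 + N')).
    exact: leM_trans h (prodN_le _ (leq_addl _ _)).
  rewrite prodN_shift e leM_mul2l => /le_prodN_term0 -/(_ (gen_simple s)).
  rewrite term_shift addn0 => /(@term_arrow xi N s); apply.
  by rewrite (prodN_term_inj e).
move=> [/UparrowPex [N' h] hs].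
set y := prodN zeta N.+1 in h hs *.
have [z ez] : le_l y (prodN xi (N.+1 + N')).
  exact: leM_trans h (prodN_le _ (leq_addl _ _)).
have noext s : le_l (genM s) z -> ~ simple (term zeta N ** genM s).
  move=> sz /in_ext hsim; apply: hs; exists s => //; apply/UparrowPex.
  by exists (N.+1 + N'); rewrite ez leM_mul2l.
(* The first terms of [zeta] are continued by the normal form of [z]. By [noext] the junction is an
   arrow, so this is the normal form of [y z], and uniqueness identifies its first terms with those
   of [xi]. *)
pose f i := if i < N.+1 then term zeta i else term (nf z) (i - N.+1).
have fs i : simple (f i) by rewrite /f; case: ifP => _; exact: term_simple.
have fa i : arrow (f i) (f i.+1).
  rewrite /f; have [hi|hi] := leqP i.+1 N.
    by rewrite !ltnS hi (ltnW hi); exact: term_arrow.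
  have [->|ne] := eqVneq i N; last first.
    have hi' : N < i by rewrite ltn_neqAle eq_sym ne -ltnS.
    have -> : (i < N.+1) = false by rewrite ltnNge hi'.
    have -> : (i.+1 < N.+1) = false by rewrite ltnNge hi.
    by rewrite subSn //; exact: term_arrow.
  rewrite ltnSn ltnn subnn => s hsz; apply: noext.
  by have [_ h' _] := headP z; exact: leM_trans hsz h'.
pose theta := mk_Mbar fs fa.
have e1 : prodN theta N.+1 = y.
  by apply: prodN_eq => i hi; rewrite /term /= /f hi.
have e2 : forall m, prodN (iter N.+1 shift theta) m = prodN (nf z) m.
  move=> m; apply: prodN_eq => i hi.
  rewrite term_shift /term /= /f ltnNge leq_addr /= addKn //.
have nth0 : nf_of (y ** z) theta.
  exists (N.+1 + len z); split.
    move=> i hi; rewrite /term /= /f ltnNge (leq_trans (leq_addr _ _) hi) /=.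
    have := @term_embed z (i - N.+1); rewrite (embed_eq (nf_of_nf z)); apply.
    by lia.
  rewrite prodN_shift e1 e2; have := @prodN_embed z (len z) (leqnn _).
  by rewrite (embed_eq (nf_of_nf z)) => ->.
rewrite /cyl /= -e1; apply: prodN_eq => i hi.
have := prodN_embed_prodN xi (N.+1 + N'); rewrite ez (embed_eq nth0) -ez => /esym/prodN_term_inj; apply.
by lia.
Qed.

End Garside.

(** * Uniform measures and inclusion-exclusion *)

Local Open Scope ring_scope.

Section Measurability.
Context {k : kind} {n : nat}.
Implicit Types (x y z : M k n) (xi zeta : Mbar k n).

Lemma open_measurable_Mbar (U : set (MbarT k n)) : open_Mbar k n U -> measurable U.
Proof. by move=> oU; exact: sub_sigma_algebra. Qed.

Lemma open_Uparrow x : open_Mbar k n (Uparrow x).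
Proof.
move=> xi /UparrowP h; exists (len x) => zeta hz.
by apply/UparrowP; rewrite (prodN_eq hz).
Qed.

Lemma measurable_Uparrow x : measurable (Uparrow x).
Proof. by apply: open_measurable_Mbar; exact: open_Uparrow. Qed.

Lemma measurable_avoid y Y : measurable (avoid y Y).
Proof.
apply: measurableD; first exact: measurable_Uparrow.
apply: fin_bigcup_measurable; first exact: finite_finset.
by move=> s _; exact: measurable_Uparrow.
Qed.

Lemma measurable_cyl N y : measurable (cyl N y).
Proof.
apply: open_measurable_Mbar => xi e; exists N => zeta hz.
by rewrite /cyl /= (prodN_eq hz).
Qed.

(** The normal form has at most [len x] non-unit terms, so the extra term in the cylinder is the
    unit, and nothing but the unit can follow it. *)
Lemma embed_cyl x : [set embed x] = cyl (len x).+1 x.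
Proof.
apply/seteqP; split=> xi; first by move=> ->; rewrite /cyl /= prodN_embed.
move=> h; apply/esym/embed_eq; exists (len x).+1; split=> // i hi.
have e1 : prodN xi (len x) = x.
  apply: leM_anti; last by apply: (@le_prodN_len _ _ _ _ (len x).+1); rewrite h; exact: leMM.
  by rewrite -{2}h; exact: prodN_le.
have e : term xi (len x) = unitM k n.
  by apply: (mulM_inj (x := x)); rewrite -{1}e1 -prodNSr mulM1.
suff H : forall m, term xi (len x + m) = unitM k n.
  by rewrite -(subnKC (ltnW hi)); exact: H.
elim=> [|m IH]; first by rewrite addn0.
have [//|[s [z ez]]] := M_head (term xi (len x + m.+1)).
have := @term_arrow _ _ xi (len x + m) s; rewrite IH -addnS ez => /(_ (leM_mulr _ _)) [].
by rewrite mul1M; exact: gen_simple.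
Qed.

Lemma measurable_embed x : measurable [set embed x].
Proof. rewrite embed_cyl; exact: measurable_cyl. Qed.

Lemma countable_M (A : set (M k n)) : countable A.
Proof.
apply/countable_injP; exists (fun x : M k n => choice.pickle (rep x)).
by move=> x y _ _ /(pcan_inj choice.pickleK) e; rewrite -(cls_rep x) e cls_rep.
Qed.

Lemma bigcupM_measurable (F : M k n -> set (MbarT k n)) (A : set (M k n)) :
  (forall x, measurable (F x)) -> measurable (\bigcup_(x in A) F x).
Proof.
move=> mF; rewrite bigcup_mkcond.
apply: countable_bigcupT_measurable; first exact: countable_M.
by move=> x; case: ifP.
Qed.

Lemma measurable_embed_image (A : set (M k n)) : measurable (@embed k n @` A : set (MbarT k n)).
Proof.
have -> : @embed k n @` A = \bigcup_(x in A) [set embed x] :> set (MbarT k n).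
  by apply/seteqP; split=> [_ [x Ax <-]|_ [x Ax ->]]; exists x.
by apply: bigcupM_measurable => x; exact: measurable_embed.
Qed.

Lemma measurable_Mset : measurable (Mset k n).
Proof. exact: measurable_embed_image. Qed.

Lemma open_bigcup_cyl (U : set (MbarT k n)) : open_Mbar k n U ->
  U = \bigcup_N \bigcup_(x in [set x | cyl N.+1 x `<=` U]) cyl N.+1 x.
Proof.
move=> oU; apply/seteqP; split=> xi; last by move=> [N _ [x hx]]; exact: hx.
move=> /oU [m hm]; exists m => //; exists (prodN xi m.+1) => //= zeta e.
apply: hm => i hi; apply: (prodN_term_inj e); exact: leqW.
Qed.

Definition Uparrows : set (set (MbarT k n)) :=
  [set A | A = set0 \/ exists x, A = Uparrow x].

Lemma Uparrows_setI : setI_closed Uparrows.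
Proof.
move=> A B [->|[x ->]] [->|[y ->]]; rewrite ?set0I ?setI0; try by left.
have [->|/set0P [xi [/UparrowPex [N hx] /UparrowPex [N' hy]]]] := eqVneq (Uparrow x `&` Uparrow y) set0.
  by left.
have hx' := leM_trans hx (prodN_le xi (leq_addr N' N)).
have hy' := leM_trans hy (prodN_le xi (leq_addl N N')).
have [z hz] := join_ex hx' hy'.
by right; exists z; exact: Uparrow_join.
Qed.

Lemma Uparrows_measurable : @measurable _ (MbarT k n) = <<s Uparrows >>.
Proof.
apply/seteqP; split; last first.
  apply: smallest_sub; first exact: smallest_sigma_algebra.
  move=> A [->|[x ->]]; first exact: measurable0.
  exact: measurable_Uparrow.
apply: smallest_sub; first exact: smallest_sigma_algebra.
move=> U /open_bigcup_cyl ->.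
pose T := g_sigma_algebraType Uparrows.
change (@measurable _ T (\bigcup_N \bigcup_(x in [set x | cyl N.+1 x `<=` U]) cyl N.+1 x)).
have mU x : @measurable _ T (Uparrow x).
  by apply: sub_sigma_algebra; right; exists x.
apply: bigcupT_measurable => N; rewrite bigcup_mkcond.
apply: countable_bigcupT_measurable; first exact: countable_M.
move=> x; case: ifP => // _.
have [->|/set0P [zeta <-]] := eqVneq (cyl N.+1 x) set0; first exact: measurable0.
rewrite cyl_avoid; apply: measurableD => //.
by apply: fin_bigcup_measurable; first exact: finite_finset.
Qed.

Lemma uniform_unique (R : realType) (p : R) (nu1 nu2 : probability (MbarT k n) R) :
  uniform nu1 p -> uniform nu2 p ->
  forall A : set (MbarT k n), measurable A -> nu1 A = nu2 A.
Proof.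
move=> h1 h2 A mA.
apply: (measure_unique Uparrows (fun=> setT)) => //.
- exact: Uparrows_measurable.
- exact: Uparrows_setI.
- by move=> _; right; exists (unitM k n); rewrite Uparrow1.
- by apply/seteqP; split=> // xi _; exists 0%N.
- by move=> B [->|[x ->]]; [rewrite !measure0|exact: etrans (h1 x) (esym (h2 x))].
- by move=> _; apply: le_lt_trans (probability_le1 nu1 measurableT) _; exact: ltry.
Qed.

End Measurability.

Lemma sum_subsetU1 (T : finType) (V : zmodType) (s : T) (Y : {set T}) (F : {set T} -> V) :
  s \notin Y -> \sum_(X : {set T} | X \subset (s |: Y)%SET) F X =
  \sum_(X : {set T} | X \subset Y) F X + \sum_(X : {set T} | X \subset Y) F (s |: X)%SET.
Proof.
move=> sY; rewrite (bigID (fun X : {set T} => s \notin X)) /=; congr (_ + _).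
  apply: eq_bigl => X; apply/andP/idP => [[h sX]|h].
    by rewrite -(finset.setU1K sY) subsetD1 h.
  split; first exact: fintype.subset_trans h (finset.subsetUr _ _).
  by apply: contra sY => /(fintype.subsetP h).
rewrite (reindex_onto (fun X => (s |: X)%SET) (fun X => (X :\ s)%SET)) /=; last first.
  by move=> X /andP[_]; rewrite negbK => /finset.setD1K.
apply: eq_bigl => X; apply/idP/idP.
  move=> /andP[/andP[h _] /eqP e].
  have sX : s \notin X by rewrite -e !inE eqxx.
  by rewrite -(finset.setU1K sX) -(finset.setU1K sY) finset.setSD.
move=> h; rewrite finset.setUS // !inE eqxx /= finset.setU1K //.
by apply: contra sY => /(fintype.subsetP h).
Qed.

Lemma sum_alternating (R : pzRingType) (T : finType) (Y : {set T}) :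
  \sum_(X : {set T} | X \subset Y) (-1) ^+ #|X| = (Y == finset.set0)%:R :> R.
Proof.
have [->|[s sY]] := set_0Vmem Y.
  rewrite eqxx (big_pred1 finset.set0) ?cards0 // => X.
  by rewrite finset.subset0.
have -> : (Y == finset.set0) = false by apply/negP => /eqP e; rewrite e inE in sY.
rewrite -(finset.setD1K sY) sum_subsetU1 ?inE ?eqxx // -big_split /= big1 // => X hX.
have sX : s \notin X by apply/negP => /(fintype.subsetP hX); rewrite !inE eqxx.
by rewrite cardsU1 sX exprS mulN1r subrr.
Qed.

Section InclusionExclusion.
Context {k : kind} {n : nat} {R : realType}.
Implicit Types (x y z : M k n) (X Y : {set gen k n}) (p : R).
Local Notation "x ** y" := (mulM x y) (at level 40, left associativity).

(** All that inclusion-exclusion asks of a measure. Besides [nu], it covers [nu] restricted to an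
    event ([additive_nu]) and the weighted count of elements of the monoid ([additive_gfine]). *)
Definition additive_set (m : set (MbarT k n) -> R) := forall A B,
  measurable A -> measurable B -> m (A `\` B) = m A - m (A `&` B).

Lemma DeltaXU1 s X y :
  is_join (y ** DeltaX X) (y ** genM s) (y ** DeltaX (s |: X)%SET).
Proof.
split.
- rewrite leM_mul2l; apply: DeltaX_le => t tX; apply: DeltaX_ge.
  by rewrite !inE tX orbT.
- by rewrite leM_mul2l; apply: DeltaX_ge; rewrite !inE eqxx.
move=> b [c ->]; rewrite -mulMA !leM_mul2l => hs.
apply: DeltaX_le => t; rewrite !inE => /orP[/eqP -> //|tX].
exact: leM_trans (DeltaX_ge tX) (leM_mulr _ _).
Qed.

Lemma DeltaX0 : DeltaX finset.set0 = unitM k n.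
Proof. by apply: leM1; apply: DeltaX_le => s; rewrite inE. Qed.

Lemma incl_excl m y Y : additive_set m ->
  m (avoid y Y) = \sum_(X : {set gen k n} | X \subset Y) (-1) ^+ #|X| * m (Uparrow (y ** DeltaX X)).
Proof.
move=> hm.
(* Removing one generator [s] also produces the intersection with [Uparrow (y ** genM s)], which
   turns [X0] into [s |: X0]; hence the generalization over [X0]. *)
suff H X0 : m (Uparrow (y ** DeltaX X0) `\` \bigcup_(s in [set` Y]) Uparrow (y ** genM s)) =
    \sum_(X : {set gen k n} | X \subset Y) (-1) ^+ #|X| * m (Uparrow (y ** DeltaX (X0 :|: X)%SET)).
  rewrite /avoid; have := H finset.set0; rewrite DeltaX0 mulM1 => ->.
  by apply: eq_bigr => X _; rewrite finset.set0U.
move En : #|Y| => N; elim: N Y En X0 => [|N IH] Y En X0.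
  move/eqP: En; rewrite cards_eq0 => /eqP ->.
  rewrite (big_pred1 finset.set0) => [|X]; last by rewrite finset.subset0.
  rewrite cards0 mul1r finset.setU0; congr m.
  by apply/seteqP; split=> [xi []|xi h] //; split=> // -[s /=]; rewrite inE.
have [s sY] : exists s, s \in Y by apply/set0Pn; rewrite -card_gt0 En.
have eN : #|(Y :\ s)%SET| = N by have := cardsD1 s Y; rewrite sY En => -[].
rewrite -(finset.setD1K sY) sum_subsetU1 ?inE ?eqxx //.
set Z := (Y :\ s)%SET; set C := \bigcup_(t in [set` Z]) Uparrow (y ** genM t).
have mC : measurable C.
  apply: fin_bigcup_measurable; first exact: finite_finset.
  by move=> t _; exact: measurable_Uparrow.
have -> : \bigcup_(t in [set` (s |: Z)%SET]) Uparrow (y ** genM t) = C `|` Uparrow (y ** genM s).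
  apply/seteqP; split=> xi.
    move=> [t /=]; rewrite !inE => /orP[/eqP -> h|ht h]; first by right.
    by left; exists t => //=; rewrite !inE.
  move=> [[t /= ht h]|h]; first by exists t => //=; rewrite inE ht orbT.
  by exists s => //=; rewrite !inE eqxx.
rewrite -setDDl hm; last 2 first.
- by apply: measurableD => //; exact: measurable_Uparrow.
- exact: measurable_Uparrow.
rewrite {2}setDE setIAC -setDE (Uparrow_join (DeltaXU1 s X0 y)) !IH // -sumrN.
congr (_ + _); apply: eq_bigr => X hX.
have sX : s \notin X by apply/negP => /(fintype.subsetP hX); rewrite !inE eqxx.
rewrite cardsU1 sX exprS mulN1r mulNr; congr (- (_ * m (Uparrow (y ** DeltaX _)))).
by apply/setP => t; rewrite !inE orbCA orbA.
Qed.

(** The value h_Y(p) of the overview; under a uniform measure, the probability that no generator of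
    [Y] divides the stream. *)
Definition mobius p Y := \sum_(X : {set gen k n} | X \subset Y) (-1) ^+ #|X| * p ^+ len (DeltaX X).

Lemma mobius_avoid m c p y Y : additive_set m ->
  (forall X, X \subset Y -> m (Uparrow (y ** DeltaX X)) = c * p ^+ len (DeltaX X)) ->
  m (avoid y Y) = c * mobius p Y.
Proof.
move=> hm h; rewrite incl_excl // mulr_sumr; apply: eq_bigr => X hX.
by rewrite h // mulrCA.
Qed.

Lemma HnE p : Hn k n p = mobius p finset.setT.
Proof. by apply: eq_bigl => X; rewrite finset.subsetT. Qed.

Lemma mobius0 p : mobius p finset.set0 = 1.
Proof.
rewrite /mobius (big_pred1 finset.set0) => [|X]; last by rewrite finset.subset0.
by rewrite cards0 DeltaX0 len1 mulr1.
Qed.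

Section Probability.
Variable nu : probability (MbarT k n) R.

Lemma nu_fineK A : measurable A -> (fine (nu A))%:E = nu A.
Proof. by move=> mA; rewrite fineK // fin_num_measure. Qed.

Lemma additive_nu C : measurable C -> additive_set (fun A => fine (nu (A `&` C))).
Proof.
move=> mC A B mA mB.
have mAC := measurableI _ _ mA mC; have mABC := measurableI _ _ (measurableI _ _ mA mB) mC.
have -> : (A `\` B) `&` C = (A `&` C) `\` B by rewrite !setDE setIAC.
rewrite measureD //; last by rewrite (le_lt_trans (probability_le1 _ mAC)) // ltry.
by rewrite setIAC fineB // fin_num_measure.
Qed.

Lemma additive_nuT : additive_set (fine \o nu).
Proof.
by move=> A B mA mB; have := additive_nu measurableT mA mB; rewrite /= !setIT.
Qed.

Variable p : R.
Hypothesis hnu : uniform nu p.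

Lemma uniform_avoid y Y : nu (avoid y Y) = (p ^+ len y * mobius p Y)%:E.
Proof.
rewrite -nu_fineK; last exact: measurable_avoid.
congr EFin; apply: (mobius_avoid additive_nuT) => X _.
by rewrite /= hnu len_mul exprD.
Qed.

Lemma uniform_mobius_ge0 Y : 0 <= mobius p Y.
Proof.
have := uniform_avoid (unitM k n) Y; rewrite len1 mul1r -lee_fin => <-.
exact: measure_ge0.
Qed.

Lemma uniform_mobius_le X Y : X \subset Y -> mobius p Y <= mobius p X.
Proof.
move=> XY; rewrite -lee_fin.
have e' Z : (mobius p Z)%:E = nu (avoid (unitM k n) Z).
  by rewrite uniform_avoid len1 mul1r.
rewrite !e'; apply: le_measure; rewrite ?inE; try exact: measurable_avoid.
apply: setDS; apply: bigcup_subset => s /= sX; exact: (fintype.subsetP XY).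
Qed.

Lemma uniform_cyl (zeta : Mbar k n) N :
  nu (cyl N.+1 (prodN zeta N.+1)) =
  (p ^+ len (prodN zeta N.+1) * mobius p (ext (term zeta N)))%:E.
Proof. by rewrite cyl_avoid uniform_avoid. Qed.

Lemma uniform_embed x : nu [set embed x] = (Hn k n p * p ^+ len x)%:E.
Proof.
rewrite embed_cyl -{2}(@prodN_embed _ _ x (len x).+1) // uniform_cyl prodN_embed //.
rewrite term_embed // mulrC HnE; congr (EFin (mobius p _ * _)).
by apply/setP => s; rewrite finset.in_setT; apply/in_ext; rewrite mul1M; exact: gen_simple.
Qed.

End Probability.

End InclusionExclusion.

(** * Positivity of the Moebius values *)

Section PositivityRules.
Context {k : kind} {n : nat} {R : realType}.
Implicit Types (x y z : M k n) (X Y : {set gen k n}).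
Local Notation "x ** y" := (mulM x y) (at level 40, left associativity).
Variables (nu : probability (MbarT k n) R) (p : R).
Hypotheses (hnu : uniform nu p) (p_gt0 : 0 < p) (p_lt1 : p < 1).

(** The divisibility hypothesis puts [avoid w Y'] inside [avoid 1 Y], and the former event has mass
    [p ^+ len w * mobius p Y']. *)
Lemma mobius_step w Y Y' :
  (forall u, u \in Y -> exists2 u', u' \in Y' &
     forall z, le_l (genM u) (w ** z) -> le_l (genM u') z) ->
  0 < mobius p Y' -> 0 < mobius p Y.
Proof.
move=> h pos; apply: (@lt_le_trans _ _ (p ^+ len w * mobius p Y')).
  by rewrite mulr_gt0 // exprn_gt0.
have := uniform_avoid hnu (unitM k n) Y; rewrite len1 mul1r => e.
rewrite -lee_fin -e -(uniform_avoid hnu).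
apply: le_measure; rewrite ?inE; try exact: measurable_avoid.
move=> xi [hw hY']; split; first by rewrite Uparrow1.
move=> [u /= /h [u' hu' hz]]; rewrite mul1M => /UparrowPex [N hu].
case/UparrowPex: hw => N' hw; apply: hY'; exists u' => //; apply/UparrowPex.
exists (N + N')%N; move: (leM_trans hw (prodN_le xi (leq_addl N N'))) => [z ez].
rewrite ez leM_mul2l; apply: hz; rewrite -ez.
exact: leM_trans hu (prodN_le xi (leq_addr _ _)).
Qed.

(** Inclusion-exclusion over [Y1] for [nu] restricted to the event that nothing in [Y2] divides.
    Closedness writes [DeltaX X] in letters of [Y1]; its lcm with [t] in [Y2] is then [DeltaX X]
    followed by [t], so each term acquires the same factor [mobius p Y2]. *)
Lemma mobius_product Y1 Y2 : compl_closed (mem Y1) ->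
  (forall s t, s \in Y1 -> t \in Y2 -> compl s t = [:: t]) ->
  mobius p (Y1 :|: Y2)%SET = mobius p Y2 * mobius p Y1.
Proof.
move=> cl com.
pose m A := fine (nu (A `&` avoid (unitM k n) Y2)).
have am : additive_set m by apply: additive_nu; exact: measurable_avoid.
have joint u t : all (mem Y1) u -> t \in Y2 ->
    is_join (cls u) (genM t) (cls u ** genM t).
  move=> hu ht; split; first exact: leM_mulr.
    elim: u hu => [|s u IH] /=; first by rewrite mul1M => _; exact: leMM.
    move=> /andP[hs /IH hu]; rewrite cls_cons -mulMA gen_le_mul com //.
  move=> b [c ->]; rewrite leM_mul2l; elim: u hu c => [|s u IH] /=.
    by move=> _ c; rewrite mul1M.
  move=> /andP[hs /IH hu] c; rewrite cls_cons -mulMA gen_le_mul com //.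
  exact: hu.
have av X : X \subset Y1 ->
    Uparrow (DeltaX X) `&` avoid (unitM k n) Y2 = avoid (DeltaX X) Y2.
  move=> hX; have [d hd [u hu eu]] := lub_spelled cl
    (fun s hs => fintype.subsetP hX s hs) (@DeltaX_ge _ _ X).
  rewrite (DeltaX_eq hd) eu /avoid Uparrow1 setTD -setDE.
  apply/seteqP; split=> xi [h1 h2]; split=> // -[t /= ht h3]; apply: h2.
    exists t => //; rewrite mul1M.
    by move: h3; rewrite -(Uparrow_join (joint _ _ hu ht)) => -[].
  exists t => //; rewrite -(Uparrow_join (joint _ _ hu ht)); split=> //.
  by move: h3; rewrite mul1M.
have := @mobius_avoid k n R m (mobius p Y2) p (unitM k n) Y1 am.
move=> /(_ _)<-; last first.
  by move=> X hX; rewrite mul1M /m av // (uniform_avoid hnu) /= mulrC.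
have -> : mobius p (Y1 :|: Y2)%SET = fine (nu (avoid (unitM k n) (Y1 :|: Y2)%SET)).
  by rewrite (uniform_avoid hnu) len1 mul1r.
rewrite /m; congr (fine (nu _)); apply/seteqP; split=> xi.
  move=> [h1 h2]; split; split=> // -[t /= ht h3]; apply: h2; exists t => //=.
  - by rewrite inE ht.
  - by rewrite inE ht orbT.
move=> [[h1 h2] [_ h3]]; split=> // -[t /=]; rewrite inE => /orP[] ht h4.
- by apply: h2; exists t.
- by apply: h3; exists t.
Qed.

Lemma mobius1 (s : gen k n) : mobius p [set s]%SET = 1 - p.
Proof.
rewrite -[X in mobius p X]finset.setU0 /mobius sum_subsetU1 ?inE //.
have -> F : \sum_(X : {set gen k n} | X \subset finset.set0) F X = F finset.set0 :> R.
  by rewrite (big_pred1 finset.set0) => [//|X]; rewrite finset.subset0.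
have -> F : \sum_(X : {set gen k n} | X \subset finset.set0) F X = F finset.set0 :> R.
  by rewrite (big_pred1 finset.set0) => [//|X]; rewrite finset.subset0.
rewrite finset.setU0 cards0 cards1 DeltaX0 len1 !expr0 expr1 mulr1 mulN1r.
rewrite (@DeltaX_eq _ _ _ (genM s)) ?len_gen ?expr1 //.
split; first by move=> t; rewrite inE => /eqP ->; exact: leMM.
by move=> y; apply; rewrite inE.
Qed.

Lemma mobius_isolated t Y : t \in Y ->
  (forall u, u \in Y -> u != t -> compl t u = [:: u]) ->
  0 < mobius p (Y :\ t)%SET -> 0 < mobius p Y.
Proof.
move=> tY h pos; rewrite -(finset.setD1K tY) mobius_product.
- by rewrite mobius1 mulr_gt0 // subr_gt0.
- by move=> s s'; rewrite /= !inE => /eqP -> /eqP ->; rewrite compl_ss.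
- by move=> s s'; rewrite !inE => /eqP -> /andP[nt sY]; exact: h.
Qed.

End PositivityRules.

(** * Positivity for the positive braid monoid: particles and holes *)

Section ArtinPositivity.
Context {n : nat} {R : realType}.
Implicit Types (s t : gen Artin n) (Y : {set gen Artin n}).
Variables (nu : probability (MbarT Artin n) R) (p : R).
Hypotheses (hnu : uniform nu p) (p_gt0 : 0 < p) (p_lt1 : p < 1).

Lemma artin_compl_head s t : s != t -> exists u, compl s t = t :: u.
Proof.
move=> st; have ne : (gv s).1 <> (gv t).1 by move=> /artin_gen_eq e; rewrite e eqxx in st.
have [h|h] := boolP (((gv s).1.+1 == (gv t).1) || ((gv t).1.+1 == (gv s).1)).
  by rewrite artin_compl_near //; exists [:: s].
rewrite artin_compl_far; first by exists [::].
by move/eqP: ne; rewrite neq_ltn; move: h; case: ssrnat.ltngtP => //; lia.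
Qed.

(** Take [w = t0 t1] in [mobius_step]. If [t1] divides [t0 t1 z], the braid relation forces [t0] to
    divide [z]; any other generator of [Y] dividing [t0 t1 z] divides [z]. A particle thus moves
    from [t1] into the hole [t0]. *)
Lemma artin_swap t0 t1 Y : t0 \notin Y -> t1 \in Y ->
  ((gv t0).1.+1 == (gv t1).1) || ((gv t1).1.+1 == (gv t0).1) ->
  0 < mobius p (t0 |: (Y :\ t1))%SET -> 0 < mobius p Y.
Proof.
move=> h0 h1 adj; apply: (mobius_step hnu p_gt0 (w := cls [:: t0; t1])) => u uY.
have [->|ut1] := eqVneq u t1.
  exists t0; first by rewrite !inE eqxx.
  move=> z; rewrite cls_cons -mulMA gen_le_mul artin_compl_near //.
  by rewrite gen_le_cons.
have ut0 : t0 != u by apply: contraNneq h0 => ->.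
exists u; first by rewrite !inE ut1 uY orbT.
move=> z; rewrite cls_cons -mulMA gen_le_mul.
have [v ->] := artin_compl_head ut0 => h.
have : le_l (genM u) (mulM (genM t1) z).
  by apply: leM_trans h; rewrite cls_cons; exact: leM_mulr.
rewrite gen_le_mul; have [|v' ->] := @artin_compl_head t1 u; first by rewrite eq_sym.
by apply: leM_trans; rewrite cls_cons; exact: leM_mulr.
Qed.

Lemma artin_isolated t Y : t \in Y ->
  (forall u, u \in Y -> ((gv u).1.+1 != (gv t).1) && ((gv t).1.+1 != (gv u).1)) ->
  0 < mobius p (Y :\ t)%SET -> 0 < mobius p Y.
Proof.
move=> tY h; apply: (mobius_isolated hnu p_lt1) => // u uY ut.
apply: artin_compl_far; have := h _ uY.
have : (gv u).1 != (gv t).1 by apply: contraNneq ut => /artin_gen_eq ->.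
by case: ssrnat.ltngtP => //; lia.
Qed.

Lemma artin_gen_ex i : (0 < i < n)%N -> exists s : gen Artin n, (gv s).1 = i.
Proof.
move=> hi; have [|s hs] := @gv_onto Artin n (i, i.+1); last by exists s; rewrite hs.
by rewrite /raw_valid /=; lia.
Qed.

Lemma artin_gen_range s : (0 < (gv s).1 < n)%N.
Proof. by have := gv_valid s; rewrite /raw_valid; case: (gv s) => a b /=; lia. Qed.

(** [Y] is seen as a set of particles on the path [1, .., n-1]. Swaps keep their number, and
    deleting an isolated particle lowers it and leaves a hole, hence the induction on the
    cardinal. *)
Lemma artin_mobius_gt0 Y : Y != finset.setT -> 0 < mobius p Y.
Proof.
move En : #|Y| => N; elim/ltn_ind: N Y En => N IH Y En hole.
have smaller Y' t : t \in Y' -> #|Y'| = #|Y| -> 0 < mobius p (Y' :\ t)%SET.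
  move=> tY' eY'; apply: (IH _ _ _ erefl).
    by rewrite -En -eY' (cardsD1 t Y') tY' add1n.
  by apply/eqP => e; have := finset.in_setT t; rewrite -e !inE eqxx.
have swapc Y' t0 t1 : t0 \notin Y' -> t1 \in Y' -> #|(t0 |: (Y' :\ t1))%SET| = #|Y'|.
  by move=> h0 h1; rewrite cardsU1 (cardsD1 t1 Y') h1 !inE (negbTE h0) andbF.
(* A hole at [i+1], preceded by particles, moves down until [1] is isolated. *)
have initial i Y' tj : #|Y'| = #|Y| -> (gv tj).1 = i.+2 -> tj \notin Y' ->
    (forall s, (gv s).1 <= i.+1 -> s \in Y')%N -> 0 < mobius p Y'.
  elim: i Y' tj => [|i IHi] Y' tj eY' etj tjY' hlow.
    have [t1 et1] : exists s : gen Artin n, (gv s).1 = 1%N.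
      by apply: artin_gen_ex; have := artin_gen_range tj; lia.
    have t1Y : t1 \in Y' by apply: hlow; rewrite et1.
    apply: (artin_isolated t1Y); last exact: smaller.
    move=> u uY; rewrite et1 eqSS -lt0n.
    have /andP[-> _] := artin_gen_range u; rewrite /=.
    by apply: contraNneq tjY' => e; rewrite (_ : tj = u) //; apply: artin_gen_eq; rewrite etj e.
  have [t1 et1] : exists s : gen Artin n, (gv s).1 = i.+2.
    by apply: artin_gen_ex; have := artin_gen_range tj; lia.
  have t1Y : t1 \in Y' by apply: hlow; rewrite et1.
  apply: (artin_swap tjY' t1Y); first by rewrite et1 etj eqxx orbT.
  apply: (IHi _ t1) => //; first by rewrite swapc.
    rewrite !inE eqxx orbF; apply/eqP => e; move: etj; rewrite -e et1; lia.
  move=> s hs; rewrite !inE hlow ?(leq_trans hs) // andbT.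
  apply/orP; right; apply/eqP => e; move: hs; rewrite e et1; lia.
have [->|/set0Pn [s0 s0Y]] := eqVneq Y finset.set0.
  by rewrite mobius0.
have [j jY] : exists j, j \notin Y.
  apply/existsP; rewrite -negb_forall; apply: contra hole => /forallP h.
  by apply/eqP/setP => s; rewrite h finset.in_setT.
pose P i := [exists s in Y, (gv s).1 == i].
have exP : exists i, P i by exists (gv s0).1; apply/existsP; exists s0; rewrite s0Y /=.
have [a /existsP[ta /andP[taY /eqP eta]] amin] := ex_minnP exP.
(* If the first particle [a] is not at [1], moving it to [a-1] isolates it, since the others lie at
   [a+1] or beyond. If it is at [1], the first hole is brought down by [initial]. *)
have [a1|a1] := eqVneq a 1%N; last first.
  have [tb etb] : exists s : gen Artin n, (gv s).1 = a.-1.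
    by apply: artin_gen_ex; have := artin_gen_range ta; lia.
  have a0 : (0 < a)%N by rewrite -eta; have := artin_gen_range ta; lia.
  have tbY : tb \notin Y.
    apply/negP => h; suff : (a <= a.-1)%N by lia.
    by apply: amin; apply/existsP; exists tb; rewrite h etb /=.
  apply: (artin_swap tbY taY); first by rewrite etb eta prednK // eqxx.
  apply: (@artin_isolated tb); first by rewrite !inE eqxx.
    move=> u; rewrite !inE => /orP[/eqP ->|/andP[uta uY]]; first by lia.
    have : (a <= (gv u).1)%N.
      by apply: amin; apply/existsP; exists u; rewrite uY /=.
    have : (gv u).1 != a by apply: contraNneq uta => e; apply/eqP/artin_gen_eq; rewrite e.
    by rewrite etb; move: (gv u).1 => b; lia.
  apply: smaller; first by rewrite !inE eqxx.
  exact: swapc.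
pose Q i := [exists s in ~: Y, (gv s).1 == i].
have exQ : exists i, Q i by exists (gv j).1; apply/existsP; exists j; rewrite inE jY /=.
have [b /existsP[tb /andP[tbY /eqP etb]] bmin] := ex_minnP exQ.
rewrite inE in tbY.
have b2 : (1 < b)%N.
  have := artin_gen_range tb; rewrite etb => hb.
  suff : b <> 1%N by lia.
  move=> e; have : tb = ta by apply: artin_gen_eq; rewrite etb eta a1 e.
  by move=> e'; rewrite e' taY in tbY.
apply: (@initial b.-2 Y tb) => //; first by rewrite etb; lia.
move=> s hs; apply/negPn/negP => sY.
have : (b <= (gv s).1)%N by apply: bmin; apply/existsP; exists s; rewrite inE sY /=.
by move: hs; lia.
Qed.

End ArtinPositivity.

(** * Positivity for the dual braid monoid: chords of a polygon *)

Section DualPositivity.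
Context {n : nat} {R : realType}.
Implicit Types (s t : gen Dual n) (Y : {set gen Dual n}) (L : seq nat).
Variables (nu : probability (MbarT Dual n) R) (p : R).
Hypotheses (hnu : uniform nu p) (p_gt0 : 0 < p) (p_lt1 : p < 1).

Definition clique L : {set gen Dual n} :=
  [set s | ((gv s).1 \in L) && ((gv s).2 \in L)]%SET.

(* The chord [(a, b)] cuts the circle into the arc [a <= x < b] and its
   complement; these are the points of [L] on either side, joined by [a] and
   [b] respectively. *)
Definition inner L (a b : nat) := a :: [seq x <- L | a < x < b]%N.
Definition outer L (a b : nat) := b :: [seq x <- L | (x < a) || (b < x)]%N.

Lemma dual_compl_head L a b c d : (a < b)%N -> (c < d)%N -> c \in L -> d \in L ->
  (a, b) <> (c, d) -> exists q r, dual_compl (a, b) (c, d) = q :: r /\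
  ((q.1 \in inner L a b) && (q.2 \in inner L a b) ||
   (q.1 \in outer L a b) && (q.2 \in outer L a b)).
Proof.
move=> ab cd cL dL ne; rewrite /dual_compl /tri_compl.
have inI x : x \in inner L a b = (x == a) || ((a < x < b)%N && (x \in L)).
  by rewrite inE mem_filter.
have inO x : x \in outer L a b = (x == b) || (((x < a) || (b < x))%N && (x \in L)).
  by rewrite inE mem_filter.
repeat (case: ifPn => //= ?); try by case: ne; f_equal; lia.
all: eexists; eexists; split; first by [].
all: rewrite /= !inI !inO ?cL ?dL ?andbT; lia.
Qed.

Lemma clique_closed L : compl_closed (mem (clique L)).
Proof.
move=> s t; rewrite /= !inE => /andP[s1 s2] /andP[t1 t2].
have /and3P[_ _ hs] := gv_valid s; have /and3P[_ _ ht] := gv_valid t.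
have := dual_compl_valid hs ht (P := fun x => x \in L) s1 s2 t1 t2.
rewrite -[dual_compl _ _](@map_compl Dual) all_map.
by apply: sub_all => u /= /and3P[_ u1 u2]; rewrite inE u1.
Qed.

(** Take [w = r] in [mobius_step]: after the chord [r], the complement in any other chord begins
    with a chord on one side of the cut. Chords on opposite sides do not cross, so [mobius_product]
    applies to the two cliques. *)
Lemma dual_split L r Y : r \notin Y -> Y \subset clique L ->
  0 < mobius p (clique (inner L (gv r).1 (gv r).2)) ->
  0 < mobius p (clique (outer L (gv r).1 (gv r).2)) -> 0 < mobius p Y.
Proof.
move=> rY YL.
have /and3P[_ _ rv] := gv_valid r.
set I := inner _ _ _; set O := outer _ _ _ => h1 h2.
apply: (mobius_step hnu p_gt0 (w := genM r) (Y' := (clique I :|: clique O)%SET)).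
  move=> u uY; have /and3P[_ _ uv] := gv_valid u.
  have := fintype.subsetP YL _ uY; rewrite inE => /andP[u1 u2].
  have ne : gv r <> gv u by move=> /gv_inj e; rewrite e uY in rY.
  have [q [v []]] : exists q v, dual_compl (gv r) (gv u) = q :: v /\
      ((q.1 \in I) && (q.2 \in I) || (q.1 \in O) && (q.2 \in O)).
    move: ne rv uv u1 u2; rewrite /I /O; case: (gv r) (gv u) => a b [c d] /= ne.
    by move=> *; exact: dual_compl_head.
  rewrite -[dual_compl _ _](@map_compl Dual); case E: (compl r u) => [|u' w] //= [<- _] hq.
  exists u'; first by rewrite !inE.
  move=> z; rewrite gen_le_mul E; apply: leM_trans.
  by rewrite cls_cons; exact: leM_mulr.
rewrite (mobius_product hnu); first by rewrite mulr_gt0.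
  exact: clique_closed.
move=> s t; rewrite !inE /= !mem_filter.
have /and3P[_ _ hs] := gv_valid s; have /and3P[_ _ ht] := gv_valid t.
move=> h3 h4; apply: compl_of; rewrite /raw_compl dual_compl_noncrossing //.
move: rv hs ht h3 h4; rewrite /noncrossing.
case: (gv r) (gv s) (gv t) => a b [c d] [e g] /= ab cd eg.
by move=> /andP[/orP[/eqP ->|/andP[c1 _]] /orP[/eqP ->|/andP[d1 _]]];
  move=> /andP[/orP[/eqP ->|/andP[e1 _]] /orP[/eqP ->|/andP[g1 _]]]; lia.
Qed.

Lemma size_le1 L : uniq L -> (forall x y, x \in L -> y \in L -> x = y) -> (size L <= 1)%N.
Proof.
case: L => [|x [|y L]] //= /andP[hx _] h; move: hx.
by rewrite (h x y) ?inE ?eqxx ?orbT.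
Qed.

(** As [inner] and [outer] add one endpoint each, the size bounds make both strictly smaller than
    [L] once [L] has more than two points; the last clause keeps the chord outside [clique L]. *)
Definition chord_gap L (r : nat * nat) :=
  [/\ uniq L, (size [seq x <- L | r.1 < x < r.2]%N <= (size L).-2)%N,
    (size [seq x <- L | (x < r.1) || (r.2 < x)]%N <= (size L).-2)%N &
    (r.1 \in L) != (r.2 \in L)].

(* A chord from a hole [v] to a point of [L] which isolates exactly one other
   point of [L]. *)
Lemma chord_ex L v : uniq L -> (2 < size L)%N -> v \notin L ->
  exists r, [/\ (r.1 < r.2)%N, (r.1 \in v :: L) && (r.2 \in v :: L) & chord_gap L r].
Proof.
move=> uL sL vL.
have count3 (P1 P2 : pred nat) : (forall x, P1 x -> ~~ P2 x) ->
    (count P1 L + count P2 L <= size L)%N.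
  move=> h; rewrite -(count_predUI P1 P2) addnC (eq_count (a2 := pred0)) ?count_pred0.
    exact: count_size.
  by move=> x /=; apply/negP => /andP[/h /negP].
have cut (a b x : nat) (w : nat) : (a < b)%N -> x \in L -> (a < x < b)%N -> w \in L ->
    ((a == w) || (b == w)) -> 
    (size [seq x <- L | (x < a) || (b < x)]%N <= (size L).-2)%N.
  move=> ab xL axb wL abw; rewrite size_filter.
  have := count3 (fun y => (y < a) || (b < y))%N (predU1 x (pred1 w)).
  have -> : count (predU1 x (pred1 w)) L = 2.
    have := count_predUI (pred1 x) (pred1 w) L; rewrite !count_uniq_mem // xL wL /=.
    rewrite (eq_count (a1 := predI _ _) (a2 := pred0)) ?count_pred0 ?addn0 //.
    by move=> y /=; apply/negP => /andP[/eqP -> /eqP e]; move: abw axb; rewrite -e; lia.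
  move=> h; have : (count (fun y => (y < a) || (b < y)) L + 2 <= size L)%N.
    apply: h => y /= hy; apply/negP => /orP[/eqP e|/eqP e]; move: hy; rewrite e; lia.
  by lia.
(* The least such [x] is the second point of [L] above [v]; [B] is the mirror case below [v]. If
   neither exists, at most one point lies on each side of [v], so [L] has at most two. *)
pose A x := (x \in L) && has (fun y => v < y < x)%N L.
have [[x0 Ax0]|nA] := pselect (exists x, A x).
  have exA : exists x, A x by exists x0.
  have [x /andP[xL /hasP[y yL vyx]] xmin] := ex_minnP exA.
  have vx : (v < x)%N by lia.
  exists (v, x); split => //=; first by rewrite !inE eqxx xL orbT.
  split=> //=.
  - apply: (@leq_trans 1%N); last by lia.
    apply: size_le1; first exact: filter_uniq.
    move=> z z'; rewrite !mem_filter => /andP[h1 zL] /andP[h2 z'L].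
    have H u u' : u \in L -> u' \in L -> (v < u < x)%N -> (v < u' < x)%N -> ~ (u < u')%N.
      move=> uL' u'L h3 h4 h5; have : (x <= u')%N; last by clear -h4; lia.
      apply: xmin; rewrite /A u'L; apply/hasP; exists u => //; clear -h3 h5; lia.
    have := H _ _ zL z'L h1 h2; have := H _ _ z'L zL h2 h1; clear; lia.
  - by apply: (cut v x y x) => //; rewrite eqxx orbT.
  - by rewrite xL (negbTE vL).
pose B x := (x \in L) && has (fun y => x < y < v)%N L.
have [[x0 Bx0]|nB] := pselect (exists x, B x).
  have exB : exists x, B x by exists x0.
  have Bv x : B x -> (x <= v)%N by move=> /andP[_ /hasP[y _]]; lia.
  have [x /andP[xL /hasP[y yL xyv]] xmax] := ex_maxnP exB Bv.
  have vx : (x < v)%N by lia.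
  exists (x, v); split => //=; first by rewrite !inE eqxx xL orbT.
  split=> //=.
  - apply: (@leq_trans 1%N); last by lia.
    apply: size_le1; first exact: filter_uniq.
    move=> z z'; rewrite !mem_filter => /andP[h1 zL] /andP[h2 z'L].
    have H u u' : u \in L -> u' \in L -> (x < u < v)%N -> (x < u' < v)%N -> ~ (u < u')%N.
      move=> uL' u'L h3 h4 h5; have : (u <= x)%N; last by clear -h3; lia.
      apply: xmax; rewrite /B uL'; apply/hasP; exists u' => //; clear -h4 h5; lia.
    have := H _ _ zL z'L h1 h2; have := H _ _ z'L zL h2 h1; clear; lia.
  - by apply: (cut x v y x) => //; rewrite eqxx.
  - by rewrite xL (negbTE vL).
exfalso.
have s1 : (size [seq x <- L | v < x]%N <= 1)%N.
  apply: size_le1; first exact: filter_uniq.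
  move=> z z'; rewrite !mem_filter => /andP[h1 zL] /andP[h2 z'L].
  case: (ssrnat.ltngtP z z') => // h; case: nA.
  - by exists z'; rewrite /A z'L; apply/hasP; exists z; rewrite ?h1.
  - by exists z; rewrite /A zL; apply/hasP; exists z'; rewrite ?h2.
have s2 : (size [seq x <- L | ~~ (v < x)]%N <= 1)%N.
  apply: size_le1; first exact: filter_uniq.
  move=> z z'; rewrite !mem_filter -!leqNgt => /andP[h1 zL] /andP[h2 z'L].
  have zv u : u \in L -> u != v by move=> uL'; apply: contraNneq vL => <-.
  case: (ssrnat.ltngtP z z') => // h; case: nB.
  - exists z; rewrite /B zL; apply/hasP; exists z' => //.
    by rewrite h /= ltn_neqAle zv.
  - exists z'; rewrite /B z'L; apply/hasP; exists z => //.
    by rewrite h /= ltn_neqAle zv.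
have : (count (fun x => v < x) L + count (fun x => ~~ (v < x)) L = size L)%N.
  exact: count_predC.
by move: s1 s2; rewrite !size_filter; lia.
Qed.

Lemma clique_mobius_gt0 L v : uniq L -> (forall x, x \in v :: L -> 0 < x <= n)%N ->
  v \notin L -> 0 < mobius p (clique L).
Proof.
move En : (size L) => N; elim/ltn_ind: N L v En => N IH L v En uL hL vL.
have [s2|s2] := leqP (size L) 2.
  have [->|/set0Pn [s sK]] := eqVneq (clique L) finset.set0; first by rewrite mobius0.
  apply: (@lt_le_trans _ _ (mobius p [set s]%SET)).
    by rewrite (mobius1 p) subr_gt0.
  apply: (uniform_mobius_le hnu); apply/fintype.subsetP => t tK; rewrite inE.
  apply/eqP/gv_inj; move: sK tK; rewrite !inE.
  have /and3P[_ _] := gv_valid s; have /and3P[_ _] := gv_valid t.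
  case: (gv s) (gv t) => a b [c d] /= cd ab.
  case: L s2 {En uL hL vL} => [|x [|y [|]]] // _; rewrite !inE.
  - by move=> /andP[/eqP -> /eqP e]; move: ab; rewrite e; lia.
  - by move=> /andP[/orP[]/eqP e1 /orP[]/eqP e2] /andP[/orP[]/eqP e3 /orP[]/eqP e4];
      f_equal; lia.
have [[a b] [/= ab abL [_ /= c1 c2 c3]]] := chord_ex uL s2 vL.
have hab : (0 < a <= n)%N && (0 < b <= n)%N.
  by case/andP: abL => /hL -> /hL ->.
have [r er] : exists r : gen Dual n, gv r = (a, b).
  by apply: gv_onto; rewrite /raw_valid /=; lia.
apply: (@dual_split L r _); rewrite ?er //=.
- by rewrite inE er /=; move: c3; case: (a \in L); case: (b \in L).
(* The arc [inner] omits [b] and [outer] omits [a]: these endpoints are the next holes. *)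
- apply: (IH _ _ _ b erefl).
  + by rewrite -En /inner /=; lia.
  + by rewrite /= filter_uniq // andbT mem_filter ltnn.
  + move=> x; rewrite !inE mem_filter => /or3P[/eqP ->|/eqP ->|/andP[_ xL]]; try by lia.
    by apply: hL; rewrite inE xL orbT.
  + by rewrite inE mem_filter ltnn andbF orbF; lia.
- apply: (IH _ _ _ a erefl).
  + by rewrite -En /outer /=; lia.
  + by rewrite /= filter_uniq // andbT mem_filter ltnn orbF; apply/negP => /andP[]; lia.
  + move=> x; rewrite !inE mem_filter => /or3P[/eqP ->|/eqP ->|/andP[_ xL]]; try by lia.
    by apply: hL; rewrite inE xL orbT.
  + by rewrite inE mem_filter ltnn; apply/negP => /orP[|/andP[]]; lia.
Qed.

Lemma dual_mobius_gt0 Y : Y != finset.setT -> 0 < mobius p Y.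
Proof.
move=> hY; have [r rY] : exists r, r \notin Y.
  apply/existsP; rewrite -negb_forall; apply: contra hY => /forallP h.
  by apply/eqP/setP => s; rewrite h finset.in_setT.
have /and3P[r1 r2 r3] := gv_valid r.
apply: (@dual_split (iota 1 n) r _ rY).
- apply/fintype.subsetP => s _; rewrite inE !mem_iota.
  by have /and3P[] := gv_valid s; move: (gv s) => [a b] /=; lia.
- apply: (@clique_mobius_gt0 _ (gv r).2).
  + by rewrite /= filter_uniq ?iota_uniq // andbT mem_filter ltnn.
  + by move=> x; rewrite !inE mem_filter mem_iota => /or3P[/eqP ->|/eqP ->|]; lia.
  + by rewrite inE mem_filter ltnn andbF orbF; lia.
- apply: (@clique_mobius_gt0 _ (gv r).1).
  + by rewrite /= filter_uniq ?iota_uniq // andbT mem_filter ltnn orbF; apply/negP => /andP[]; lia.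
  + by move=> x; rewrite !inE mem_filter mem_iota => /or3P[/eqP ->|/eqP ->|]; lia.
  + by rewrite inE mem_filter ltnn; apply/negP => /orP[|/andP[]]; lia.
Qed.

End DualPositivity.

Lemma mobius_gt0 k n (R : realType) (nu : probability (MbarT k n) R) (p : R)
    (Y : {set gen k n}) :
  uniform nu p -> 0 < p -> p < 1 -> Y != finset.setT -> 0 < mobius p Y.
Proof.
case: k nu Y => nu Y hnu p0 p1.
- exact: (artin_mobius_gt0 hnu).
- exact: (dual_mobius_gt0 hnu).
Qed.

(** * Moebius inversion on simple elements *)

Section FiniteInversion.
Context {k : kind} {n : nat} {R : realType}.
Implicit Types (x y z : M k n) (X Y : {set gen k n}) (p : R).
Local Notation "x ** y" := (mulM x y) (at level 40, left associativity).

Lemma simples_ex : exists l : seq (M k n), uniq l /\ forall x, x \in l <-> simple x.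
Proof.
have H N : exists l : seq (M k n), forall x, (len x <= N)%N -> x \in l.
  elim: N => [|N [l hl]].
    by exists [:: unitM k n] => x; rewrite leqn0 inE => /eqP/len_eq0 ->.
  exists (unitM k n :: [seq genM s ** y | s <- enum [set: gen k n]%SET, y <- l]) => x.
  have [->|[s [y ->]]] := M_head x; first by rewrite inE eqxx.
  rewrite len_mul len_gen add1n ltnS => /hl hy; rewrite inE; apply/orP; right.
  by apply/allpairsP; exists (s, y); rewrite mem_enum finset.in_setT.
have [l hl] := H (len (Delta k n)).
exists (undup [seq x <- l | `[< simple x >]]); split; first exact: undup_uniq.
move=> x; rewrite mem_undup mem_filter; split=> [/andP[/asboolP] //|hx].
by rewrite hl ?andbT; [apply/asboolP|exact: leM_len].
Qed.

Definition simples : seq (M k n) := projT1 (cid simples_ex).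

Lemma simples_uniq : uniq simples.
Proof. by rewrite /simples; case: cid => l []. Qed.

Lemma simplesP x : x \in simples <-> simple x.
Proof. by rewrite /simples; case: cid => l [] /= _ h; exact: h. Qed.

(** The mass a uniform measure gives to the streams whose first letter is [y]. *)
Definition weight p y := p ^+ len y * mobius p (ext y).

Lemma ext_DeltaX y X : simple y -> X \subset ext y -> simple (y ** DeltaX X).
Proof.
move=> [z ez] hX; rewrite /simple ez leM_mul2l; apply: DeltaX_le => s sX.
have /in_ext := fintype.subsetP hX _ sX.
by rewrite /simple ez leM_mul2l.
Qed.

Lemma sum_alternating_ge z y : simple y ->
  \sum_(X : {set gen k n} | (X \subset ext z) && (X != finset.set0))
    (-1) ^+ #|X| * (`[< le_l (z ** DeltaX X) y >])%:R =
  - (`[< le_l z y >] && (y != z))%:R :> R.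
Proof.
move=> hy; have [zy|zy] := asboolP (le_l z y); last first.
  rewrite /= oppr0 big1 // => X _; case: asboolP; rewrite ?mulr0 // => h.
  by case: zy; exact: leM_trans (leM_mulr _ _) h.
pose Z := [set s : gen k n | `[< le_l (z ** genM s) y >]]%SET.
have -> : (y != z) = (Z != finset.set0).
  apply/idP/set0Pn => [yz|[s]]; last first.
    rewrite inE => /asboolP /leM_len; apply: contraTneq => ->.
    by rewrite len_mul len_gen addn1 ltnn.
  case: zy => c ey; have [c1|[s [d ed]]] := M_head c.
    by rewrite ey c1 mulM1 eqxx in yz.
  by exists s; rewrite inE; apply/asboolP; rewrite ey ed mulMA; exact: leM_mulr.
have hZ X : X \subset Z <-> le_l (z ** DeltaX X) y.
  case: zy => c ey; rewrite ey leM_mul2l; split=> [h|h].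
    apply: DeltaX_le => s /(fintype.subsetP h); rewrite inE => /asboolP.
    by rewrite ey leM_mul2l.
  apply/fintype.subsetP => s sX; rewrite inE; apply/asboolP; rewrite ey leM_mul2l.
  exact: leM_trans (DeltaX_ge sX) h.
have Zext : Z \subset ext z.
  apply/fintype.subsetP => s; rewrite inE => /asboolP h; apply/in_ext.
  exact: le_simple h hy.
transitivity (\sum_(X : {set gen k n} | (X \subset Z) && (X != finset.set0)) (-1) ^+ #|X| : R).
  rewrite big_mkcond [RHS]big_mkcond; apply: eq_bigr => X _.
  have [XZ|XZ] := boolP (X \subset Z).
    rewrite (fintype.subset_trans XZ Zext); case: ifP => // _.
    by rewrite asboolT ?mulr1 //; apply/hZ.
  case: ifP => // _; rewrite asboolF ?mulr0 // => /hZ h.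
  by rewrite h in XZ.
have := @sum_alternating R _ Z; rewrite (bigD1 finset.set0) ?finset.sub0set //= cards0 expr0.
rewrite -/(Z != finset.set0); case: (Z == _) => /= h.
  by apply/(addrI 1); rewrite h subr0.
by apply/(addrI 1); rewrite h subrr.
Qed.

(** Moebius inversion on the simple elements, by induction on the colength of [z]: the terms of
    [weight p z] with [X] nonempty cancel the weights of the proper multiples of [z]. It is an
    identity in [p], valid before any measure is available. *)
Lemma sum_weight_ge p z : simple z ->
  \sum_(y <- simples | `[< le_l z y >]) weight p y = p ^+ len z.
Proof.
move En : (len (Delta k n) - len z)%N => N.
elim/ltn_ind: N z En => N IH z En hz.
have zs : z \in simples by apply/simplesP.
rewrite big_mkcond (bigD1_seq z) ?simples_uniq //= asboolT; last exact: leMM.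
have -> : weight p z = p ^+ len z + \sum_(X : {set gen k n} | (X \subset ext z) && (X != finset.set0))
    (-1) ^+ #|X| * p ^+ len (z ** DeltaX X).
  rewrite /weight /mobius mulr_sumr (bigD1 finset.set0) ?finset.sub0set //=.
  rewrite cards0 DeltaX0 len1 expr0 !mulr1; congr (_ + _).
  by apply: eq_bigr => X _; rewrite len_mul exprD mulrCA.
rewrite -addrA -[RHS]addr0; congr (_ + _).
have -> : \sum_(X : {set gen k n} | (X \subset ext z) && (X != finset.set0))
    (-1) ^+ #|X| * p ^+ len (z ** DeltaX X) =
  \sum_(X : {set gen k n} | (X \subset ext z) && (X != finset.set0))
    \sum_(y <- simples) weight p y * ((-1) ^+ #|X| * (`[< le_l (z ** DeltaX X) y >])%:R).
  apply: eq_bigr => X /andP[hX X0].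
  have sX := ext_DeltaX hz hX.
  have lX : (0 < len (DeltaX X))%N.
    have [s sX'] := set0Pn _ X0.
    by have /leM_len := DeltaX_ge sX'; rewrite len_gen.
  rewrite -(IH _ _ _ erefl sX); last first.
    by rewrite -En len_mul; have := leM_len hz; have := leM_len sX; rewrite len_mul; lia.
  rewrite mulr_sumr big_mkcond; apply: eq_bigr => y _.
  by case: asboolP => _; rewrite ?mulr1 ?mulr0 // mulrC.
rewrite exchange_big /= (eq_big_seq (fun y => - (weight p y * (`[< le_l z y >] && (y != z))%:R))).
  rewrite sumrN [X in _ + X]big_mkcond.
  rewrite [X in - X + _ = _](_ : _ = \sum_(y <- simples) (if y != z then (if `[< le_l z y >] then weight p y else 0) else 0)).
    by rewrite addNr.
  by apply: eq_bigr => y _; case: asboolP; case: (y != z); rewrite ?mulr1 ?mulr0.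
move=> y /simplesP hy; rewrite -mulr_sumr sum_alternating_ge // mulrN.
by [].
Qed.

(** At [Y = ext x] the sum runs over the letters that may follow [x]: this is the consistency
    equation between a cylinder and its successors, used in [sum_branch]. *)
Lemma sum_weight_avoid p Y :
  \sum_(y <- simples | [forall s in Y, ~~ `[< le_l (genM s) y >]]) weight p y = mobius p Y.
Proof.
rewrite /mobius.
have -> : \sum_(X : {set gen k n} | X \subset Y) (-1) ^+ #|X| * p ^+ len (DeltaX X) =
   \sum_(X : {set gen k n} | X \subset Y) \sum_(y <- simples)
     weight p y * ((-1) ^+ #|X| * (`[< le_l (DeltaX X) y >])%:R).
  apply: eq_bigr => X hX; rewrite -(@sum_weight_ge p (DeltaX X)).
    rewrite mulr_sumr big_mkcond; apply: eq_bigr => y _.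
    by case: asboolP => _; rewrite ?mulr1 ?mulr0 // mulrC.
  by apply: DeltaX_le => s _; exact: gen_simple.
rewrite exchange_big /= big_mkcond; apply: eq_bigr => y _.
pose Z := [set s in Y | `[< le_l (genM s) y >]]%SET.
rewrite -mulr_sumr.
have -> : \sum_(X : {set gen k n} | X \subset Y) (-1) ^+ #|X| * (`[< le_l (DeltaX X) y >])%:R
    = (Z == finset.set0)%:R :> R.
  rewrite -sum_alternating big_mkcond [RHS]big_mkcond; apply: eq_bigr => X _.
  have hZ : X \subset Z <-> X \subset Y /\ le_l (DeltaX X) y.
    split=> [h|[h1 h2]].
      split; first by apply/fintype.subsetP => s /(fintype.subsetP h); rewrite inE => /andP[].
      by apply: DeltaX_le => s /(fintype.subsetP h); rewrite inE => /andP[_ /asboolP].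
    apply/fintype.subsetP => s sX; rewrite inE (fintype.subsetP h1) //=; apply/asboolP.
    exact: leM_trans (DeltaX_ge sX) h2.
  have [XZ|XZ] := boolP (X \subset Z).
    by have [-> h] := hZ.1 XZ; rewrite asboolT // mulr1.
  case: ifP => // XY; rewrite asboolF ?mulr0 // => h.
  by move/negP: XZ; apply; apply/hZ.
have -> : (Z == finset.set0) = [forall s in Y, ~~ `[< le_l (genM s) y >]].
  apply/eqP/forall_inP => [e s sY|h].
    by apply/negP => h; have := finset.in_set0 s; rewrite -e inE sY h.
  by apply/setP => s; rewrite !inE; apply/negP => /andP[/h /negP].
by case: [forall s in Y, _]; rewrite ?mulr1 ?mulr0.
Qed.

Lemma arrowP x y : arrow x y <-> [forall s in ext x, ~~ `[< le_l (genM s) y >]].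
Proof.
split=> [h|/forall_inP h s sy hs].
  apply/forall_inP => s /in_ext hs; apply/negP => /asboolP sy.
  exact: (h s).
by have := h s (proj2 (in_ext _ _) hs); rewrite asboolT.
Qed.

Lemma ext_Delta : ext (Delta k n) = finset.set0.
Proof.
apply/setP => s; rewrite [RHS]inE; apply/negP => /in_ext /leM_len.
by rewrite len_mul len_gen addn1 ltnn.
Qed.

Lemma ext_setT x : simple x -> ext x = finset.setT -> x = unitM k n.
Proof.
move=> [z ez] e; suff : le_l (Delta k n) z.
  by move=> /leM_len; rewrite {1}ez len_mul -{2}[len z]add0n leq_add2r leqn0 => /eqP/len_eq0.
apply: DeltaX_le => s _.
have /in_ext : s \in ext x by rewrite e finset.in_setT.
by rewrite /simple ez leM_mul2l.
Qed.

Lemma prod_simple_rcons m x y : prod_simple m x -> simple y -> prod_simple m.+1 (x ** y).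
Proof.
elim: m x => [|m IH] x.
  move=> -> hy; exists y, (unitM k n); split=> //; by rewrite mul1M mulM1.
move=> [r [z [hr hz ->]]] hy; exists r, (z ** y); split=> //; first exact: IH.
by rewrite mulMA.
Qed.

Lemma prod_simple_bound m x : prod_simple m x -> (len x <= m * len (Delta k n))%N.
Proof.
elim: m x => [|m IH] x; first by move=> ->; rewrite len1.
move=> [r [z [/leM_len hr /IH hz ->]]].
by rewrite len_mul mulSn leq_add.
Qed.

Lemma prod_simple_embed m x : prod_simple m x -> prodN (embed x) m = x.
Proof.
move=> h; apply: leM_anti; first exact: le_prodN_embed.
by apply: (prod_simple_le (N := len x) h); rewrite prodN_embed //; exact: leMM.
Qed.


End FiniteInversion.

(** * Existence of uniform measures *)

(* Downward induction on length among products of [m] simple elements: the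
   inclusion-exclusion formula for the cylinder of [y] determines the measure
   of [Uparrow y] from those of its proper multiples. *)
Lemma uniform_of_cyl k n (R : realType) (nu : probability (MbarT k n) R) (p : R) :
  (forall (zeta : Mbar k n) N, nu (cyl N.+1 (prodN zeta N.+1)) =
     (p ^+ len (prodN zeta N.+1) * mobius p (ext (term zeta N)))%:E) ->
  uniform nu p.
Proof.
move=> hc x.
suff H m y : prod_simple m.+1 y -> fine (nu (Uparrow y)) = p ^+ len y.
  rewrite -(nu_fineK nu (measurable_Uparrow x)) (H (len x)) //.
  rewrite -[x in prod_simple _ x]mulM1; apply: prod_simple_rcons; first exact: prod_simple_len.
  exact: simple_unit.
move En : (m.+1 * len (Delta k n) - len y)%N => N.
elim/ltn_ind: N y En => N IH y En hy.
have := hc (embed y) m; rewrite cyl_avoid (prod_simple_embed hy).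
set E := ext _ => /(congr1 fine) /=.
have := incl_excl y E (additive_nuT nu); rewrite /= => -> h.
have rest : \sum_(X : {set gen k n} | (X \subset E) && (X != finset.set0))
      (-1) ^+ #|X| * fine (nu (Uparrow (mulM y (DeltaX X)))) =
    \sum_(X : {set gen k n} | (X \subset E) && (X != finset.set0))
      (-1) ^+ #|X| * p ^+ len (mulM y (DeltaX X)).
  apply: eq_bigr => X /andP[XE X0]; congr (_ * _).
  have hX : prod_simple m.+1 (mulM y (DeltaX X)).
    rewrite -(prod_simple_embed hy) prodNSr -mulMA; apply: prod_simple_rcons.
      exact: prod_simple_prodN.
    by apply: ext_DeltaX XE; exact: term_simple.
  have lX : (0 < len (DeltaX X))%N.
    have [s sX] := set0Pn _ X0.
    by have /leM_len := DeltaX_ge sX; rewrite len_gen.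
  apply: (IH _ _ _ erefl hX); rewrite -En.
  have := prod_simple_bound hX; have := prod_simple_bound hy; rewrite len_mul; lia.
move: h; rewrite (bigD1 finset.set0) ?finset.sub0set //= cards0 DeltaX0 mulM1 expr0 mul1r rest.
rewrite /mobius mulr_sumr [in RHS](bigD1 finset.set0) ?finset.sub0set //=.
rewrite cards0 DeltaX0 len1 expr0 !mulr1.
rewrite [X in _ + X = _](eq_bigr (fun X : {set gen k n} => p ^+ len y * ((-1) ^+ #|X| * p ^+ len (DeltaX X)))).
  exact: addIr.
by move=> X _; rewrite len_mul exprD mulrCA.
Qed.

Section CumulativeSums.
Context {T : eqType} {R : realDomainType}.
Implicit Types (l : seq T) (w : T -> R).

Definition cum w l y := \sum_(z <- take (index y l) l) w z.

Lemma cum_head w t l : cum w (t :: l) t = 0.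
Proof. by rewrite /cum /= eqxx big_nil. Qed.

Lemma cum_behead w t l y : y != t -> cum w (t :: l) y = w t + cum w l y.
Proof. by move=> h; rewrite /cum /= eq_sym (negbTE h) big_cons. Qed.

Lemma cum_ex w l (v : R) : uniq l -> 0 <= v < \sum_(z <- l) w z ->
  exists2 y, y \in l & cum w l y <= v < cum w l y + w y.
Proof.
elim: l v => [|t l IH] v /=; first by rewrite big_nil => _ /andP[h /(le_lt_trans h)]; rewrite ltxx.
move=> /andP[tl ul] /andP[v0]; rewrite big_cons => hv.
have [h|h] := ltP v (w t).
  by exists t; rewrite ?inE ?eqxx // cum_head add0r v0.
have [|y yl hy] := IH (v - w t) ul; first by rewrite subr_ge0 h ltrBlDl.
exists y; first by rewrite inE yl orbT.
have yt : y != t by apply: contraNneq tl => <-.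
by rewrite cum_behead // -lerBrDl -addrA -ltrBlDl.
Qed.

Lemma cum_ge0 w l y : (forall z, z \in l -> 0 <= w z) -> 0 <= cum w l y.
Proof.
by move=> h; rewrite /cum big_seq; apply: sumr_ge0 => z /mem_take; exact: h.
Qed.

Lemma cum_le w l y : (forall z, z \in l -> 0 <= w z) -> y \in l ->
  cum w l y + w y <= \sum_(z <- l) w z.
Proof.
elim: l => [|t l IH] //= h; rewrite inE big_cons => /predU1P[->|yl].
  rewrite cum_head add0r lerDl big_seq; apply: sumr_ge0 => z zl.
  by apply: h; rewrite inE zl orbT.
have h' z : z \in l -> 0 <= w z by move=> zl; apply: h; rewrite inE zl orbT.
have [->|yt] := eqVneq y t; last by rewrite cum_behead // -addrA lerD2l IH.
by rewrite cum_head add0r lerDl big_seq; apply: sumr_ge0 => z zl; exact: h'.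
Qed.

Lemma cum_inj w l (v : R) y y' : (forall z, z \in l -> 0 <= w z) ->
  y \in l -> y' \in l -> cum w l y <= v < cum w l y + w y ->
  cum w l y' <= v < cum w l y' + w y' -> y = y'.
Proof.
elim: l v => [|t l IH] v //= h; rewrite !inE.
have h' z : z \in l -> 0 <= w z by move=> zl; apply: h; rewrite inE zl orbT.
have ge0 x : 0 <= cum w l x by exact: cum_ge0.
have [->|yt] := eqVneq y t; have [->|y't] := eqVneq y' t => //=.
- rewrite cum_head add0r cum_behead // => _ _ /andP[_ h1] /andP[h2 _].
  by exfalso; have := ge0 y'; lra.
- rewrite cum_head add0r cum_behead // => _ _ /andP[h2 _] /andP[_ h1].
  by exfalso; have := ge0 y; lra.
rewrite !cum_behead // => yl y'l h1 h2; apply: (IH (v - w t)) => //; lra.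
Qed.

End CumulativeSums.

(* A point of [0, 1[ is sent to the stream whose successive cylinders
   correspond to the nested intervals [lo, lo + mass[ containing it, where the
   interval of a cylinder is split among its successors in proportion to their
   weights. *)
Section Tree.
Context {k : kind} {n : nat} {R : realType}.
Implicit Types (x y z : M k n) (u : R) (zeta : Mbar k n).
Variable p : R.
Hypotheses (p_ge0 : 0 <= p) (hmob : forall x, simple x -> 0 <= mobius p (ext x)).

(** [st_coef] is [p] to the length of the product read so far ([stream_coef]), so [mass] is the
    prescribed mass of the current cylinder. *)
Record state := State { st_lo : R; st_coef : R; st_last : M k n }.

Definition mass st := st_coef st * mobius p (ext (st_last st)).

Definition branch st y :=
  st_coef st * (if `[< arrow (st_last st) y >] then weight p y else 0).

Definition next st y :=
  State (st_lo st + cum (branch st) simples y) (st_coef st * p ^+ len y) y.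

Definition good st := 0 <= st_coef st /\ simple (st_last st).

Lemma branch_ge0 st y : good st -> y \in simples -> 0 <= branch st y.
Proof.
move=> [h0 hs] /simplesP hy; rewrite mulr_ge0 //; case: asboolP => // _.
by rewrite mulr_ge0 ?exprn_ge0 ?hmob.
Qed.

Lemma sum_branch st : \sum_(y <- simples) branch st y = mass st.
Proof.
rewrite /branch -mulr_sumr; congr (_ * _).
rewrite -sum_weight_avoid [RHS]big_mkcond; apply: eq_bigr => y _.
case: asboolP => [/arrowP -> //|h]; case: ifP => // /arrowP h'.
by case: h.
Qed.

Lemma mass_next st y : arrow (st_last st) y -> mass (next st y) = branch st y.
Proof. by move=> h; rewrite /mass /branch asboolT //= mulrA. Qed.

Lemma good_next st y : good st -> simple y -> good (next st y).
Proof. by move=> [h1 h2] hy; split=> //=; rewrite mulr_ge0 ?exprn_ge0. Qed.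

Definition in_state u st := st_lo st <= u < st_lo st + mass st.

Definition picks u st y := y \in simples /\
  st_lo st + cum (branch st) simples y <= u <
  st_lo st + cum (branch st) simples y + branch st y.

Lemma picks_ex u st : in_state u st -> exists y, picks u st y.
Proof.
move=> /andP[h1 h2].
have [|y ys hy] := @cum_ex _ _ (branch st) _ (u - st_lo st) simples_uniq.
  by rewrite subr_ge0 h1 sum_branch ltrBlDl.
by exists y; split => //; lra.
Qed.

Lemma picks_arrow u st y : picks u st y -> arrow (st_last st) y.
Proof.
move=> [_]; rewrite /branch; case: asboolP => // _ h.
by exfalso; move: h; rewrite mulr0; lra.
Qed.

Lemma picks_next u st y : picks u st y <->
  [/\ y \in simples, arrow (st_last st) y & in_state u (next st y)].
Proof.
split=> [h|[h1 h2 h3]]; last first.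
  by split=> //; move: h3; rewrite /in_state mass_next.
have ha := picks_arrow h; case: h => h1 h2; split=> //.
by rewrite /in_state mass_next.
Qed.

Lemma picks_uniq u st y y' : good st -> picks u st y -> picks u st y' -> y = y'.
Proof.
move=> hg [h1 h2] [h3 h4].
apply: (@cum_inj _ _ (branch st) simples (u - st_lo st)) => //; try lra.
by move=> z hz; exact: branch_ge0.
Qed.

Lemma in_state_picks u st y : good st -> picks u st y -> in_state u st.
Proof.
move=> hg [ys /andP[h1 h2]].
have h z : z \in simples -> 0 <= branch st z by exact: branch_ge0.
have := cum_ge0 y h; have := cum_le h ys; rewrite sum_branch /in_state; lra.
Qed.

Definition pick u st := xget (Delta k n) (picks u st).

Lemma pickP u st : in_state u st -> picks u st (pick u st).
Proof. by move=> h; apply: (xgetPex (Delta k n)); exact: picks_ex. Qed.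

(** [Delta] acts as a virtual letter before the first one: [ext] of it is empty, so the initial mass
    is 1 and every simple element may follow. *)
Definition st0 := State 0 1 (Delta k n).

Definition path_state u i := iter i (fun st => next st (pick u st)) st0.

Definition unit_itv : set R := `[0, 1[%classic.

Lemma good0 : good st0. Proof. by split=> //=; exact: leMM. Qed.

Lemma in_state0 u : in_state u st0 = (0 <= u < 1).
Proof. by rewrite /in_state /mass /= ext_Delta mobius0 mulr1 add0r. Qed.

Lemma path_stateP u i : unit_itv u ->
  good (path_state u i) /\ in_state u (path_state u i).
Proof.
move=> hu; elim: i => [|i [IH1 IH2]].
  by split; [exact: good0|rewrite in_state0; move: hu; rewrite /unit_itv /= in_itv].
have hp := pickP IH2; have [h1 h2 h3] := (picks_next _ _ _).1 hp.
by rewrite /path_state iterS; split=> //; apply: good_next => //; apply/simplesP.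
Qed.

Definition path_term u i := if `[< unit_itv u >] then pick u (path_state u i) else unitM k n.

Lemma path_term_simple u i : simple (path_term u i).
Proof.
rewrite /path_term; case: asboolP => [hu|_]; last exact: simple_unit.
have [_ hin] := path_stateP i hu.
by have [/simplesP] := pickP hin.
Qed.

Lemma path_term_arrow u i : arrow (path_term u i) (path_term u i.+1).
Proof.
rewrite /path_term; case: asboolP => [hu|_]; last exact: arrow_unit.
have [_ hin] := path_stateP i.+1 hu.
exact: (picks_arrow (pickP hin)).
Qed.

Definition path u : MbarT k n := mk_Mbar (path_term_simple u) (@path_term_arrow u).

Definition stream_state zeta i := foldl (fun st j => next st (term zeta j)) st0 (iota 0 i).

Lemma stream_stateS zeta i : stream_state zeta i.+1 = next (stream_state zeta i) (term zeta i).
Proof. by rewrite /stream_state -addn1 iotaD foldl_cat. Qed.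

Lemma good_stream zeta i : good (stream_state zeta i).
Proof.
elim: i => [|i IH]; first exact: good0.
by rewrite stream_stateS; apply: good_next => //; exact: term_simple.
Qed.

Lemma stream_arrow zeta i : arrow (st_last (stream_state zeta i)) (term zeta i).
Proof.
case: i => [|i]; last by rewrite stream_stateS; exact: term_arrow.
by move=> s _ /leM_len; rewrite len_mul len_gen addn1 ltnn.
Qed.

Lemma stream_coef zeta i : st_coef (stream_state zeta i) = p ^+ len (prodN zeta i).
Proof.
elim: i => [|i IH]; first by rewrite /= prodN0 len1.
by rewrite stream_stateS /= IH prodNSr len_mul exprD.
Qed.

Lemma path_cyl u zeta N : unit_itv u ->
  (forall i, (i < N)%N -> term (path u) i = term zeta i) <->
  in_state u (stream_state zeta N).
Proof.
move=> hu.
(* Equality of states is carried along, because the letter picked at step [N] depends on the state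
   reached from [u], not on [zeta]. *)
suff H : ((forall i, (i < N)%N -> term (path u) i = term zeta i) <->
    in_state u (stream_state zeta N)) /\
    (in_state u (stream_state zeta N) -> path_state u N = stream_state zeta N).
  by have [] := H.
have tp i : term (path u) i = pick u (path_state u i).
  by rewrite /path /term /= /path_term; case: asboolP.
elim: N => [|N [IH1 IH2]].
  by split=> //; split=> // _; rewrite in_state0; move: hu; rewrite /unit_itv /= in_itv.
have pk : in_state u (stream_state zeta N.+1) -> picks u (stream_state zeta N) (term zeta N).
  move=> h; apply/picks_next; split; last by rewrite -stream_stateS.
  - by apply/simplesP; exact: term_simple.
  - exact: stream_arrow.
have down : in_state u (stream_state zeta N.+1) ->
    in_state u (stream_state zeta N) /\ pick u (stream_state zeta N) = term zeta N.
  move=> /pk hp; have hin := in_state_picks (good_stream zeta N) hp; split=> //.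
  exact: picks_uniq (good_stream zeta N) (pickP hin) hp.
split; last first.
  move=> /down [h1 h2]; rewrite /path_state iterS -/(path_state u N) IH2 // h2.
  by rewrite stream_stateS.
split=> [h|/[dup] h /down [h1 h2] i].
  have hin : in_state u (stream_state zeta N) by apply/IH1 => i hi; apply: h; exact: leqW.
  have e := h N (leqnn _); rewrite tp IH2 // in e.
  have := pickP hin; rewrite e => /picks_next [_ _].
  by rewrite stream_stateS.
rewrite ltnS leq_eqVlt => /predU1P[->|hi]; last exact: (IH1.2 h1).
by rewrite tp IH2.
Qed.

Lemma path_preimage_cyl zeta N :
  path @^-1` (cyl N (prodN zeta N)) `&` unit_itv =
  `[st_lo (stream_state zeta N), st_lo (stream_state zeta N) + mass (stream_state zeta N)[%classic.
Proof.
have sub i : `[st_lo (stream_state zeta i), st_lo (stream_state zeta i) + mass (stream_state zeta i)[%classic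
    `<=` unit_itv.
  elim: i => [|i IH] u /=.
    by have := in_state0 u; rewrite /in_state in_itv /= => ->; rewrite /unit_itv /= in_itv.
  rewrite in_itv /= => h; apply: IH; rewrite /= in_itv.
  apply: (in_state_picks (good_stream zeta i) (y := term zeta i)); apply/picks_next; split.
  - by apply/simplesP; exact: term_simple.
  - exact: stream_arrow.
  - by rewrite -stream_stateS.
apply/seteqP; split=> u.
  move=> [/= e hu]; rewrite in_itv /=.
  by apply/(path_cyl zeta N hu) => i hi; exact: (prodN_term_inj e).
move=> h; have hu := sub _ _ h; split=> //.
apply: prodN_eq; apply/(path_cyl zeta N hu).
by move: h; rewrite /= in_itv.
Qed.

Lemma measurable_path : @measurable_fun _ _ (measurableTypeR R) (MbarT k n) setT path.
Proof.
apply: (@measurability _ _ (measurableTypeR R) (MbarT k n) setT path (open_Mbar k n)) => //.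
move=> _ [U oU <-]; rewrite setTI (open_bigcup_cyl oU) preimage_bigcup.
apply: bigcupT_measurable => N; rewrite preimage_bigcup bigcup_mkcond.
apply: countable_bigcupT_measurable; first exact: countable_M.
move=> x; case: ifP => // _.
have [->|/set0P [zeta <-]] := eqVneq (cyl N.+1 x) set0.
  by rewrite preimage_set0; exact: measurable0.
set C := cyl _ _.
have -> : path @^-1` C = (path @^-1` C `&` unit_itv) `|` (path @^-1` C `&` ~` unit_itv).
  by rewrite -setIUr setUv setIT.
apply: measurableU; first by rewrite path_preimage_cyl; exact: measurable_itv.
(* [path] is constant outside [[0, 1[], and [1] represents these points: their part of the preimage
   is empty or everything. *)
have [h|h] := pselect (C (path 1)); last first.
  rewrite (_ : _ `&` _ = set0); first exact: measurable0.
  apply/seteqP; split=> // u [/= hC hu]; apply: h.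
  suff -> : path 1 = path u by [].
  apply: Mbar_ext => i; rewrite /path /term /= /path_term.
  case: asboolP => [h1|_]; first by move: h1; rewrite /unit_itv /= in_itv /= ltxx andbF.
  by case: asboolP.
rewrite (_ : _ `&` _ = ~` unit_itv); first by apply: measurableC; exact: measurable_itv.
apply/seteqP; split=> [u []|u hu] //; split=> //=.
suff -> : path u = path 1 by [].
apply: Mbar_ext => i; rewrite /path /term /= /path_term.
case: asboolP => // _; case: asboolP => // h1.
by move: h1; rewrite /unit_itv /= in_itv /= ltxx andbF.
Qed.

Lemma tree_uniform : exists nu : probability (MbarT k n) R, uniform nu p.
Proof.
have m01 : measurable (unit_itv : set (measurableTypeR R)) by exact: measurable_itv.
pose leb : {measure set (measurableTypeR R) -> \bar R} := mrestr (@lebesgue_measure R) m01.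
have leb1 : leb setT = 1%E.
  by rewrite /leb /= /mrestr setTI lebesgue_measure_itv /= lte_fin ltr01 sube0.
(* [leb] has mass 1 already, so normalizing leaves it unchanged and supplies the structure of a
   probability; the Dirac mass is the default for measures that cannot be normalized. *)
pose P : probability (measurableTypeR R) R := mnormalize leb (dirac (0 : measurableTypeR R)).
have PE A : P A = leb A.
  rewrite /P /= /mnormalize leb1 /=.
  have -> : (1%E == 0%E :> \bar R) = false by apply/negP => /eqP [] /eqP; rewrite oner_eq0.
  by rewrite /= invr1 mule1.
pose X : {mfun (measurableTypeR R) >-> MbarT k n} := HB.pack path (isMeasurableFun.Build _ _ (measurableTypeR R) (MbarT k n) path measurable_path).
exists (distribution P X); apply: uniform_of_cyl => zeta N.
transitivity (leb (path @^-1` cyl N.+1 (prodN zeta N.+1))); first exact: PE.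
rewrite /leb /= /mrestr path_preimage_cyl.
have hm : 0 <= mass (stream_state zeta N.+1).
  by rewrite mulr_ge0 ?hmob //; have [] := good_stream zeta N.+1.
rewrite lebesgue_measure_itv /= lte_fin ltrDl.
have -> : p ^+ len (prodN zeta N.+1) * mobius p (ext (term zeta N)) = mass (stream_state zeta N.+1).
  by rewrite /mass stream_coef stream_stateS.
case: ltP => h; first by rewrite -EFinB addrAC subrr add0r.
by congr EFin; apply/eqP; rewrite eq_le hm h.
Qed.

End Tree.

(** * The growth series *)

Import numFieldNormedType.Exports.

(** * The degenerate parameters 0 and 1 *)

Section Diracs.
Context {k : kind} {n : nat} {R : realType}.

Lemma uniform_dirac0 : uniform (\d_(embed (unitM k n)) : probability (MbarT k n) R) (0 : R).
Proof.
move=> x; change (dirac (embed (unitM k n)) (Uparrow x) = (0 ^+ len x)%:E :> \bar R).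
rewrite diracE /=; have [->|x1] := eqVneq x (unitM k n).
  by rewrite Uparrow1 in_setT len1 expr0.
rewrite expr0n; have -> : (len x == 0%N) = false.
  by apply/negP => /eqP/len_eq0 e; rewrite e eqxx in x1.
rewrite memNset // => /Uparrow_embed /leM1 e.
by rewrite e eqxx in x1.
Qed.

Lemma Delta_arrow : arrow (Delta k n) (Delta k n).
Proof. by move=> s _ /leM_len; rewrite len_mul len_gen addn1 ltnn. Qed.

Lemma term_Delta_inf i : term (Delta_inf k n) i = Delta k n.
Proof.
have ex : exists xi : Mbar k n, forall i, term xi i = Delta k n.
  by exists (mk_Mbar (fun _ => leMM _) (fun _ => Delta_arrow)).
exact: (xgetPex (Mbar_point k n) ex i).
Qed.

Lemma uniform_Delta_inf : uniform (\d_(Delta_inf k n) : probability (MbarT k n) R) (1 : R).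
Proof.
move=> x; change (dirac (Delta_inf k n) (Uparrow x) = (1 ^+ len x)%:E :> \bar R).
rewrite diracE expr1n mem_set //; apply/UparrowP.
suff -> N : prodN (Delta_inf k n) N = Dpow N by exact: le_Dpow.
elim: N => [//|N IH]; by rewrite prodNSr IH term_Delta_inf -DpowSr.
Qed.

End Diracs.

Lemma esumZl (R : realType) (T : choiceType) (S : set T) (a : T -> \bar R) (r : R) :
  0 <= r -> (forall x, 0 <= a x)%E ->
  (\esum_(x in S) (r%:E * a x) = r%:E * \esum_(x in S) a x)%E.
Proof.
move=> r0 a0; rewrite /esum -ereal_supZl //; last first.
  by apply/set0P; exists 0%E; exists set0; rewrite ?fsbig_set0 //; exact: fsets_set0.
congr ereal_sup; apply/seteqP; split.
- move=> _ [F hF <-]; exists (\sum_(x \in F) a x)%E; first by exists F.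
  by rewrite ge0_mule_fsumr.
- move=> _ [_ [F hF <-] <-]; exists F => //.
  by rewrite ge0_mule_fsumr.
Qed.

Section GrowthSeries.
Context {k : kind} {n : nat} {R : realType}.
Implicit Types (x y z : M k n) (Y : {set gen k n}) (p : R).

(** The measure giving each [x] in M the mass [p ^+ len x], before normalization; its total mass is
    G_n(p). *)
Definition gsum p (A : set (MbarT k n)) : \bar R :=
  \esum_(x in (@embed k n) @^-1` A) (p ^+ len x)%:E.

Lemma gsumT p : gsum p setT = \esum_(x in [set: M k n]) (p ^+ len x)%:E.
Proof. by rewrite /gsum preimage_setT. Qed.

Definition qset : set R := [set r | 0 <= r /\ (gsum r setT < +oo)%E].

Lemma qnE : qn k n R = ereal_sup [set r%:E | r in qset].
Proof. by rewrite /qn /qset; congr (ereal_sup (image _ _)); apply/funext => r /=; rewrite gsumT. Qed.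

Section Fixed.
Variable p : R.
Hypothesis p_ge0 : 0 <= p.

Lemma len_ge0 x : (0 <= (p ^+ len x)%:E)%E.
Proof. by rewrite lee_fin exprn_ge0. Qed.

Lemma gsum_ge0 A : (0 <= gsum p A)%E.
Proof. by apply: esum_ge0 => x _; exact: len_ge0. Qed.

Lemma gsumID A B : (gsum p A = gsum p (A `&` B) + gsum p (A `\` B))%E.
Proof. by rewrite /gsum (esumID (@embed k n @^-1` B)) // => x _; exact: len_ge0. Qed.

Lemma gsum_le A B : A `<=` B -> (gsum p A <= gsum p B)%E.
Proof.
move=> AB; rewrite (gsumID B A) (setIidr AB).
by rewrite leeDl // gsum_ge0.
Qed.

Lemma gsum_embed x : gsum p [set embed x] = (p ^+ len x)%:E.
Proof.
rewrite /gsum (_ : _ @^-1` _ = [set x]) ?esum_set1 ?len_ge0 //.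
by apply/seteqP; split=> [y /embed_inj //|y ->].
Qed.

Hypothesis Gfin : (gsum p setT < +oo)%E.

Lemma gsum_fin A : gsum p A \is a fin_num.
Proof. by rewrite ge0_fin_numE ?gsum_ge0 // (le_lt_trans _ Gfin) // gsum_le. Qed.

Definition gfine A := fine (gsum p A).

Lemma gfineK A : (gfine A)%:E = gsum p A.
Proof. by rewrite fineK // gsum_fin. Qed.

Lemma additive_gfine : additive_set gfine.
Proof.
move=> A B _ _; apply: EFin_inj.
have := gsumID A B; rewrite -!gfineK -EFinD => -[] ->.
by rewrite addrAC subrr add0r.
Qed.

Lemma gfine_Uparrow x : gfine (Uparrow x) = gfine setT * p ^+ len x.
Proof.
apply: EFin_inj; rewrite EFinM !gfineK gsumT /gsum.
rewrite (@reindex_esum R _ _ setT _ (mulM x)).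
  rewrite (eq_esum (b := fun z => ((p ^+ len x)%:E * (p ^+ len z)%:E)%E)).
    by rewrite esumZl ?exprn_ge0 1?muleC // => z; exact: len_ge0.
  by move=> z _; rewrite len_mul exprD EFinM.
split.
- by move=> z _ /=; apply/Uparrow_embed; exact: leM_mulr.
- by move=> z z' _ _; exact: mulM_inj.
- by move=> y /= /Uparrow_embed [z ->]; exists z.
Qed.

Lemma gfine_gt0 : 0 < gfine setT.
Proof.
apply: (@lt_le_trans _ _ 1) => //; rewrite -lee_fin gfineK.
by apply: le_trans (gsum_le (subsetT [set embed (unitM k n)])); rewrite gsum_embed len1 expr0.
Qed.

Lemma gfine_avoid Y : gfine (avoid (unitM k n) Y) = gfine setT * mobius p Y.
Proof.
by apply: (mobius_avoid additive_gfine) => X _; rewrite mul1M gfine_Uparrow.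
Qed.

Lemma gsum_mobius_ge0 Y : 0 <= mobius p Y.
Proof.
rewrite -(pmulr_rge0 _ gfine_gt0) -gfine_avoid -lee_fin gfineK.
exact: gsum_ge0.
Qed.

(** Only the unit is divisible by no generator, so inclusion-exclusion over all generators counts a
    single element. *)
Lemma gfine_Hn : gfine setT * Hn k n p = 1.
Proof.
rewrite HnE -gfine_avoid; apply: EFin_inj; rewrite gfineK.
suff -> : avoid (unitM k n) finset.setT = [set embed (unitM k n)].
  by rewrite gsum_embed len1 expr0.
rewrite embed_cyl len1 -{2}(@prodN_embed _ _ (unitM k n) 1) ?len1 //.
rewrite cyl_avoid prodN_embed ?len1 // term_embed ?len1 //; congr (avoid _ _).
by apply/esym/setP => s; rewrite finset.in_setT; apply/in_ext; rewrite mul1M; exact: gen_simple.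
Qed.

(** Finite sums of atoms give one inequality on every measurable set. Both sides have total mass 1,
    so the same inequality on the complement gives the other. *)
Lemma singletons_gfine (nu : probability (MbarT k n) R) :
  (forall x, nu [set embed x] = (Hn k n p * p ^+ len x)%:E) ->
  forall A, measurable A -> fine (nu A) = Hn k n p * gfine A.
Proof.
move=> hnu.
have G0 := gfine_gt0; have HG := gfine_Hn.
have lower A : measurable A -> Hn k n p * gfine A <= fine (nu A).
  move=> mA; rewrite -(ler_pM2l G0) mulrA HG mul1r -lee_fin gfineK.
  apply: ub_ereal_sup => _ [F [Ffin FA] <-].
  rewrite fsbig_finite //= sumEFin lee_fin.
  have -> : \sum_(x <- fset_set F) p ^+ len x =
      gfine setT * \sum_(x <- fset_set F) fine (nu [set embed x]).
    by rewrite mulr_sumr; apply: eq_bigr => x _; rewrite hnu /= mulrA HG mul1r.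
  rewrite ler_pM2l // -lee_fin nu_fineK // -sumEFin.
  rewrite (eq_bigr (fun x => nu [set embed x])); last first.
    by move=> x _; rewrite nu_fineK //; exact: measurable_embed.
  rewrite -fsbig_finite // -measure_fin_bigcup //.
  - apply: le_measure; rewrite ?inE //; last by move=> _ [x Fx ->]; exact: FA.
    by apply: fin_bigcup_measurable => // x _; exact: measurable_embed.
  - by move=> x y _ _ [xi [-> /embed_inj]].
  - by move=> x _; exact: measurable_embed.
move=> A mA; apply/eqP; rewrite eq_le lower // andbT.
have := lower _ (measurableC mA); have := additive_nuT nu measurableT mA.
have := additive_gfine measurableT mA.
rewrite setTI setTD /= => -> ->; rewrite probability_setT /= mulrBr [Hn k n p * gfine setT]mulrC HG.
by rewrite lerD2l lerN2.
Qed.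

End Fixed.

Lemma gsum_Mset p (nu : probability (MbarT k n) R) :
  0 <= p -> (gsum p setT < +oo)%E ->
  (forall x, nu [set embed x] = (Hn k n p * p ^+ len x)%:E) -> nu (Mset k n) = 1%E.
Proof.
move=> p0 G h; rewrite -(nu_fineK nu measurable_Mset) (singletons_gfine p0 G h); last exact: measurable_Mset.
suff -> : gfine p (Mset k n) = gfine p setT by rewrite mulrC gfine_Hn.
rewrite /gfine /gsum; congr (fine (esum _ _)).
by apply/seteqP; split=> // x _; exists x.
Qed.

Lemma mobius_continuous Y : continuous (fun p : R => mobius p Y).
Proof.
pose P : {poly R} := \sum_(X : {set gen k n} | X \subset Y) (-1) ^+ #|X| *: 'X^(len (DeltaX X)).
have -> : (fun p : R => mobius p Y) = horner P.
  apply/funext => p; rewrite /P horner_sum; apply: eq_bigr => X _.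
  by rewrite hornerZ hornerXn.
exact: continuous_horner.
Qed.

Lemma mobius_left_limit p Y : 0 < p ->
  (forall r, 0 <= r < p -> 0 <= mobius r Y) -> 0 <= mobius p Y.
Proof.
move=> p0 h; rewrite leNgt; apply/negP => neg.
have near_neg : \forall t \near p, mobius t Y < 0.
  exact: (@cvgr_lt R R (nbhs p) _ (fun t => mobius t Y) _ (@mobius_continuous Y p) 0 neg).
case/nbhs_ballP: near_neg => e /= e0 he.
pose r := Num.max 0 (p - e / 2).
have hr : 0 <= r < p.
  by rewrite /r le_max lexx /= gt_max p0 /= ltrBlDr ltrDl divr_gt0.
have : mobius r Y < 0.
  apply: he; rewrite /ball /= ltr_norml.
  have : p - e / 2 <= r by rewrite /r le_max lexx orbT.
  by move: hr e0 => /andP[_ h1] h2 h3; apply/andP; split; lra.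
by rewrite ltNge h.
Qed.

End GrowthSeries.

Lemma qn_ge0 k n (R : realType) : (0 <= qn k n R)%E.
Proof.
rewrite qnE; apply: ereal_sup_ubound; exists 0 => //; split => //.
rewrite (gsumID (lexx 0) _ [set embed (unitM k n)]) setTI gsum_embed // len1 expr0.
rewrite /gsum esum1; first by rewrite adde0 ltry.
move=> x [_ /= hx]; rewrite expr0n; case: eqP => // /len_eq0 e.
by case: hx; rewrite e.
Qed.

Lemma lt_qn k n (R : realType) (p : R) : 0 <= p -> (p%:E < qn k n R)%E ->
  (@gsum k n R p setT < +oo)%E.
Proof.
move=> p0; rewrite qnE => /ereal_sup_gt [_ [r [r0 hr] <-]].
rewrite lte_fin => pr; apply: le_lt_trans hr; apply: le_esum => x _.
by rewrite lee_fin lerXn2r // ?nnegrE // ltW.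
Qed.

Lemma uniform_ex k n (R : realType) (p : R) : 0 <= p -> (p%:E <= qn k n R)%E ->
  exists nu : probability (MbarT k n) R, uniform nu p.
Proof.
move=> p0; have [->|pn0] := eqVneq p 0.
  by move=> _; exists (dirac (embed (unitM k n))); exact: uniform_dirac0.
have {}p0 : 0 < p by rewrite lt_neqAle eq_sym pn0.
move=> pq; apply: tree_uniform; first exact: ltW.
move=> x _; apply: mobius_left_limit => // r /andP[r0 rp].
apply: (gsum_mobius_ge0 r0); apply: lt_qn => //.
by apply: lt_le_trans pq; rewrite lte_fin.
Qed.

(** * Nonexistence beyond the radius of convergence *)


Section Nonexistence.
Context {k : kind} {n : nat} {R : realType}.
Implicit Types (x y z : M k n) (Y : {set gen k n}) (p : R).

Lemma height_ex x : exists N, `[< prodN (embed x) N = x >].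
Proof. by exists (len x); apply/asboolP; rewrite prodN_embed. Qed.

(** The number of non-unit terms of the normal form of [x]. *)
Definition height x := ex_minn (height_ex x).

Lemma prodN_height x : prodN (embed x) (height x) = x.
Proof. by rewrite /height; case: ex_minnP => N /asboolP. Qed.

Lemma height_le x : (height x <= len x)%N.
Proof. by rewrite /height; case: ex_minnP => N _; apply; apply/asboolP; rewrite prodN_embed. Qed.

Lemma height_last x N : height x = N.+1 -> term (embed x) N <> unitM k n.
Proof.
move=> h e; suff : (height x <= N)%N by rewrite h ltnn.
rewrite {1}/height; case: ex_minnP => m _; apply; apply/asboolP.
by have := prodN_height x; rewrite h prodNSr e mulM1.
Qed.

Lemma height0 x : height x = 0%N -> x = unitM k n.
Proof. by move=> h; have := prodN_height x; rewrite h prodN0 => <-. Qed.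

Lemma sum_cyl_le1 (nu : probability (MbarT k n) R) N (l : seq (M k n)) : uniq l ->
  \sum_(x <- l) fine (nu (cyl N x)) <= 1.
Proof.
move=> ul; pose U (l : seq (M k n)) : set (MbarT k n) := [set xi | prodN xi N \in l].
have mU l' : measurable (U l').
  have -> : U l' = \bigcup_(x in [set x | x \in l']) cyl N x.
    by apply/seteqP; split=> xi; [move=> h; exists (prodN xi N)|move=> [x h e]; rewrite /U /= e].
  by apply: bigcupM_measurable => x; exact: measurable_cyl.
suff -> : \sum_(x <- l) fine (nu (cyl N x)) = fine (nu (U l)).
  by rewrite -lee_fin nu_fineK // probability_le1.
elim: l ul => [|x l IH] /=.
  rewrite big_nil (_ : U [::] = set0) ?measure0 //.
  by apply/seteqP; split=> xi //; rewrite /U /= in_nil.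
move=> /andP[xl ul]; rewrite big_cons IH //.
have := additive_nuT nu (mU (x :: l)) (measurable_cyl N x) => /=.
have -> : U (x :: l) `\` cyl N x = U l.
  apply/seteqP; split=> xi /=; rewrite /U /cyl /= inE.
    by move=> [/predU1P[//|]].
  by move=> h; rewrite h orbT; split=> // e; move: xl; rewrite -e h.
have -> : U (x :: l) `&` cyl N x = cyl N x.
  by apply/setIidPr => xi; rewrite /U /cyl /= inE => ->; rewrite eqxx.
by move=> ->; rewrite addrC subrK.
Qed.

Lemma finite_lower_bound (T : finType) (f : T -> R) (P : pred T) :
  (forall t, P t -> 0 < f t) -> exists2 c, 0 < c & forall t, P t -> c <= f t.
Proof.
move=> h; suff [c c0 hc] : exists2 c, 0 < c & forall t, t \in enum P -> c <= f t.
  by exists c => // t Pt; apply: hc; rewrite mem_enum.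
have : forall t, t \in enum P -> 0 < f t by move=> t; rewrite mem_enum => /h.
elim: (enum P) => [|t l IH] hl; first by exists 1.
have [|c c0 hc] := IH; first by move=> s sl; apply: hl; rewrite inE sl orbT.
exists (Num.min c (f t)); first by rewrite lt_min c0 hl // inE eqxx.
move=> s; rewrite inE => /predU1P[->|/hc hs]; first by rewrite ge_min lexx orbT.
by rewrite ge_min hs.
Qed.

(* If [c] bounds [mobius p Y] from below for [Y] proper, the elements [x] of
   height [N > 0] satisfy [c * p ^+ len x <= nu (cyl N x)], hence the sum of
   [p ^+ len x] over them is at most [c^-1]. As [height x <= len x], the growth
   series converges geometrically at every [r < p]. *)
Lemma uniform_gsum_fin (nu : probability (MbarT k n) R) p r :
  uniform nu p -> p < 1 -> 0 < r < p -> (@gsum k n R r setT < +oo)%E.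
Proof.
move=> hnu p1 /andP[r0 rp]; have p0 := lt_trans r0 rp.
have [c c0 hc] := @finite_lower_bound _ (fun Y : {set gen k n} => mobius p Y)
  (fun Y => Y != finset.setT) (fun Y => mobius_gt0 hnu p0 p1).
pose rho := r / p.
have rho0 : 0 < rho by rewrite divr_gt0.
have rho1 : rho < 1 by rewrite ltr_pdivrMr // mul1r.
have rE m : r ^+ m = rho ^+ m * p ^+ m by rewrite -exprMn /rho divfK // gt_eqF.
have level N (l : seq (M k n)) : uniq l -> (forall x, x \in l -> height x = N.+1) ->
    \sum_(x <- l) p ^+ len x <= c^-1.
  move=> ul hl; rewrite -(ler_pM2l c0) divff ?gt_eqF // mulr_sumr.
  apply: le_trans (sum_cyl_le1 nu N.+1 ul).
  rewrite big_seq [leRHS]big_seq; apply: ler_sum => x /hl hx.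
  have := uniform_cyl hnu (embed x) N; rewrite -hx prodN_height => -> /=.
  rewrite mulrC ler_wpM2l ?exprn_ge0 ?(ltW p0) // hc //.
  apply/eqP => e; apply: (height_last hx).
  by apply: ext_setT e; exact: term_simple.
(* The term 1 accounts for the unit, the only element of height 0; height [N.+1] contributes at most
   [rho ^+ N * c^-1]. *)
suff bound (l : seq (M k n)) : uniq l -> \sum_(x <- l) r ^+ len x <= 1 + c^-1 / (1 - rho).
  apply: (@le_lt_trans _ _ (1 + c^-1 / (1 - rho))%:E); last exact: ltry.
  apply: ub_ereal_sup => _ [F [Ffin _] <-].
  by rewrite fsbig_finite //= sumEFin lee_fin bound // fset_uniq.
move=> ul.
rewrite (bigID (fun x => x == unitM k n)) /=; apply: lerD.
  rewrite (eq_bigr (fun=> 1)); last by move=> x /eqP ->; rewrite len1 expr0.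
  by rewrite big_const_seq iter_addr_0 -[leRHS](mulr1n 1) ler_wpMn2l // count_uniq_mem // leq_b1.
pose K := (\max_(x <- l) height x).+1.
have hK x : x \in l -> (height x < K)%N.
  by move=> xl; rewrite ltnS; exact: leq_bigmax_seq.
apply: (@le_trans _ _ (\sum_(x <- l | x != unitM k n) \sum_(N < K)
    (if height x == N.+1 then rho ^+ N * p ^+ len x else 0))).
  rewrite big_seq_cond [leRHS]big_seq_cond; apply: ler_sum => x /andP[xl x1].
  case E: (height x) => [|N]; first by rewrite (height0 E) eqxx in x1.
  have NK : (N < K)%N by apply: ltnW; rewrite -E; exact: hK.
  rewrite (bigD1 (Ordinal NK)) //= eqxx big1 ?addr0; last first.
    by move=> i hi; case: eqP => // -[e]; move: hi; rewrite -val_eqE /= e eqxx.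
  rewrite rE ler_wpM2r ?exprn_ge0 ?(ltW p0) //.
  apply: ler_wiXn2l; rewrite ?ltW //.
  by apply: leq_trans (height_le x); rewrite E.
rewrite exchange_big /=.
apply: (@le_trans _ _ (\sum_(N < K) rho ^+ N * c^-1)).
  apply: ler_sum => N _.
  rewrite -big_mkcondr /= -mulr_sumr ler_wpM2l ?exprn_ge0 ?(ltW rho0) //.
  rewrite -big_filter; apply: (@level N); first exact: filter_uniq.
  by move=> x; rewrite mem_filter => /andP[/andP[_ /eqP]].
rewrite -mulr_suml mulrC ler_pM2l ?invr_gt0 //.
rewrite -(ler_pM2r (_ : 0 < 1 - rho)) ?subr_gt0 // mulVf ?gt_eqF ?subr_gt0 //.
have := subrX1 rho K; have : 0 <= rho ^+ K by rewrite exprn_ge0 // ltW.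
set s := \sum_(i < K) _; set t := rho ^+ K; nra.
Qed.

Lemma uniform_le_qn (nu : probability (MbarT k n) R) p :
  uniform nu p -> p < 1 -> (p%:E <= qn k n R)%E.
Proof.
move=> hnu p1; rewrite leNgt; apply/negP => qp.
have qfin : qn k n R \is a fin_num by rewrite ge0_fin_numE ?qn_ge0 // (lt_trans qp) // ltry.
have q0 : 0 <= fine (qn k n R) by rewrite fine_ge0 // qn_ge0.
move: qp; rewrite -(fineK qfin) lte_fin; set q := fine _ in q0 * => qp.
pose r := (q + p) / 2.
have hr : 0 < r < p by rewrite /r; lra.
have : (r%:E <= qn k n R)%E.
  rewrite qnE; apply: ereal_sup_ubound; exists r => //; split; first by case/andP: hr => /ltW.
  exact: (uniform_gsum_fin hnu p1 hr).
rewrite -(fineK qfin) lee_fin -/q /r; lra.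
Qed.

Lemma uniform_le1 (nu : probability (MbarT k n) R) p : (2 <= n)%N -> uniform nu p -> p <= 1.
Proof.
move=> n2 hnu.
have [s _] : exists s : gen k n, gv s = (1, 2)%N.
  by apply: gv_onto; rewrite /raw_valid /= n2; case: k.
have := probability_le1 nu (measurable_Uparrow (genM s)).
by rewrite hnu len_gen expr1 lee_fin.
Qed.

Lemma Hn1 : (2 <= n)%N -> Hn k n (1 : R) = 0.
Proof.
move=> n2; have [s _] : exists s : gen k n, gv s = (1, 2)%N.
  by apply: gv_onto; rewrite /raw_valid /= n2; case: k.
rewrite HnE /mobius (eq_bigr (fun X : {set gen k n} => (-1) ^+ #|X|)); last first.
  by move=> X _; rewrite expr1n mulr1.
rewrite sum_alternating (_ : _ == _ = false) //.
by apply/negP => /eqP e; have := finset.in_setT s; rewrite e inE.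
Qed.

(* If [H_n(q) > 0], all Moebius values at [q] are positive, hence remain so
   slightly beyond [q], where a uniform measure would then exist. *)
Lemma Hn_qn (nu : probability (MbarT k n) R) p : (2 <= n)%N ->
  p%:E = qn k n R -> uniform nu p -> Hn k n p = 0.
Proof.
move=> n2 pq hnu; apply/eqP/negPn/negP => H0.
have Hpos : 0 < Hn k n p by rewrite lt_neqAle eq_sym H0 HnE (uniform_mobius_ge0 hnu).
have p1 : p < 1.
  rewrite lt_neqAle (uniform_le1 n2 hnu) andbT; apply: contra H0 => /eqP ->.
  by rewrite Hn1.
have pos Y : 0 < mobius p Y.
  apply: lt_le_trans Hpos _; rewrite HnE; apply: (uniform_mobius_le hnu).
  exact: finset.subsetT.
have near_pos : \forall t \near p, forall Y : {set gen k n}, 0 < mobius t Y.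
  apply: (@filter_forall _ _ (fun Y : {set gen k n} => [set t | 0 < mobius t Y]) (nbhs p)).
  move=> Y; exact: (@cvgr_gt R R (nbhs p) _ (fun t => mobius t Y) _ (@mobius_continuous _ _ _ Y p) 0 (pos Y)).
case/nbhs_ballP: near_pos => e /= e0 he.
(* The first bound keeps [r] where all Moebius values are positive, the second keeps it below 1, as
   [uniform_le_qn] requires. *)
pose r := Num.min (p + e / 2) ((p + 1) / 2).
have p0 : 0 <= p by rewrite -lee_fin pq qn_ge0.
have [hr1 hr2] : p < r < 1 /\ r <= p + e / 2.
  by rewrite /r lt_min gt_min ge_min lexx; split => //; apply/andP; split; [apply/andP|apply/orP; right]; lra.
have r_pos Y : 0 < mobius r Y.
  apply: he; rewrite /ball /= ltr_norml; apply/andP; split; lra.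
have [nu' hnu'] : exists nu : probability (MbarT k n) R, uniform nu r.
  apply: tree_uniform; first by lra.
  by move=> x _; exact: ltW.
have : (r%:E <= qn k n R)%E by apply: (uniform_le_qn hnu'); lra.
by rewrite -pq lee_fin; lra.
Qed.

Lemma Mset_null (nu : probability (MbarT k n) R) :
  (forall x, nu [set embed x] = 0%E) -> nu (Mset k n) = 0%E.
Proof.
move=> h.
pose F (i : nat) : set (MbarT k n) :=
  if choice.unpickle i is Some w then [set embed (cls (w : word k n))] else set0.
have mF i : measurable (F i).
  by rewrite /F; case: choice.unpickle => [w|]; [exact: measurable_embed|exact: measurable0].
have cover : Mset k n `<=` \bigcup_i F i.
  move=> _ [x _ <-]; exists (choice.pickle (rep x)) => //.
  by rewrite /F choice.pickleK cls_rep.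
have : nu.-negligible (\bigcup_i F i).
  apply: negligible_bigcup => i; exists (F i); split=> //.
  by rewrite /F; case: choice.unpickle => [w|]; [exact: h|exact: measure0].
move=> /(negligibleS cover) /negligibleP; apply.
exact: measurable_Mset.
Qed.

End Nonexistence.

Theorem theorem4p8 (k : kind) (n : nat) (R : realType) : (2 <= n)%N ->
  (* existence iff p in [0,q_n] \cup {1} *)
  (forall p : R, 0 <= p ->
     ((exists nu : probability (MbarT k n) R, uniform nu p) <->
      ((p%:E <= qn k n R)%E \/ p = 1))) /\
  (* uniqueness *)
  (forall p : R, 0 <= p -> forall nu1 nu2 : probability (MbarT k n) R,
     uniform nu1 p -> uniform nu2 p ->
     forall A : set (MbarT k n), measurable A -> nu1 A = nu2 A) /\
  (* (1) *)
  (forall nu : probability (MbarT k n) R, uniform nu 0 ->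
     forall A : set (MbarT k n), measurable A -> nu A = \d_(embed (unitM k n)) A) /\
  (* (2) *)
  (forall nu : probability (MbarT k n) R, uniform nu 1 ->
     forall A : set (MbarT k n), measurable A -> nu A = \d_(Delta_inf k n) A) /\
  (* (3) *)
  (forall p : R, 0 < p -> (p%:E < qn k n R)%E ->
     forall nu : probability (MbarT k n) R, uniform nu p ->
       nu (Mset k n) = 1%E /\
       (forall x : M k n, nu [set embed x] = (Hn k n p * p ^+ len x)%:E) /\
       (forall nu' : probability (MbarT k n) R,
          (forall x : M k n, nu' [set embed x] = (Hn k n p * p ^+ len x)%:E) ->
          forall A : set (MbarT k n), measurable A -> nu' A = nu A)) /\
  (* (4) *)
  (forall p : R, p%:E = qn k n R ->
     forall nu : probability (MbarT k n) R, uniform nu p ->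
       nu (boundary k n) = 1%E /\
       (forall x : M k n, nu (uparrow x) = (p ^+ len x)%:E) /\
       (forall nu' : probability (MbarT k n) R,
          (forall x : M k n, nu' (uparrow x) = (p ^+ len x)%:E) ->
          forall A : set (MbarT k n), measurable A -> nu' A = nu A)).
Proof.
move=> n2; split; [|split; [|split; [|split; [|split]]]].
- move=> p p0; split=> [[nu hnu]|[pq| ->]].
  + have := uniform_le1 n2 hnu; rewrite le_eqVlt => /predU1P[|p1]; first by right.
    by left; exact: uniform_le_qn hnu p1.
  + exact: uniform_ex.
  + by exists (dirac (Delta_inf k n)); exact: uniform_Delta_inf.
- by move=> p _ nu1 nu2 h1 h2; exact: uniform_unique h1 h2.
- by move=> nu hnu A mA; exact: (uniform_unique hnu uniform_dirac0 mA).
- by move=> nu hnu A mA; exact: (uniform_unique hnu uniform_Delta_inf mA).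
- move=> p /ltW p0 pq nu hnu; have G := lt_qn p0 pq.
  have hx := uniform_embed hnu.
  split; first exact: gsum_Mset G hx.
  split=> // nu' hx' A mA.
  by rewrite -(nu_fineK nu' mA) -(nu_fineK nu mA) !(singletons_gfine p0 G).
- move=> p pq nu hnu.
  have bd (mu : probability (MbarT k n) R) : mu (boundary k n) = (1 - mu (Mset k n))%E.
    by apply: probability_setC; exact: measurable_Mset.
  have M0 : nu (Mset k n) = 0%E.
    apply: Mset_null => x; rewrite (uniform_embed hnu) (Hn_qn n2 pq hnu).
    by rewrite mul0r.
  have split_up (mu : probability (MbarT k n) R) x : mu (Mset k n) = 0%E ->
      mu (uparrow x) = mu (Uparrow x).
    move=> mu0; have mM := @measurable_Mset k n; have mx := measurable_Uparrow x.
    have z : mu (Uparrow x `&` Mset k n) = 0%E.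
      apply/eqP; rewrite eq_le measure_ge0 andbT -mu0.
      by apply: le_measure; rewrite ?inE; [exact: measurableI|exact: mM|exact: subIsetr].
    have := additive_nuT mu mx mM; rewrite /= z subr0 /uparrow /boundary -setDE => e.
    by rewrite -(nu_fineK mu (measurableD mx mM)) e nu_fineK.
  split; first by rewrite bd M0 sube0.
  split=> [x|nu' hx' A mA]; first by rewrite split_up.
  (* At the unit, [uparrow] is the whole boundary and the prescribed value is 1. Once M is null,
     [uparrow] and [Uparrow] have the same mass, so [nu'] is uniform. *)
  have M0' : nu' (Mset k n) = 0%E.
    have := hx' (unitM k n); rewrite len1 expr0 /uparrow Uparrow1 setTI bd.
    rewrite -(nu_fineK nu' (@measurable_Mset k n)) -EFinB => -[e].
    by congr EFin; lra.
  have hnu' : uniform nu' p by move=> x; rewrite -split_up.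
  exact: uniform_unique hnu' hnu _ mA.
Qed.
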